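(* There exist positive absolute constants $K_4,K_5$ such that for all $n\ge2$, all real $n\times n$ matrices $A$ with $\sigma_A>0$, and all positive constants $C_1$ for which $$|\Delta_y^2F_B(z)|\le C_1\,(D_A^2+y^2)\qquad\text{for all } z\in\mathbb{R},\ 0\le y\le D_A,\ B\in N(8,\hat A),$$ we have $$\sup_{z\in\mathbb{R}}\big|\mathscr{F}_A(z)-e_{1,A}(z)\big|\le (K_4C_1+K_5)\,D_A^2 .$$
   Context: For a real $n\times n$ matrix $A=(a_{ij})$, $n\ge2$: $\mu_A=\frac1n\sum_{i,j}a_{ij}$; $\breve a_{ij}=a_{ij}-\frac1n\sum_l a_{il}-\frac1n\sum_k a_{kj}+\frac1{n^2}\sum_{k,l}a_{kl}$; $\sigma_A^2=\frac1{n-1}\sum_{i,j}\breve a_{ij}^2$ ($\sigma_A\ge0$); if $\sigma_A>0$, $\hat a_{ij}=\breve a_{ij}/\sigma_A$ and $\hat A=(\hat a_{ij})$. Let $\pi$ be a uniformly distributed random permutation of $\{1,\dots,n\}$; $\mathscr{F}_A$ is the distribution function of $\mathscr{T}_A=\big(\sum_i a_{i\pi(i)}-\mu_A\big)/\sigma_A=\sum_i\hat a_{i\pi(i)}$. For any real square $m\times m$ matrix $B=(b_{ij})$, $m\ge 1$, $F_B$ is the distribution function of $T_B=\sum_i b_{i\rho(i)}$, where $\rho$ is a uniformly distributed random permutation of $\{1,\dots,m\}$. For $l\in\mathbb{N}_0$, $N(l,A)$ is the set of all matrices obtainable from $A$ by deleting $r$ rows and $r$ columns for some $0\le r\le\min\{l,n-1\}$.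 $\Delta_y^2F(z)=F(z+2y)-2F(z+y)+F(z)$. Put $D_A=\big(\frac1n\sum_{i,j}|\hat a_{ij}|^4\big)^{1/2}$, $\lambda_{1,A}=\frac1n\sum_{i,j}\hat a_{ij}^3$ and $e_{1,A}(x)=\Phi(x)-\frac16\lambda_{1,A}(x^2-1)\psi(x)$, where $\Phi$ is the standard normal distribution function and $\psi=\Phi'$. *)

(* Defs.v *)
From mathcomp Require Import all_boot all_order all_algebra all_fingroup.
From mathcomp Require Import all_classical all_reals all_analysis.
Import Order.TTheory GRing.Theory Num.Theory numFieldNormedType.Exports.

Set Implicit Arguments.
Unset Strict Implicit.
Unset Printing Implicit Defensive.

Local Open Scope classical_set_scope.
Local Open Scope ring_scope.

Section Matrices.
Variables (R : realType) (n : nat).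
Implicit Type A : 'M[R]_n.

Definition mu A : R := n%:R^-1 * \sum_i \sum_j A i j.

Definition breve_mx A : 'M[R]_n :=
  \matrix_(i, j) (A i j - n%:R^-1 * (\sum_l A i l) - n%:R^-1 * (\sum_k A k j)
                  + (n%:R ^+ 2)^-1 * \sum_k \sum_l A k l).

Definition sigma A : R :=
  Num.sqrt ((n%:R - 1)^-1 * \sum_i \sum_j (breve_mx A i j) ^+ 2).

(* Only meaningful when 0 < sigma A. *)
Definition hat_mx A : 'M[R]_n := \matrix_(i, j) (breve_mx A i j / sigma A).

Definition D A : R :=
  Num.sqrt (n%:R^-1 * \sum_i \sum_j `|hat_mx A i j| ^+ 4).

Definition lambda1 A : R := n%:R^-1 * \sum_i \sum_j (hat_mx A i j) ^+ 3.

(* The combinatorial sum of A along the permutation s, and its standardization;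
   permutations are drawn uniformly. *)
Definition perm_sum A (s : 'S_n) : R := \sum_i A i (s i).

Definition std_perm_sum A (s : 'S_n) : R := (perm_sum A s - mu A) / sigma A.

End Matrices.

Definition unif_prob (R : realType) (T : finType) (E : {pred T}) : R :=
  #|E|%:R / #|T|%:R.

(* Distribution function of X : T -> R under the uniform probability on T. *)
Definition unif_cdf (R : realType) (T : finType) (X : T -> R) (z : R) : R :=
  unif_prob R [pred t : T | X t <= z].

Definition F (R : realType) (m : nat) (B : 'M[R]_m) : R -> R :=
  unif_cdf (perm_sum B).

Definition Fstd (R : realType) (n : nat) (A : 'M[R]_n) : R -> R :=
  unif_cdf (std_perm_sum A).

(* N l A B: B arises from A by deleting r rows and r columns, for some
   0 <= r <= min(l, n - 1).  The increasing maps f and g list the indices of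
   the remaining rows and columns. *)
Definition N (R : realType) (l n : nat) (A : 'M[R]_n) (m : nat) (B : 'M[R]_m) :
    Prop :=
  exists (r : nat) (f g : 'I_m -> 'I_n),
    [/\ (r <= minn l (n - 1))%N, (m + r)%N = n,
        {homo f : i j / (i < j)%N}, {homo g : i j / (i < j)%N}
      & B = mxsub f g A].

Definition Delta2 (R : realType) (y : R) (G : R -> R) (z : R) : R :=
  G (z + 2 * y) - 2 * G (z + y) + G z.

Definition Phi (R : realType) (x : R) : R :=
  fine (normal_prob 0 1 `]-oo, x]).

Definition psi (R : realType) : R -> R := derive1 (@Phi R).

Definition e1 (R : realType) (n : nat) (A : 'M[R]_n) (x : R) : R :=
  Phi x - 6^-1 * lambda1 A * (x ^+ 2 - 1) * psi x.

(* Main.v *)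
(* Stein's method.  Write a for the standardized matrix, T for its random
   permutation sum and D for D_A, and let h be a smoothing at scale D of the
   indicator of ]-oo, z].  Since E h(T) averages the distribution function F
   over a kernel symmetric about z, the difference E h(T) - F(z) averages second
   differences of F and is O(C1 D^2) by hypothesis.  The equation
     f'(x) = (x f(x) + h(x) - c) (1 - kappa(x)),
   where kappa is a bounded function close to (l / 2) x with l = n lambda_1 / (n - 1),
   has a bounded solution for exactly one constant c; integrating it against
   the density (1 + lambda_1 x^3 / 6) psi(x) shows c = e_1(z) + O(D^2).
   Using twice the exchangeable pair formed by the random permutation and its
   composition with a random transposition yields
     E[T f(T)] = E[f'(T)] + (l / 2) E[T f'(T)] + O((1 + C1) D^2),
   because T_{a^2} - E T_{a^2} - l T is again the permutation sum of a doubly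
   centered matrix, orthogonal to a.  Hence E h(T) = c + O((1 + C1) D^2).
   In the Taylor remainders f'' varies on the scale D, but conditionally on two
   values of the permutation T is a shift of T_B with B in N(2, a), and the
   hypothesis on F_B makes t |-> E f''(T_B + t) Lipschitz. *)
Require Import Defs.
From mathcomp Require Import all_boot all_order all_algebra all_fingroup.
From mathcomp Require Import all_classical all_reals all_analysis.
From HB Require Import structures.
From mathcomp Require Import ring lra zify.
Import Order.TTheory GRing.Theory Num.Theory numFieldNormedType.Exports.

Set Implicit Arguments.
Unset Strict Implicit.
Unset Printing Implicit Defensive.

Local Open Scope classical_set_scope.
Local Open Scope ring_scope.

(** * Derivatives of real functions *)

Section RealDerivatives.
Variable R : realType.
Implicit Types (f g df dg : R -> R) (x y z a b c M : R).

(** The second derivative of [f] reaches size 1/D on a window of width 2D, so pointwise Taylor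
    bounds would lose a factor 1/D. The Taylor remainders are therefore averaged over the
    permutation outside two rows before absolute values are taken. There the hypothesis acts twice:
    it bounds the Lipschitz constant of the averaged kernel and, combined with a second moment, it
    yields P(u < T_B <= u + D) = O(D / (1 + |u|)). The decay in u pays for a factor 1 + |x| that the
    Stein equation puts in front of the kernel.

    Where f'' is bounded pointwise by O(1/D + |x|), it comes with a factor 1/n, which Cauchy-Schwarz
    bounds by 4 D^2, and with [T Tb] or [offdiag a beta], whose mean size is O(D). Orthogonality of
    beta to a removes the constant from the conditional covariance of the increments and centers the
    permutation sum of the entrywise product of a and beta, so that a third use of the pair controls
    its product with f''.

    If D is bounded below the claim is trivial; otherwise n > 6, and the minors are large enough for
    uniform moment bounds. *)

Definition has_deriv f df := forall x, is_derive x 1 f (df x).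

Lemma has_deriv_eq f df dg : has_deriv f df -> df =1 dg -> has_deriv f dg.
Proof. by move=> fd e x; rewrite -e. Qed.

Lemma has_deriv_continuous f df : has_deriv f df -> continuous f.
Proof.
by move=> fd x; apply/differentiable_continuous/derivable1_diffP; have [] := fd x.
Qed.

Lemma has_derivC c : has_deriv (fun=> c) (fun=> 0).
Proof. by move=> x; apply: is_derive_cst. Qed.

Lemma has_derivX : has_deriv id (fun=> 1).
Proof. by move=> x; apply: is_derive_id. Qed.

Lemma has_derivD f g df dg : has_deriv f df -> has_deriv g dg ->
  has_deriv (fun x => f x + g x) (fun x => df x + dg x).
Proof. by move=> fd gd x; apply: is_deriveD. Qed.

Lemma has_derivN f df : has_deriv f df ->
  has_deriv (fun x => - f x) (fun x => - df x).
Proof. by move=> fd x; apply: is_deriveN. Qed.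

Lemma has_derivB f g df dg : has_deriv f df -> has_deriv g dg ->
  has_deriv (fun x => f x - g x) (fun x => df x - dg x).
Proof. by move=> fd gd x; apply: is_deriveB. Qed.

Lemma has_derivM f g df dg : has_deriv f df -> has_deriv g dg ->
  has_deriv (fun x => f x * g x) (fun x => df x * g x + f x * dg x).
Proof.
move=> fd gd x; apply: (is_derive_eq (is_deriveM (fd x) (gd x))).
by rewrite /GRing.scale /= addrC mulrC.
Qed.

Lemma has_derivZ c f df : has_deriv f df ->
  has_deriv (fun x => c * f x) (fun x => c * df x).
Proof.
move=> fd; apply: has_deriv_eq (has_derivM (has_derivC c) fd) _ => x.
by rewrite mul0r add0r.
Qed.

Lemma has_deriv_comp f g df dg : has_deriv f df -> has_deriv g dg ->
  has_deriv (fun x => f (g x)) (fun x => df (g x) * dg x).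
Proof. by move=> fd gd x; apply: is_derive1_comp (fd _) (gd _). Qed.

Lemma has_deriv_shift f df t : has_deriv f df ->
  has_deriv (fun x => f (x + t)) (fun x => df (x + t)).
Proof.
move=> fd; apply: has_deriv_eq.
  exact: has_deriv_comp fd (has_derivD has_derivX (has_derivC t)).
by move=> x; rewrite addr0 mulr1.
Qed.

Lemma has_derivXn n : has_deriv (fun x => x ^+ n) (fun x => n%:R * x ^+ n.-1).
Proof.
elim: n => [|n IHn].
  by apply: has_deriv_eq (has_derivC 1) _ => x; rewrite mul0r.
have H : has_deriv (fun x => x * x ^+ n) (fun x => 1 * x ^+ n + x * (n%:R * x ^+ n.-1)).
  exact: has_derivM has_derivX IHn.
move=> x; have -> : (fun y : R => y ^+ n.+1) = (fun y => y * y ^+ n).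
  by apply/funext => y; rewrite exprS.
apply: is_derive_eq (H x) _; case: n {IHn H} => [|n] /=.
  by rewrite mul0r mulr0 addr0.
by rewrite (mulrCA x) -exprS -mulrDl nat1r.
Qed.

Lemma has_deriv_expR f df : has_deriv f df ->
  has_deriv (fun x => expR (f x)) (fun x => expR (f x) * df x).
Proof. by move=> fd; apply: has_deriv_comp fd => x; apply: is_derive_expR. Qed.

Lemma has_derivV f df : (forall x, f x != 0) -> has_deriv f df ->
  has_deriv (fun x => (f x)^-1) (fun x => - df x / f x ^+ 2).
Proof.
move=> f0 fd x; apply: is_derive_eq (is_deriveV (f0 x) (fd x)) _.
by rewrite /GRing.scale /= mulNr mulrC -mulNr.
Qed.

Lemma has_deriv_sum (T : finType) (h dh : T -> R -> R) :
  (forall i, has_deriv (h i) (dh i)) ->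
  has_deriv (fun x => \sum_i h i x) (fun x => \sum_i dh i x).
Proof.
move=> hd; suff H (s : seq T) :
    has_deriv (fun x => \sum_(i <- s) h i x) (fun x => \sum_(i <- s) dh i x).
  exact: H.
elim: s => [|i s IHs].
  move=> x; under eq_fun do rewrite big_nil; rewrite big_nil; exact: has_derivC.
move=> x; under eq_fun do rewrite big_cons; rewrite big_cons.
exact: (has_derivD (hd i) IHs).
Qed.

Lemma MVT_has_deriv f df a b : a <= b ->
  (forall x, a <= x <= b -> is_derive x 1 f (df x)) ->
  exists2 c, a <= c <= b & f b - f a = df c * (b - a).
Proof.
move=> ab fd.
have [||c] := @MVT_segment R f df a b ab.
- by move=> x; rewrite in_itv /= => /andP[/ltW ax /ltW xb]; apply: fd; rewrite ax.
- apply: derivable_within_continuous => x; rewrite in_itv /= => /fd H.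
  by have [] := H.
- by rewrite in_itv /= => ? ?; exists c.
Qed.

Lemma lipschitz_has_deriv f df a b M : has_deriv f df ->
  (forall x, Order.min a b <= x <= Order.max a b -> `|df x| <= M) ->
  `|f b - f a| <= M * `|b - a|.
Proof.
move=> fd; wlog ab : a b / a <= b => [H|] dfM.
  have [ab|/ltW ba] := leP a b; first exact: H.
  by rewrite distrC (distrC b); apply: H => // x; rewrite minC maxC; exact: dfM.
have [c cab ->] := MVT_has_deriv ab (fun x _ => fd x).
rewrite normrM ler_wpM2r//; apply: dfM.
by move: cab; rewrite (min_idPl ab) (max_idPr ab).
Qed.

(** Both [g - f] and [g + f] are nondecreasing on the segment. The majorant [dg] may vary, so that a
    bound such as 1 / (1 + x^2) can be integrated uniformly over half-lines. *)
Lemma incr_le_has_deriv f g df dg a b : a <= b ->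
  (forall x, a <= x <= b -> is_derive x 1 f (df x)) -> has_deriv g dg ->
  (forall x, a <= x <= b -> `|df x| <= dg x) -> `|f b - f a| <= g b - g a.
Proof.
move=> ab fd gd dfg.
have le_incr (h : R -> R) : (exists dh : R -> R, (forall x, a <= x <= b -> is_derive x 1 h (dh x)) /\
    forall x, a <= x <= b -> 0 <= dh x) -> 0 <= h b - h a.
  move=> [dh [hd dh0]]; have [c cab ->] := MVT_has_deriv ab hd.
  by rewrite mulr_ge0 ?subr_ge0 ?dh0.
have H1 : 0 <= (g b - f b) - (g a - f a).
  apply: (le_incr (fun x => g x - f x)); exists (fun x => dg x - df x); split=> x xab.
    by have := is_deriveB (gd x) (fd _ xab).
  by rewrite subr_ge0 (le_trans _ (dfg _ xab)) ?ler_norm.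
have H2 : 0 <= (g b + f b) - (g a + f a).
  apply: (le_incr (fun x => g x + f x)); exists (fun x => dg x + df x); split=> x xab.
    by have := is_deriveD (gd x) (fd _ xab).
  by have := dfg _ xab; rewrite ler_norml; lra.
by rewrite ler_norml; lra.
Qed.

Lemma nondecr_has_deriv f df a b : has_deriv f df ->
  (forall x, 0 <= df x) -> a <= b -> f a <= f b.
Proof.
move=> fd df0 ab; rewrite -subr_ge0.
have [c _ ->] := MVT_has_deriv ab (fun x _ => fd x).
by rewrite mulr_ge0 ?subr_ge0.
Qed.

(** The integral starts at the finite point -1, hence the restriction to the right of it. *)
Lemma antideriv_right f : continuous f -> exists F0 : R -> R,
  F0 0 = 0 /\ forall x, -1 < x -> is_derive x 1 F0 (f x).
Proof.
move=> fc.
pose I y := \int[@lebesgue_measure R]_(t in `[-1, y]) f t.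
exists (fun y => I y - I 0); split=> [|x x1]; first by rewrite subrr.
have [|||Id Ie] := @continuous_FTC1_closed R f (-1) x (x + 1) _ _ _ (fc x).
- by rewrite ltrDl.
- apply: continuous_compact_integrable; first exact: segment_compact.
  exact: continuous_subspaceT.
- exact: x1.
apply: (is_derive_eq (is_deriveB (derivableP Id) (is_derive_cst (I 0) x 1))).
by rewrite subr0 -derive1E.
Qed.

(** Two one-sided antiderivatives are glued: the one to the right of -1, and the reflection of the
    one of [f (- x)], valid to the left of 1. On the overlap they have the same derivative and both
    vanish at 0. *)
Lemma antideriv f : continuous f -> exists F0, F0 0 = 0 /\ has_deriv F0 f.
Proof.
move=> fc; have [F1 [F10 F1d]] := antideriv_right fc.
have [|F2 [F20 F2d]] := @antideriv_right (fun x => f (- x)).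
  by move=> x; apply: continuous_comp; [exact: opp_continuous | exact: fc].
have F2d' x : x < 1 -> is_derive x 1 (fun y => - F2 (- y)) (f x).
  move=> x1; have x1' : -1 < - x by rewrite ltrN2.
  have N1 : is_derive x (1 : R) (fun y => - y) (- 1) by exact: is_deriveNid.
  apply: (is_derive_eq (is_deriveN (is_derive1_comp (F2d _ x1') N1))).
  by rewrite opprK mulrN1 opprK.
have E x : -1 < x < 1 -> F1 x = - F2 (- x).
  move=> x1; apply/eqP; rewrite -subr_eq0; apply/eqP.
  pose G y := F1 y - (- F2 (- y)).
  have Gd (y : R) : -1 < y < 1 -> is_derive y 1 G 0.
    move=> /andP[y1 y2]; apply: is_derive_eq (is_deriveB (F1d _ y1) (F2d' _ y2)) _.
    exact: subrr.
  have G0 : G 0 = 0 by rewrite /G oppr0 F20 F10 oppr0 subr0.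
  change (G x = 0).
  have [x0|x0] := leP 0 x.
    have [|c _] := @MVT_has_deriv G (fun=> 0) 0 x x0 _; last first.
      by rewrite mul0r G0 subr0.
    by move=> y yx; apply: Gd; lra.
  have [|c _] := @MVT_has_deriv G (fun=> 0) x 0 (ltW x0) _; last first.
    by rewrite mul0r G0 sub0r => /eqP; rewrite oppr_eq0 => /eqP.
  by move=> y yx; apply: Gd; lra.
exists (fun x => if -1 < x then F1 x else - F2 (- x)); split.
  by rewrite ifT // ltrN10.
move=> x; have [x1|x1] := ltP (-1) x.
  apply: near_eq_is_derive (F1d _ x1).
  near=> y; rewrite ifT //; near: y; exact: lt_nbhsr.
apply: near_eq_is_derive (F2d' x _); last by lra.
near=> y; case: ifP => // y1; rewrite E // y1 /=.
near: y; apply: lt_nbhsl; lra.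
Unshelve. all: by end_near. Qed.

End RealDerivatives.

(** * Bounded solutions of the Stein equation *)

Section SteinEquation.
Variable R : realType.
Implicit Types (x y c : R).

Section LeftTail.
Variables kap Th G : R -> R.
Hypothesis kap_half : forall x, `|kap x| <= 2^-1.
Hypothesis Th_deriv : has_deriv Th (fun x => x * (1 - kap x)).
Hypothesis G_deriv : has_deriv G (fun x => (1 - kap x) * expR (- Th x)).

Let kap_bound x : 2^-1 <= 1 - kap x <= 3 / 2.
Proof. by have := kap_half x; rewrite ler_norml; lra. Qed.

Lemma stein_scale_nondecr x y : x <= y -> G x <= G y.
Proof.
apply: nondecr_has_deriv G_deriv _ => t.
by rewrite mulr_ge0 ?expR_ge0//; have := kap_bound t; lra.
Qed.

(* For fixed [y], [u |-> expR (- Th u) + u * (G u - G y)] has derivative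
   [G u - G y], so it is nondecreasing to the right of [y]. *)
Lemma stein_mills x y : y <= x -> (G x - G y) * - x <= expR (- Th x).
Proof.
move=> yx.
pose Q u := expR (- Th u) + u * (G u - G y).
have Qd : has_deriv Q (fun u => G u - G y).
  apply: has_deriv_eq.
    apply: has_derivD; first by apply: has_deriv_expR; apply: has_derivN Th_deriv.
    apply: has_derivM; first exact: has_derivX.
    exact: has_derivB G_deriv (has_derivC _).
  by move=> u /=; ring.
have [u /andP[yu ux] E] := MVT_has_deriv yx (fun u _ => Qd u).
have : 0 <= Q x - Q y.
  by rewrite E mulr_ge0// subr_ge0//; exact: stein_scale_nondecr.
by rewrite /Q subrr mulr0 addr0; have := expR_gt0 (- Th y); lra.
Qed.

Lemma stein_potential_left x y : y <= x -> x <= 0 -> Th x <= Th y.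
Proof.
move=> yx x0; have [u /andP[yu ux] E] := MVT_has_deriv yx (fun u _ => Th_deriv u).
rewrite -subr_le0 E; have := kap_bound u => ku.
by rewrite mulr_le0_ge0 ?mulr_le0_ge0 ?subr_ge0//; lra.
Qed.

(** To the left of -1 the Mills bound has a factor |x| >= 1 to spare and costs 1; on [-1, 0] the
    integrand is at most 3/2 times its exponential at the right end, over a length at most 1.
    Together 1 + 3/2 = 5/2. *)
Lemma stein_scale_left x y : y <= x -> x <= 0 ->
  G x - G y <= 5 / 2 * expR (- Th x).
Proof.
have near0 t s : s <= t -> t <= 0 -> -1 <= s -> G t - G s <= 3 / 2 * expR (- Th t).
  move=> st t0 s1.
  have [u /andP[su ut] ->] := MVT_has_deriv st (fun u _ => G_deriv u).
  have Eu : expR (- Th u) <= expR (- Th t).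
    by rewrite ler_expR lerN2; exact: stein_potential_left.
  have := kap_bound u; have := expR_gt0 (- Th u) => ? ?.
  apply: (@le_trans _ _ (3 / 2 * expR (- Th u) * 1)); last by lra.
  apply: ler_pM; rewrite ?mulr_ge0//; try lra.
  by apply: ler_wpM2r; lra.
have far t s : s <= t -> t <= -1 -> G t - G s <= expR (- Th t).
  move=> st t1; apply: le_trans (stein_mills st).
  by have := stein_scale_nondecr st; nra.
move=> yx x0; have E0 := expR_gt0 (- Th x).
have [x1|x1] := leP x (-1).
  by have := far _ _ yx x1; lra.
have [y1|y1] := leP (-1) y.
  by have := near0 _ _ yx x0 y1; lra.
have := near0 _ _ (ltW x1) x0 (lexx _); have := far _ _ (ltW y1) (lexx _).
have : expR (- Th (-1)) <= expR (- Th x).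
  by rewrite ler_expR lerN2; apply: stein_potential_left => //; exact: ltW.
lra.
Qed.

End LeftTail.

(** If Th' = x (1 - kap), then expR (- Th) is an integrating factor: (f expR (- Th))' = (h - c) rho
    with rho = (1 - kap) expR (- Th). Boundedness at both ends forces c to be the mean of h under
    the density proportional to rho. Improper integrals are avoided by taking the infimum and
    supremum of the monotone antiderivatives [G] of rho and [J] of h rho. *)
Lemma stein_solution (kap h : R -> R) :
  continuous kap -> (forall x, `|kap x| <= 2^-1) ->
  continuous h -> (forall x, 0 <= h x <= 1) ->
  exists f c, [/\ 0 <= c <= 1,
    has_deriv f (fun x => (x * f x + h x - c) * (1 - kap x)),
    forall x, `|f x| <= 5 / 2 & forall x, `|x * f x| <= 1].
Proof.
move=> kapc kaph hc h01.
have kap1c : continuous (fun x => 1 - kap x).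
  by move=> x; apply: cvgB; [exact: cvg_cst | exact: kapc].
have [|Th [Th0 Thd]] := @antideriv R (fun x => x * (1 - kap x)).
  by move=> x; apply: cvgM; [exact: cvg_id | exact: kap1c].
pose rho x := (1 - kap x) * expR (- Th x).
have rhoc : continuous rho.
  move=> x; apply: cvgM; first exact: kap1c.
  apply: (has_deriv_continuous (has_deriv_expR (has_derivN Thd))).
have rho0 x : 0 <= rho x.
  by rewrite mulr_ge0 ?expR_ge0//; have := kaph x; rewrite ler_norml; lra.
have [G [G0 Gd]] := antideriv rhoc.
have [|J [J0 Jd]] := @antideriv R (fun x => h x * rho x).
  by move=> x; apply: cvgM; [exact: hc | exact: rhoc].
(* The data reflected at 0 satisfy the hypotheses of the left-tail lemmas, which thereby also give
   the right tail. *)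
have kaph' x : `|kap (- x)| <= 2^-1 by exact: kaph.
have Nd : has_deriv (fun x : R => - x) (fun=> -1) by exact: has_derivN (@has_derivX R).
have Thd' : has_deriv (fun x => Th (- x)) (fun x => x * (1 - kap (- x))).
  by apply: has_deriv_eq (has_deriv_comp Thd Nd) _ => x /=; ring.
have Gd' : has_deriv (fun x => - G (- x)) (fun x => (1 - kap (- x)) * expR (- Th (- x))).
  by apply: has_deriv_eq (has_derivN (has_deriv_comp Gd Nd)) _ => x /=; rewrite /rho; ring.
have Gle x y : x <= y -> G x <= G y by exact: (stein_scale_nondecr kaph Gd).
have JG x y : x <= y -> 0 <= J y - J x <= G y - G x.
  move=> xy; apply/andP; split.
    rewrite subr_ge0; apply: nondecr_has_deriv Jd _ xy => t.
    by rewrite mulr_ge0//; have /andP[] := h01 t.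
  apply: le_trans (ler_norm _) _; apply: incr_le_has_deriv xy (fun t _ => Jd t) Gd _.
  by move=> t _; have /andP[? ?] := h01 t; rewrite (ger0_norm (mulr_ge0 _ (rho0 t)))// ler_piMl ?rho0.
have Ex0 x : expR (- Th x) * expR (Th x) = 1 by rewrite -expRD addNr expR0.
have E1 x : expR (- Th x) <= 1.
  rewrite -expR0 ler_expR oppr_le0 -Th0.
  have [x0|/ltW x0] := leP x 0; first exact: (stein_potential_left kaph Thd).
  have := @stein_potential_left _ _ kaph' Thd' 0 (- x).
  by rewrite oppr0 opprK; apply; lra.
have L1 x y : y <= x -> x <= 0 -> G x - G y <= 5 / 2 * expR (- Th x).
  exact: (stein_scale_left kaph Thd Gd).
have L2 x y : x <= y -> 0 <= x -> G y - G x <= 5 / 2 * expR (- Th x).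
  move=> xy x0; have := @stein_scale_left _ _ _ kaph' Thd' Gd' (- x) (- y).
  by rewrite !opprK addrC; apply; lra.
have M1 x y : y <= x -> (G x - G y) * - x <= expR (- Th x).
  exact: (stein_mills kaph Thd Gd).
have M2 x y : x <= y -> (G y - G x) * x <= expR (- Th x).
  move=> xy; have := @stein_mills _ _ _ kaph' Thd' Gd' (- x) (- y).
  by rewrite !opprK addrC; apply; lra.
(* The bound 5/2 rounded up; it serves only to guarantee that the infima and suprema below exist. *)
have Gb x : -3 <= G x <= 3.
  have [x0|/ltW x0] := leP x 0.
    by have := L1 _ _ x0 (lexx _); have := Gle _ _ x0; have := E1 0; lra.
  by have := L2 _ _ x0 (lexx _); have := Gle _ _ x0; have := E1 0; lra.
have Jb x : -3 <= J x <= 3.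
  by have [x0|/ltW x0] := leP x 0; have := JG _ _ x0; have := Gb x; lra.
have HI (K : R -> R) : (forall x, -3 <= K x <= 3) -> has_inf (range K).
  move=> Kb; split; first by exists (K 0), 0.
  by exists (-3) => _ [x _ <-]; have /andP[] := Kb x.
have HS (K : R -> R) : (forall x, -3 <= K x <= 3) -> has_sup (range K).
  move=> Kb; split; first by exists (K 0), 0.
  by exists 3 => _ [x _ <-]; have /andP[] := Kb x.
have infle (K : R -> R) x : (forall x, -3 <= K x <= 3) -> inf (range K) <= K x.
  by move=> Kb; apply: ge_inf; [have [] := HI _ Kb | exists x].
have supge (K : R -> R) x : (forall x, -3 <= K x <= 3) -> K x <= sup (range K).
  by move=> Kb; apply: ub_le_sup; [have [] := HS _ Kb | exists x].
have leinf (K : R -> R) v : (forall x, -3 <= K x <= 3) -> (forall x, v <= K x) ->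
    v <= inf (range K).
  move=> Kb vK; apply: lb_le_inf; first by have [] := HI _ Kb.
  by move=> _ [x _ <-].
have supleq (K : R -> R) v : (forall x, -3 <= K x <= 3) -> (forall x, K x <= v) ->
    sup (range K) <= v.
  move=> Kb vK; apply: ge_sup; first by have [] := HS _ Kb.
  by move=> _ [x _ <-].
pose Gm := inf (range G); pose Gp := sup (range G).
pose Jm := inf (range J); pose Jp := sup (range J).
have GmG x : Gm <= G x by exact: infle.
have GGp x : G x <= Gp by exact: supge.
have JmJ x : Jm <= J x by exact: infle.
have JJp x : J x <= Jp by exact: supge.
have JGm x : J x - Jm <= G x - Gm.
  suff : J x - G x + Gm <= Jm by lra.
  apply: leinf => // y; have [xy|/ltW yx] := leP x y.
    by have := JG _ _ xy; have := GmG x; lra.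
  by have := JG _ _ yx; have := GmG y; lra.
have JGp x : Jp - J x <= Gp - G x.
  suff : Jp <= J x - G x + Gp by lra.
  apply: supleq => // y; have [xy|/ltW yx] := leP x y.
    by have := JG _ _ xy; have := GGp y; lra.
  by have := JG _ _ yx; have := GGp x; lra.
have Gmp : 0 < Gp - Gm.
  suff : G 0 < G 1 by have := GmG 0; have := GGp 1; lra.
  rewrite -subr_gt0; have [u _ ->] := MVT_has_deriv (@ler01 R) (fun u _ => Gd u).
  rewrite subr0 mulr1 mulr_gt0 ?expR_gt0//.
  by have := kaph u; rewrite ler_norml; lra.
pose c := (Jp - Jm) / (Gp - Gm).
have cE : Jp - Jm = c * (Gp - Gm) by rewrite /c divfK ?gt_eqF.
have c01 : 0 <= c <= 1.
  have := JGm 0; have := JGp 0; have := JmJ 0; have := JJp 0 => ? ? ? ?.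
  rewrite /c ler_pdivlMr// ler_pdivrMr// !mul0r !mul1r; lra.
(* Integration from -oo; by the choice of [c] it equals minus the integral up to +oo, which is [fE].
   The first form is estimated on the negative axis and the second on the positive one. *)
pose f x := expR (Th x) * (J x - Jm - c * (G x - Gm)).
have fE x : f x = expR (Th x) * - (Jp - J x - c * (Gp - G x)).
  by rewrite /f; congr (_ * _); move: cE; lra.
have LB x u v : 0 <= u <= v -> `|u - c * v| <= v.
  by move=> uv; rewrite ler_norml; nra.
have fl x : `|f x| <= expR (Th x) * (G x - Gm).
  rewrite normrM ger0_norm ?expR_ge0// ler_wpM2l ?expR_ge0//.
  by apply: LB => //; rewrite subr_ge0 JmJ JGm.
have fr x : `|f x| <= expR (Th x) * (Gp - G x).
  rewrite fE normrM normrN ger0_norm ?expR_ge0// ler_wpM2l ?expR_ge0//.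
  by apply: LB => //; rewrite subr_ge0 JJp JGp.
have div_exp x u v : u <= v * expR (- Th x) -> expR (Th x) * u <= v.
  move=> uv; rewrite -[leRHS]mulr1 -(Ex0 x) mulrA [leRHS]mulrC.
  by rewrite ler_wpM2l ?expR_ge0.
exists f, c; split => // [|x|x].
- have fd := has_derivM (has_deriv_expR Thd)
    (has_derivB (has_derivB Jd (has_derivC Jm))
                (has_derivZ c (has_derivB Gd (has_derivC Gm)))).
  move=> y; apply: (is_derive_eq (fd y)) => /=.
  transitivity (y * (1 - kap y) * f y + (h y - c) * (1 - kap y) * (expR (- Th y) * expR (Th y))).
    by rewrite /f /rho; ring.
  by rewrite Ex0; ring.
- have [x0|/ltW x0] := leP x 0.
    apply: le_trans (fl x) _; apply: div_exp.
    suff : G x - 5 / 2 * expR (- Th x) <= Gm by lra.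
    apply: leinf => // y; have [xy|/ltW yx] := leP x y.
      by have := Gle _ _ xy; have := expR_gt0 (- Th x); lra.
    by have := L1 _ _ yx x0; lra.
  apply: le_trans (fr x) _; apply: div_exp.
  suff : Gp <= G x + 5 / 2 * expR (- Th x) by lra.
  apply: supleq => // y; have [xy|/ltW yx] := leP x y.
    by have := L2 _ _ xy x0; lra.
  by have := Gle _ _ yx; have := expR_gt0 (- Th x); lra.
- rewrite normrM; have E0 := expR_gt0 (- Th x).
  have [x0|x0] := ltP x 0.
    rewrite ltr0_norm//; apply: le_trans (ler_wpM2l _ (fl x)) _; first by lra.
    rewrite mulrCA; apply: div_exp; rewrite mul1r.
    rewrite -ler_pdivlMl ?oppr_gt0//.
    suff : G x - (- x)^-1 * expR (- Th x) <= Gm by lra.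
    have P0 : 0 < (- x)^-1 * expR (- Th x) by rewrite mulr_gt0 ?invr_gt0 ?oppr_gt0.
    apply: leinf => // y; have [xy|/ltW yx] := leP x y.
      by have := Gle _ _ xy; lra.
    have := M1 _ _ yx; rewrite mulrC -ler_pdivlMl ?oppr_gt0//; lra.
  have [->|xn0] := eqVneq x 0; first by rewrite normr0 mul0r.
  have x1 : 0 < x by rewrite lt_def xn0.
  rewrite gtr0_norm//; apply: le_trans (ler_wpM2l _ (fr x)) _; first by lra.
  rewrite mulrCA; apply: div_exp; rewrite mul1r.
  rewrite -ler_pdivlMl//.
  suff : Gp <= G x + x^-1 * expR (- Th x) by lra.
  have P0 : 0 < x^-1 * expR (- Th x) by rewrite mulr_gt0 ?invr_gt0.
  apply: supleq => // y; have [xy|/ltW yx] := leP x y.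
    have := M2 _ _ xy; rewrite mulrC -ler_pdivlMl//; lra.
  by have := Gle _ _ yx; lra.
Qed.

End SteinEquation.

(** * Smoothed indicators and second differences *)

Section Ramp.
Variable R : realType.
Implicit Types (x y z t d D : R).

Definition pos_part x : R := Order.max 0 x.
Definition pos_sqr x : R := pos_part x ^+ 2 / 2.

Lemma pos_part_ge x : 0 <= x -> pos_part x = x.
Proof. by move=> x0; rewrite /pos_part (max_idPr x0). Qed.

Lemma pos_part_le x : x <= 0 -> pos_part x = 0.
Proof. by move=> x0; rewrite /pos_part (max_idPl x0). Qed.

Lemma pos_part_lipschitz x y : `|pos_part x - pos_part y| <= `|x - y|.
Proof.
have := ler_norm (x - y); have := ler_norm (- (x - y)); rewrite normrN ler_norml.
by rewrite /pos_part; have [?|?] := leP 0 x; have [?|?] := leP 0 y; lra.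
Qed.

Lemma pos_part_incr x d : 0 <= d ->
  d * (0 <= x)%R%:R <= pos_part (x + d) - pos_part x <= d * (0 <= x + d)%R%:R.
Proof.
move=> d0; rewrite /pos_part; have [?|?] := leP 0 x;
by have [?|?] := leP 0 (x + d); rewrite ?mulr0 ?mulr1; lra.
Qed.

Lemma pos_part_continuous : continuous pos_part.
Proof.
move=> x; apply: (@continuous_max R R (fun=> 0) id) => //.
exact: cvg_cst.
Qed.

(** The kink of [pos_part] at 0 is avoided by identifying [pos_sqr] with the antiderivative of
    [pos_part] that vanishes at 0, separately on each half-line. *)
Lemma pos_sqr_deriv : has_deriv pos_sqr pos_part.
Proof.
have [P [P0 Pd]] := antideriv pos_part_continuous.
suff -> : pos_sqr = P by [].
apply/funext => x; apply/esym/eqP; have [x0|/ltW x0] := leP 0 x.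
  pose g y : R := P y - y ^+ 2 / 2.
  have gd : has_deriv g (fun y => pos_part y - y).
    apply: has_deriv_eq.
      apply: has_derivB Pd _.
      exact: has_derivM (@has_derivXn R 2) (has_derivC 2^-1).
    by move=> y /=; field.
  have [y /andP[y0 _]] := MVT_has_deriv x0 (fun u _ => gd u).
  rewrite (pos_part_ge y0) subrr mul0r /g P0 /pos_sqr pos_part_ge// => H.
  by apply/eqP; lra.
have [y /andP[_ y0]] := MVT_has_deriv x0 (fun u _ => Pd u).
by rewrite (pos_part_le y0) mul0r P0 /pos_sqr pos_part_le// => H; apply/eqP; lra.
Qed.

Lemma pos_sqrD x : pos_sqr x + pos_sqr (- x) = x ^+ 2 / 2.
Proof.
rewrite /pos_sqr; have [x0|/ltW x0] := leP 0 x.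
  by rewrite pos_part_ge// pos_part_le ?oppr_le0//; field.
by rewrite pos_part_le// pos_part_ge ?oppr_ge0//; field.
Qed.

(* A smoothing of the indicator of ]-oo, z] at scale D: minus its derivative
   is the triangular kernel on [z - D, z + D]. *)
Definition ramp D z x : R :=
  (pos_sqr (z + D - x) - 2 * pos_sqr (z - x) + pos_sqr (z - D - x)) / D ^+ 2.

Definition dramp D z x : R :=
  - (pos_part (z + D - x) - 2 * pos_part (z - x) + pos_part (z - D - x)) / D ^+ 2.

Lemma ramp_deriv D z : has_deriv (ramp D z) (dramp D z).
Proof.
have H a : has_deriv (fun x => pos_sqr (a - x)) (fun x => - pos_part (a - x)).
  apply: has_deriv_eq.
    by apply: (has_deriv_comp pos_sqr_deriv); exact: has_derivB (has_derivC a) (@has_derivX R).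
  by move=> x /=; ring.
apply: has_deriv_eq.
  apply: has_derivM (has_derivC (D ^- 2)).
  exact: has_derivD (has_derivB (H _) (has_derivZ 2 (H _))) (H _).
by move=> x /=; rewrite /dramp; ring.
Qed.

Section RampBounds.
Variables (D z : R).
Hypothesis D0 : 0 < D.

Let D2 : 0 < D ^+ 2. Proof. exact: exprn_gt0. Qed.

Lemma ramp_left x : x <= z - D -> ramp D z x = 1.
Proof.
move: (D0) (D2) => Dgt0 D2gt0.
move=> xz; rewrite /ramp /pos_sqr !pos_part_ge; try lra.
by field; exact: lt0r_neq0.
Qed.

Lemma ramp_right x : z + D <= x -> ramp D z x = 0.
Proof.
move: (D0) (D2) => Dgt0 D2gt0.
move=> xz; rewrite /ramp /pos_sqr !pos_part_le; lra.
Qed.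

(** Symmetry of the kernel about [z]. It later leaves only differences of the Edgeworth density at z
    + u and z - u, which removes the term of order D. *)
Lemma ramp_sym u : ramp D z (z + u) + ramp D z (z - u) = 1.
Proof.
move: (D0) (D2) => Dgt0 D2gt0.
have H a : pos_sqr (- a) = a ^+ 2 / 2 - pos_sqr a by rewrite -pos_sqrD; ring.
rewrite /ramp (_ : z + D - (z + u) = D - u); last by ring.
rewrite (_ : z - (z + u) = - u); last by ring.
rewrite (_ : z - D - (z + u) = - (D + u)); last by ring.
rewrite (_ : z + D - (z - u) = D + u); last by ring.
rewrite (_ : z - (z - u) = u); last by ring.
rewrite (_ : z - D - (z - u) = - (D - u)); last by ring.
rewrite !H; field; exact: lt0r_neq0.
Qed.

Lemma dramp_bound x : - D^-1 <= dramp D z x <= 0.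
Proof.
move: (D0) (D2) => Dgt0 D2gt0.
have DE : D^-1 = D / D ^+ 2 by field; exact: lt0r_neq0.
rewrite /dramp DE -mulNr ler_pM2r ?invr_gt0// pmulr_lle0 ?invr_gt0//.
rewrite /pos_part; have [?|?] := leP 0 (z + D - x); have [?|?] := leP 0 (z - x);
  have [?|?] := leP 0 (z - D - x); lra.
Qed.

Lemma dramp_out x : ~~ (z - D < x <= z + D) -> dramp D z x = 0.
Proof.
move: (D0) (D2) => Dgt0 D2gt0.
rewrite negb_and -leNgt -ltNge => /orP[xz|xz]; rewrite /dramp.
  by rewrite !pos_part_ge; try lra; rewrite (_ : - _ = 0) ?mul0r//; ring.
by rewrite !pos_part_le; try lra; rewrite mulr0 subr0 addr0 oppr0 mul0r.
Qed.

Lemma dramp_lipschitz x y : `|dramp D z x - dramp D z y| <= 4 / D ^+ 2 * `|x - y|.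
Proof.
move: (D0) (D2) => Dgt0 D2gt0.
have L a : `|pos_part (a - x) - pos_part (a - y)| <= `|x - y|.
  apply: le_trans (pos_part_lipschitz _ _) _.
  by rewrite (_ : _ - _ - _ = - (x - y)) ?normrN//; ring.
have D2V : 0 < D ^- 2 by rewrite invr_gt0.
rewrite /dramp -mulrBl normrM (gtr0_norm D2V) mulrAC ler_pM2r//.
have := L (z + D); have := L z; have := L (z - D).
by rewrite !ler_norml; lra.
Qed.

Lemma ramp01 x : 0 <= ramp D z x <= 1.
Proof.
move: (D0) (D2) => Dgt0 D2gt0.
have noninc a b : a <= b -> ramp D z b <= ramp D z a.
  move=> ab; have [c _] := MVT_has_deriv ab (fun u _ => @ramp_deriv D z u).
  have := dramp_bound c; have : 0 <= b - a by lra.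
  by move=> ? ? ?; nra.
apply/andP; split.
  have [?|?] := leP (z + D) x; first by rewrite ramp_right.
  by rewrite -(@ramp_right (z + D))//; apply: noninc; exact: ltW.
have [?|?] := leP x (z - D); first by rewrite ramp_left.
by rewrite -(@ramp_left (z - D))//; apply: noninc; exact: ltW.
Qed.

End RampBounds.
End Ramp.

(** * Expectation under the uniform law on a finite type *)

Section UniformExpectation.
Variables (R : realType) (T : finType).
Implicit Types (g k : T -> R) (c : R).

Definition Ex g : R := (#|T|%:R)^-1 * \sum_t g t.

Lemma eq_Ex g k : g =1 k -> Ex g = Ex k.
Proof. by move=> gk; rewrite /Ex (eq_bigr _ (fun t _ => gk t)). Qed.

Lemma ExD g k : Ex (fun t => g t + k t) = Ex g + Ex k.
Proof. by rewrite /Ex big_split mulrDr. Qed.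

Lemma ExZ c g : Ex (fun t => c * g t) = c * Ex g.
Proof. by rewrite /Ex -mulr_sumr mulrCA. Qed.

Lemma ExN g : Ex (fun t => - g t) = - Ex g.
Proof. by rewrite /Ex sumrN mulrN. Qed.

Lemma ExB g k : Ex (fun t => g t - k t) = Ex g - Ex k.
Proof. by rewrite ExD ExN. Qed.

Lemma Ex_le g k : (forall t, g t <= k t) -> Ex g <= Ex k.
Proof. by move=> gk; rewrite ler_wpM2l ?invr_ge0// ler_sum. Qed.

Lemma Ex_ge0 g : (forall t, 0 <= g t) -> 0 <= Ex g.
Proof. by move=> g0; rewrite mulr_ge0 ?invr_ge0// sumr_ge0. Qed.

Lemma Ex_norm g : `|Ex g| <= Ex (fun t => `|g t|).
Proof.
by rewrite /Ex normrM ger0_norm ?invr_ge0// ler_wpM2l ?invr_ge0// ler_norm_sum.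
Qed.

Lemma Ex_norm_le g k : (forall t, `|g t| <= k t) -> `|Ex g| <= Ex k.
Proof. by move=> gk; apply: le_trans (Ex_norm _) (Ex_le gk). Qed.

Lemma Ex_norm_sub g k : `|Ex g - Ex k| <= Ex (fun t => `|g t - k t|).
Proof. by rewrite -ExB Ex_norm. Qed.

Lemma Ex_sum (I : finType) (P : pred I) (G : I -> T -> R) :
  Ex (fun t => \sum_(i | P i) G i t) = \sum_(i | P i) Ex (G i).
Proof. by rewrite /Ex exchange_big mulr_sumr. Qed.

(* Young's inequality in place of Cauchy-Schwarz. *)
Lemma Ex_young g k c : 0 < c ->
  Ex (fun t => `|g t * k t|) <= c / 2 * Ex (fun t => g t ^+ 2) + (2 * c)^-1 * Ex (fun t => k t ^+ 2).
Proof.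
move=> c0; rewrite -!ExZ -ExD; apply: Ex_le => t.
rewrite normrM -(real_normK (num_real (g t))) -(real_normK (num_real (k t))).
move: `|g t| `|k t| => a b.
rewrite -subr_ge0 (_ : _ - _ = (2 * c)^-1 * (c * a - b) ^+ 2); last first.
  by field; rewrite lt0r_neq0.
by rewrite mulr_ge0 ?sqr_ge0// invr_ge0 mulr_ge0// ltW.
Qed.

Lemma Ex_deriv (h dh : T -> R -> R) : (forall t, has_deriv (h t) (dh t)) ->
  has_deriv (fun x => Ex (fun t => h t x)) (fun x => Ex (fun t => dh t x)).
Proof. by move=> hd; apply: has_derivZ; exact: has_deriv_sum. Qed.

Hypothesis T0 : (0 < #|T|)%N.

Lemma ExC c : Ex (fun=> c) = c.
Proof.
rewrite /Ex sumr_const -[c *+ _]mulr_natl mulrA mulVf ?mul1r//.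
by rewrite pnatr_eq0 -lt0n.
Qed.

End UniformExpectation.

Section SecondDifferences.
Variables (R : realType) (T : finType) (X : T -> R).
Implicit Types (t s u y z : R).

Local Notation Fx := (unif_cdf X).

(* The antiderivative of the distribution function that vanishes near -oo. *)
Definition call t : R := Ex (fun w => pos_part (t - X w)).

Lemma unif_cdfE z : Fx z = Ex (fun w => (X w <= z)%R%:R).
Proof.
rewrite /unif_cdf /unif_prob /Ex mulrC; congr (_ * _).
rewrite -sum1_card natr_sum big_mkcond /=.
by apply: eq_bigr => w _; rewrite inE; case: ifP.
Qed.

Lemma unif_cdf_incr s t : s <= t -> Fx s <= Fx t.
Proof.
move=> st; rewrite !unif_cdfE; apply: Ex_le => w.
rewrite ler_nat; have [Xs|//] := boolP (X w <= s).
by rewrite (le_trans Xs st).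
Qed.

Lemma call_incr t y : 0 <= y ->
  y * Fx t <= call (t + y) - call t <= y * Fx (t + y).
Proof.
move=> y0; rewrite !unif_cdfE /call -ExB -!ExZ.
have H w := pos_part_incr (t - X w) y0.
have E w : t + y - X w = t - X w + y by ring.
apply/andP; split; apply: Ex_le => w; rewrite E.
  by have := H w; rewrite subr_ge0 => /andP[].
by have := H w; rewrite -E !subr_ge0 => /andP[].
Qed.

Lemma call_deriv_sqr : has_deriv (fun t => Ex (fun w => pos_sqr (t - X w))) call.
Proof. by apply: Ex_deriv => w; exact: has_deriv_shift (@pos_sqr_deriv R). Qed.

Lemma Ex_ramp (D z : R) : Ex (fun w => ramp D z (X w)) =
  (Ex (fun w => pos_sqr (z + D - X w)) - 2 * Ex (fun w => pos_sqr (z - X w))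
   + Ex (fun w => pos_sqr (z - D - X w))) / D ^+ 2.
Proof.
rewrite -ExZ -ExB -ExD mulrC -ExZ; apply: eq_Ex => w.
by rewrite /ramp mulrC.
Qed.

Lemma Ex_dramp (D z t : R) : Ex (fun w => dramp D z (X w + t)) =
  - (call (z + D - t) - 2 * call (z - t) + call (z - D - t)) / D ^+ 2.
Proof.
rewrite /call -ExZ -ExB -ExD -ExN mulrC -ExZ; apply: eq_Ex => w.
rewrite /dramp mulrC; congr (_ * - _).
by congr (pos_part _ - 2 * pos_part _ + pos_part _); ring.
Qed.

Hypothesis T0 : (0 < #|T|)%N.

Lemma unif_cdf01 z : 0 <= Fx z <= 1.
Proof.
rewrite unif_cdfE; apply/andP; split; first by apply: Ex_ge0.
by rewrite -[leRHS](ExC T0); apply: Ex_le => w; rewrite lern1 leq_b1.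
Qed.

(** On each cell the increment of [call] exceeds the left end term by at most the mesh times the
    increment of the monotone [Fx]; these errors telescope to the mesh times a total increment at
    most 1. Riemann sums replace the integral of a step function. *)
Lemma call_riemann t y N : 0 <= y -> (0 < N)%N ->
  `|call (t + y) - call t - \sum_(k < N) y / N%:R * Fx (t + k%:R * (y / N%:R))|
    <= y / N%:R.
Proof.
move=> y0 N0; set d := y / N%:R.
have d0 : 0 <= d by rewrite divr_ge0.
have H (n : nat) : 0 <= call (t + n%:R * d) - call t - \sum_(k < n) d * Fx (t + k%:R * d)
    <= d * (Fx (t + n%:R * d) - Fx t).
  elim: n => [|n /andP[IH1 IH2]].
    by rewrite big_ord0 mul0r addr0 !subrr mulr0 lexx.
  rewrite big_ord_recr /=.
  have -> : t + n.+1%:R * d = t + n%:R * d + d by rewrite -natr1; ring.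
  by have := call_incr (t + n%:R * d) d0; lra.
have NE : N%:R * d = y by rewrite /d mulrC divfK// pnatr_eq0 -lt0n.
have := H N; rewrite NE => /andP[H1 H2]; rewrite ger0_norm//.
apply: le_trans H2 _; rewrite -[leRHS]mulr1 ler_wpM2l//.
by have := unif_cdf01 (t + y); have := unif_cdf01 t; lra.
Qed.

(* Letting the mesh of the Riemann sums tend to 0. *)
Lemma le_mesh (a b y : R) (K : R) : 0 <= y -> 0 <= K ->
  (forall N, (0 < N)%N -> a <= b + K * (y / N%:R)) -> a <= b.
Proof.
move=> y0 K0 H; apply/ler_addgt0Pr => e e0.
pose N := (Num.trunc (K * y / e)).+1.
have NK : K * y / e <= N%:R.
  by apply/ltW; rewrite truncnS_gt.
apply: le_trans (H N isT) _; rewrite lerD2l mulrA ler_pdivrMr ?ltr0n//.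
by rewrite [leRHS]mulrC -ler_pdivrMr.
Qed.

Variables (C1 D : R).
Hypotheses (C10 : 0 < C1) (D0 : 0 < D) (D1 : D <= 1).
Hypothesis smooth : forall z y, 0 <= y <= D ->
  `|Delta2 y Fx z| <= C1 * (D ^+ 2 + y ^+ 2).

Let M := 2 * C1 * D ^+ 2.

Let M0 : 0 <= M.
Proof. by rewrite /M !mulr_ge0 ?sqr_ge0// ltW. Qed.

Let smoothM z y : 0 <= y <= D -> `|Delta2 y Fx z| <= M.
Proof.
move=> yD; apply: le_trans (smooth z yD) _; rewrite /M [2 * C1]mulrC -mulrA.
rewrite ler_wpM2l ?(ltW C10)//; case/andP: yD => y0 yD.
suff : y ^+ 2 <= D ^+ 2 by lra.
by rewrite lerXn2r ?nnegrE ?(ltW D0).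
Qed.

(** The increment between s and t is the integral of [Delta2 D Fx] over the segment, computed on
    Riemann sums. *)
Lemma call_second_difference s t :
  `|(call (t + 2 * D) - 2 * call (t + D) + call t)
    - (call (s + 2 * D) - 2 * call (s + D) + call s)| <= M * `|t - s|.
Proof.
wlog st : s t / s <= t => [H|].
  have [/H //|/ltW /H] := leP s t.
  by rewrite distrC (distrC t).
rewrite (@ger0_norm _ (t - s)) ?subr_ge0//.
have ts0 : 0 <= t - s by rewrite subr_ge0.
(* The three Riemann errors enter with weights 1, 2 and 1. *)
apply: (@le_mesh _ _ (t - s) 4) => // N N0.
have R1 a := @call_riemann a _ _ ts0 N0.
have := R1 (s + 2 * D); have := R1 (s + D); have := R1 s.
rewrite (_ : s + 2 * D + _ = t + 2 * D); last by ring.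
rewrite (_ : s + D + _ = t + D); last by ring.
rewrite (_ : s + (t - s) = t); last by ring.
set d := (t - s) / N%:R.
set S1 := \sum_(k < N) _ => H1; set S2 := \sum_(k < N) _ => H2; set S3 := \sum_(k < N) _ => H3.
have d0 : 0 <= d by rewrite divr_ge0.
have : `|S3 - 2 * S2 + S1| <= M * (t - s).
  rewrite /S1 /S2 /S3 mulr_sumr -sumrB -big_split /=.
  apply: le_trans (ler_norm_sum _ _ _) _.
  have -> : M * (t - s) = \sum_(k < N) d * M.
    rewrite sumr_const card_ord -(mulr_natl _ N) /d.
    by field; rewrite pnatr_eq0 -lt0n.
  apply: ler_sum => k _.
  rewrite (_ : _ + _ = d * Delta2 D Fx (s + k%:R * d)).
    by rewrite normrM ger0_norm// ler_wpM2l// smoothM ?lexx ?ltW.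
  rewrite /Delta2 (_ : s + 2 * D + _ = s + k%:R * d + 2 * D); last by ring.
  by rewrite (_ : s + D + _ = s + k%:R * d + D); ring.
move: H1 H2 H3; rewrite !ler_norml; lra.
Qed.

(** The averaged kernel is minus a second difference of [call] divided by D^2, so the two powers of
    D cancel. A pointwise estimate would only give 4 / D^2. *)
Lemma Ex_dramp_lipschitz z s t :
  `|Ex (fun w => dramp D z (X w + t)) - Ex (fun w => dramp D z (X w + s))|
    <= 2 * C1 * `|t - s|.
Proof.
have D2 : 0 < D ^+ 2 by exact: exprn_gt0.
rewrite !Ex_dramp -mulrBl normrM (@gtr0_norm _ (D ^- 2)) ?invr_gt0// ler_pdivrMr//.
have := call_second_difference (z - D - s) (z - D - t).
rewrite (_ : z - D - t + 2 * D = z + D - t); last by ring.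
rewrite (_ : z - D - s + 2 * D = z + D - s); last by ring.
rewrite (_ : z - D - t + D = z - t); last by ring.
rewrite (_ : z - D - s + D = z - s); last by ring.
rewrite (_ : z - D - t - _ = - (t - s)) ?normrN; last by ring.
set A := (X in `|X| <= _) => H; set B := (X in `|X| <= _).
have -> : B = - A by rewrite /A /B; ring.
by rewrite normrN; apply: le_trans H _; rewrite /M; lra.
Qed.

(** D^2 times the difference equals [S D], and the derivative [S1] of [S] at y is the integral over
    [0, y] of the symmetric second differences F(z + v) - 2 F(z) + F(z - v), hence at most y M. *)
Lemma Ex_ramp_cdf z : `|Ex (fun w => ramp D z (X w)) - Fx z| <= 2 * C1 * D ^+ 2.
Proof.
have D2 : 0 < D ^+ 2 by exact: exprn_gt0.
pose Q t := Ex (fun w => pos_sqr (t - X w)).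
pose S y := Q (z + y) - 2 * Q z + Q (z - y) - y ^+ 2 * Fx z.
pose S1 y := call (z + y) - call (z - y) - 2 * y * Fx z.
have Nd : has_deriv (fun x : R => z - x) (fun=> -1).
  apply: has_deriv_eq (has_derivB (has_derivC z) (@has_derivX R)) _ => x.
  by rewrite sub0r.
have Pd : has_deriv (fun x : R => z + x) (fun=> 1).
  apply: has_deriv_eq (has_derivD (has_derivC z) (@has_derivX R)) _ => x.
  by rewrite add0r.
have Sd : has_deriv S S1.
  apply: has_deriv_eq.
    apply: has_derivB.
      apply: has_derivD (has_deriv_comp call_deriv_sqr Nd).
      exact: has_derivB (has_deriv_comp call_deriv_sqr Pd) (has_derivC (2 * Q z)).
    exact: has_derivM (@has_derivXn R 2) (has_derivC (Fx z)).
  by move=> x /=; rewrite /S1; ring.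
have S1b y : 0 <= y <= D -> `|S1 y| <= y * M.
  move=> /andP[y0 yD]; apply: (@le_mesh _ _ y 3) => // N N0.
  have := @call_riemann z _ _ y0 N0; have := @call_riemann (z - y) _ _ y0 N0.
  rewrite subrK; set d := y / N%:R.
  set A1 := \sum_(k < N) _ => H1; set A2 := \sum_(k < N) _ => H2.
  have d0 : 0 <= d by rewrite divr_ge0.
  have NE : N%:R * d = y by rewrite /d mulrC divfK// pnatr_eq0 -lt0n.
  (* Reversing the sum over [z - y, z] gives the nodes z - (k + 1) d; shifting the index by one
     pairs them with z + k d, at the cost of one boundary term. With the two Riemann errors this
     makes the constant 3. *)
  have A1E : A1 = \sum_(k < N) d * Fx (z - k%:R * d) + d * (Fx (z - y) - Fx z).
    rewrite /A1 (reindex_inj rev_ord_inj) /=.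
    have K (n : nat) : \sum_(k < n) d * Fx (z - k.+1%:R * d)
        = \sum_(k < n) d * Fx (z - k%:R * d) + d * (Fx (z - n%:R * d) - Fx z).
      elim: n => [|n IH]; first by rewrite !big_ord0 mul0r subr0 subrr mulr0 addr0.
      by rewrite !big_ord_recr /= IH; ring.
    rewrite -NE -K; apply: eq_bigr => k _; congr (d * Fx _).
    by rewrite natrB//; ring.
  have : `|\sum_(k < N) d * Fx (z - k%:R * d) + A2 - 2 * y * Fx z| <= y * M.
    have -> : 2 * y * Fx z = \sum_(k < N) d * (2 * Fx z).
      by rewrite sumr_const card_ord -(mulr_natl _ N) mulrA NE; ring.
    rewrite /A2 -big_split -sumrB /=; apply: le_trans (ler_norm_sum _ _ _) _.
    have -> : y * M = \sum_(k < N) d * M.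
      by rewrite sumr_const card_ord -(mulr_natl _ N) mulrA NE.
    apply: ler_sum => k _.
    have kD : 0 <= k%:R * d <= D.
      rewrite mulr_ge0//=; apply: le_trans yD; rewrite -NE ler_wpM2r// ler_nat.
      exact: ltnW.
    rewrite (_ : _ - _ = d * Delta2 (k%:R * d) Fx (z - k%:R * d)).
      by rewrite normrM ger0_norm// ler_wpM2l// smoothM.
    rewrite /Delta2 subrK (_ : z - _ + 2 * _ = z + k%:R * d); last by ring.
    by ring.
  have dF : `|d * (Fx (z - y) - Fx z)| <= d.
    rewrite normrM ger0_norm// -[leRHS]mulr1 ler_wpM2l//.
    by rewrite ler_norml; have := unif_cdf01 (z - y); have := unif_cdf01 z; lra.
  move: H1 H2 dF; rewrite /S1 A1E !ler_norml; lra.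
have SD : `|S D - S 0| <= D * M * `|D - 0|.
  apply: lipschitz_has_deriv Sd _ => y.
  rewrite (min_idPl (ltW D0)) (max_idPr (ltW D0)) => /andP[y0 yD].
  apply: le_trans (S1b _ _) _; first by rewrite y0.
  by rewrite ler_wpM2r.
move: SD; rewrite subr0 (gtr0_norm D0) (_ : S 0 = 0); last first.
  by rewrite /S addr0 subr0; ring.
rewrite subr0 Ex_ramp => SD.
rewrite (_ : _ - _ = S D / D ^+ 2); last first.
  by rewrite /S /Q; field; rewrite lt0r_neq0.
rewrite normrM (@gtr0_norm _ (D ^- 2)) ?invr_gt0// ler_pdivrMr//.
by apply: le_trans SD _; rewrite /M; lra.
Qed.

End SecondDifferences.

(** * Concentration of a sum in windows of width D *)

Section Concentration.
Variables (R : realType) (T : finType) (X : T -> R).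
Implicit Types (t s u y z : R).

Local Notation Fx := (unif_cdf X).

Hypothesis T0 : (0 < #|T|)%N.
Variables (C1 D K : R).
Hypotheses (C10 : 0 < C1) (D0 : 0 < D) (D1 : D <= 1).
Hypothesis smooth : forall z y, 0 <= y <= D ->
  `|Delta2 y Fx z| <= C1 * (D ^+ 2 + y ^+ 2).
Hypotheses (K1 : 1 <= K) (second_moment : Ex (fun w => X w ^+ 2) <= K).

(** Mass of the window []u, u + D]]; the increment of [p] over a step D is exactly [Delta2 D Fx]. *)
Let p u := Fx (u + D) - Fx u.

Let p0 u : 0 <= p u.
Proof. by rewrite subr_ge0 unif_cdf_incr// lerDl ltW. Qed.

Let p_step u : `|p (u + D) - p u| <= 2 * C1 * D ^+ 2.
Proof.
have /(smooth u) : 0 <= D <= D by rewrite lexx ltW.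
rewrite (_ : Delta2 _ _ _ = p (u + D) - p u); last first.
  by rewrite /Delta2 /p (_ : u + 2 * D = u + D + D); ring.
by move=> H; apply: le_trans H _; lra.
Qed.

Let p_right u (n : nat) : p u - n%:R * (2 * C1 * D ^+ 2) <= p (u + n%:R * D).
Proof.
elim: n => [|n IH]; first by rewrite !mul0r subr0 addr0.
have := p_step (u + n%:R * D).
rewrite (_ : u + n%:R * D + D = u + n.+1%:R * D); last by rewrite -natr1; ring.
by rewrite -[n.+1%:R]natr1 ler_norml; lra.
Qed.

Let p_left u (n : nat) : p u - n%:R * (2 * C1 * D ^+ 2) <= p (u - n%:R * D).
Proof.
elim: n => [|n IH]; first by rewrite !mul0r !subr0.
have := p_step (u - n.+1%:R * D).
rewrite (_ : _ - _ + D = u - n%:R * D); last by rewrite -natr1; ring.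
by rewrite -[n.+1%:R]natr1 ler_norml; lra.
Qed.

(** Adjacent windows are added up. The k-th one loses at most 2 k C1 D^2, and the losses sum to J (J
    - 1) C1 D^2. *)
Let F_right u (J : nat) : J%:R * p u - J%:R ^+ 2 * (C1 * D ^+ 2) <= Fx (u + J%:R * D) - Fx u.
Proof.
elim: J => [|J IH]; first by rewrite expr0n /= !mul0r addr0 !subrr.
have := p_right u J; rewrite {2}/p.
rewrite (_ : u + J%:R * D + D = u + J.+1%:R * D); last by rewrite -natr1; ring.
rewrite -[J.+1%:R]natr1; have : 0 <= C1 * D ^+ 2 by rewrite mulr_ge0 ?sqr_ge0// ltW.
by move: IH; lra.
Qed.

Let F_left u (J : nat) : J%:R * p u - J%:R ^+ 2 * (C1 * D ^+ 2)
   <= Fx (u + D) - Fx (u + D - J%:R * D).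
Proof.
elim: J => [|J IH]; first by rewrite expr0n /= !mul0r !subr0 !subrr.
have := p_left u J; rewrite {2}/p.
rewrite (_ : u - J%:R * D + D = u + D - J%:R * D); last by ring.
rewrite (_ : u - J%:R * D = u + D - J.+1%:R * D); last by rewrite -natr1; ring.
rewrite -[J.+1%:R]natr1; have : 0 <= C1 * D ^+ 2 by rewrite mulr_ge0 ?sqr_ge0// ltW.
by move: IH; lra.
Qed.

Let tail_right u : 0 < u -> 1 - Fx u <= K / u ^+ 2.
Proof.
move=> u0; have u2 : 0 < u ^+ 2 by exact: exprn_gt0.
rewrite ler_pdivlMr//; apply: le_trans second_moment.
rewrite unif_cdfE -[X in X - _](ExC T0) -ExB mulrC -ExZ; apply: Ex_le => w.
have [Xu|Xu] := leP (X w) u; first by rewrite subrr mulr0 sqr_ge0.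
by rewrite subr0 mulr1 lerXn2r ?nnegrE; lra.
Qed.

Let tail_left u : u < 0 -> Fx u <= K / u ^+ 2.
Proof.
move=> u0; have u2 : 0 < u ^+ 2 by rewrite -sqrrN exprn_gt0// oppr_gt0.
rewrite ler_pdivlMr//; apply: le_trans second_moment.
rewrite unif_cdfE mulrC -ExZ; apply: Ex_le => w.
have [Xu|Xu] := leP (X w) u; last by rewrite mulr0 sqr_ge0.
rewrite mulr1 -sqrrN -(sqrrN (X w)) lerXn2r ?nnegrE; lra.
Qed.

(* The increments of F over windows of width D vary by at most 2 C1 D^2 from
   one window to the next; sum about 1/(s D) of them. *)
Let window q s W : 0 <= q -> 1 <= s -> q <= W -> W * s ^+ 2 <= 4 * K ->
  (forall J : nat, J%:R * q - J%:R ^+ 2 * (C1 * D ^+ 2) <= W) ->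
  q * s <= (4 * K + 2 * C1) * D.
Proof.
move: (C10) (D0) (D1) (K1) => C1_gt0 D_gt0 D_le1 K_ge1 q0 s1 qW Ws H.
have [sD|sD] := leP 1 (s * D).
  have : q * s ^+ 2 <= 4 * K by apply: le_trans Ws; rewrite ler_wpM2r ?sqr_ge0.
  have qs0 : 0 <= q * s by rewrite mulr_ge0//; lra.
  move=> H1; have : q * s <= q * s * (s * D) by rewrite ler_peMr.
  have : q * s * (s * D) <= 4 * K * D.
    by rewrite mulrA ler_wpM2r//; [exact: ltW | move: H1; rewrite expr2; lra].
  have : 0 <= C1 * D by rewrite mulr_ge0// ltW.
  lra.
have s0 : 0 < s by lra.
have sD0 : 0 < s * D by rewrite mulr_gt0.
pose J := (Num.trunc (s * D)^-1).+1.
have inv1 : 1 <= (s * D)^-1 by rewrite invf_ge1// ltW.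
have J1 : (s * D)^-1 <= J%:R by apply/ltW; rewrite truncnS_gt.
have J2 : J%:R <= 2 * (s * D)^-1.
  have : (Num.trunc (s * D)^-1)%:R <= (s * D)^-1.
    by rewrite truncn_le// invr_ge0 ltW.
  by rewrite /J -natr1; lra.
have J1' : 1 <= J%:R * (s * D) by rewrite -ler_pdivrMr// div1r.
have J2' : J%:R * (s * D) <= 2 by rewrite -ler_pdivlMr.
have J0 : 0 <= J%:R :> R by [].
have Jpos : 0 < J%:R :> R by [].
have W0 : 0 <= W by exact: le_trans qW.
have q1 : q <= W * (s * D) + J%:R * (C1 * D ^+ 2).
  have : q <= (W + J%:R ^+ 2 * (C1 * D ^+ 2)) / J%:R.
    by rewrite ler_pdivlMr// mulrC; have := H J; lra.
  have : W / J%:R <= W * (s * D).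
    by rewrite ler_wpM2l// -[leRHS]invrK lef_pV2 ?posrE ?invr_gt0.
  rewrite mulrDl (_ : J%:R ^+ 2 * _ / _ = J%:R * (C1 * D ^+ 2)); first lra.
  by field; rewrite lt0r_neq0.
have c0 : 0 <= C1 * D by rewrite mulr_ge0// ltW.
have q2 : J%:R * (s * D) * (C1 * D) <= 2 * (C1 * D) by rewrite ler_wpM2r.
have q3 : W * s ^+ 2 * D <= 4 * K * D by rewrite ler_wpM2r// ltW.
have : q * s <= (W * (s * D) + J%:R * (C1 * D ^+ 2)) * s by rewrite ler_wpM2r// ltW.
lra.
Qed.

(** Away from the origin, windows are added outwards and W is the tail mass there, so that
    Chebyshev's inequality supplies W s^2 <= 4 K; for -D <= u <= 1 the choice W = 1 is enough. The
    factor 2 over [window] comes from u < -D, where the tail starts at v = u + D and 1 + |u| <= 2 (1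
    + |v|). *)
Lemma cdf_window_bound u : (1 + `|u|) * (Fx (u + D) - Fx u) <= (8 * K + 4 * C1) * D.
Proof.
move: (C10) (D0) (D1) (K1) => C1_gt0 D_gt0 D_le1 K_ge1.
rewrite -/(p u) mulrC.
have C1D : 0 <= C1 * D by rewrite mulr_ge0 // ltW.
have KD : 0 <= K * D by rewrite mulr_ge0; lra.
have F01 a : 0 <= Fx a <= 1 by exact: unif_cdf01.
have [uD|uD] := ltP u (- D).
  pose v := u + D; have v0 : v < 0 by rewrite /v; lra.
  have vu : 1 + `|u| <= 2 * (1 + `|v|) by rewrite !ltr0_norm /v; lra.
  have FJ J : J%:R * p u - J%:R ^+ 2 * (C1 * D ^+ 2) <= Fx v.
    by apply: le_trans (F_left u J) _; have := F01 (u + D - J%:R * D); rewrite /v; lra.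
  have pF : p u <= Fx v by rewrite /p -/v; have := F01 u; lra.
  have FW : Fx v * (1 + `|v|) ^+ 2 <= 4 * K.
    have [v1|v1] := leP `|v| 1.
      have : (1 + `|v|) ^+ 2 <= 4 by have := normr_ge0 v; nra.
      by have := F01 v; have := sqr_ge0 (1 + `|v|); nra.
    have := tail_left v0; rewrite ler_pdivlMr; last by rewrite -sqrrN exprn_gt0 ?oppr_gt0.
    have : (1 + `|v|) ^+ 2 <= 4 * v ^+ 2.
      by rewrite -(real_normK (num_real v)); nra.
    by have := F01 v; nra.
  have := window (p0 u) _ pF FW FJ; rewrite lerDl normr_ge0 => /(_ isT) Hw.
  have : p u * (1 + `|u|) <= p u * (2 * (1 + `|v|)) by rewrite ler_wpM2l ?p0.
  by lra.
have FJ (W : R) : 1 - Fx u <= W \/ 1 <= W ->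
    forall J : nat, J%:R * p u - J%:R ^+ 2 * (C1 * D ^+ 2) <= W.
  move=> FuW J; apply: le_trans (F_right u J) _.
  by have := F01 (u + J%:R * D); have := F01 u; case: FuW; lra.
have pF (W : R) : 1 - Fx u <= W \/ 1 <= W -> p u <= W.
  by rewrite /p; have := F01 (u + D); have := F01 u => ? ? []; lra.
have u1 : 1 <= 1 + `|u| by rewrite lerDl.
have [ule|ult] := leP u 1.
  have nu : `|u| <= 1 by rewrite ler_norml; lra.
  have := @window (p u) (1 + `|u|) 1 (p0 u) u1 (pF _ (or_intror (lexx _))) _
    (FJ _ (or_intror (lexx _))).
  have : (1 + `|u|) ^+ 2 <= 4 by have := normr_ge0 u; nra.
  rewrite mul1r => ? /(_ _)/le_trans -> //; lra.
have nu : `|u| = u by rewrite ger0_norm; lra.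
have := @window (p u) (1 + `|u|) _ (p0 u) u1 (pF _ (or_introl (lexx _))) _
    (FJ _ (or_introl (lexx _))).
move=> /(_ _)/le_trans -> //; last by lra.
have := @tail_right u; rewrite ler_pdivlMr; last by rewrite exprn_gt0//; lra.
move=> /(_ _); rewrite nu; have := F01 u => ? /(_ ltac:(lra)).
have : (1 + u) ^+ 2 <= 4 * u ^+ 2 by nra.
nra.
Qed.

(** The kernel is at most 1/D and lives on two adjacent windows of width D, on which 1 + |x| <= 2 +
    |z|. The decay of the window masses absorbs |z|; only the shift remains, as 3 + |t|. *)
Lemma Ex_dramp_weight z t :
  Ex (fun w => (1 + `|X w + t|) * `|dramp D z (X w + t)|)
    <= 2 * (8 * K + 4 * C1) * (3 + `|t|).
Proof.
move: (C10) (D0) (D1) (K1) => C1_gt0 D_gt0 D_le1 K_ge1.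
have pt w : (1 + `|X w + t|) * `|dramp D z (X w + t)| <=
   (2 + `|z|) / D * ((X w <= z + D - t)%R%:R - (X w <= z - D - t)%R%:R).
  have [/andP[H1 H2]|H] := boolP (z - D < X w + t <= z + D).
    rewrite (_ : X w <= z + D - t = true); last by lra.
    rewrite (_ : X w <= z - D - t = false); last by apply/negbTE; rewrite -ltNge; lra.
    rewrite subr0 mulr1; apply: ler_pM => //.
      have := ler_norm z; have := ler_norm (- z); rewrite normrN => ? ?.
      have : `|X w + t| <= 1 + `|z| by rewrite ler_norml; lra.
      lra.
    have : 0 <= D^-1 by rewrite invr_ge0 ltW.
    by have := dramp_bound z D0 (X w + t); rewrite ler_norml; lra.
  rewrite dramp_out// normr0 mulr0 mulr_ge0//; first by rewrite divr_ge0 ?addr_ge0// ltW.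
  rewrite subr_ge0 ler_nat; have [a|//] := boolP (X w <= z - D - t).
  by rewrite (_ : X w <= z + D - t = true)//; lra.
apply: le_trans (Ex_le pt) _; rewrite ExZ ExB -!unif_cdfE.
rewrite mulrAC ler_pdivrMr//.
have W1 := cdf_window_bound (z - t); have W2 := cdf_window_bound (z - D - t).
rewrite (_ : z - D - t + D = z - t) in W2; last by ring.
rewrite (_ : z - t + D = z + D - t) in W1; last by ring.
have nz : `|z| <= `|z - t| + `|t| by rewrite -{1}(subrK t z) ler_normD.
have nzD : `|z| <= `|z - D - t| + 1 + `|t|.
  rewrite -{1}(_ : z - D - t + D + t = z); last by ring.
  apply: le_trans (ler_normD _ _) _; rewrite lerD2r.
  by apply: le_trans (ler_normD _ _) _; rewrite lerD2l gtr0_norm.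
have key (a b : R) : 0 <= b -> (1 + `|a|) * b <= (8 * K + 4 * C1) * D ->
    `|z| <= `|a| + 1 + `|t| -> (2 + `|z|) * b <= (8 * K + 4 * C1) * (3 + `|t|) * D.
  move=> b0 H za; apply: (@le_trans _ _ ((1 + `|a|) * b * (3 + `|t|))).
    rewrite mulrAC ler_wpM2r//.
    by have := normr_ge0 a; have := normr_ge0 t; nra.
  by rewrite [leRHS]mulrAC ler_wpM2r// addr_ge0.
have P1 : 0 <= Fx (z + D - t) - Fx (z - t) by rewrite subr_ge0 unif_cdf_incr//; lra.
have P2 : 0 <= Fx (z - t) - Fx (z - D - t) by rewrite subr_ge0 unif_cdf_incr//; lra.
have nz1 : `|z| <= `|z - t| + 1 + `|t| by lra.
by have := key _ _ P1 W1 nz1; have := key _ _ P2 W2 nzD; lra.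
Qed.

End Concentration.

(** * Regularity of the solution *)

Section SteinRegularity.
Variables (R : realType) (D z c : R) (kap dkap ddkap f : R -> R).
Implicit Types (x y s t : R).

Local Notation h := (ramp D z).
Local Notation dh := (dramp D z).

Definition stein_d1 x := (x * f x + h x - c) * (1 - kap x).
Definition stein_d2 x :=
  (f x + x * stein_d1 x + dh x) * (1 - kap x) - (x * f x + h x - c) * dkap x.

Hypotheses (D0 : 0 < D) (D1 : D <= 1) (c01 : 0 <= c <= 1).
Hypotheses (kapd : has_deriv kap dkap) (dkapd : has_deriv dkap ddkap).
Hypotheses (kap_le : forall x, `|kap x| <= 2^-1) (dkap_le : forall x, `|dkap x| <= D)
  (ddkap_le : forall x, `|ddkap x| <= 3).
Hypotheses (fd : has_deriv f stein_d1) (f_le : forall x, `|f x| <= 5 / 2)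
  (xf_le : forall x, `|x * f x| <= 1).

Let r x := x * f x + h x - c.

Let r_deriv : has_deriv r (fun x => f x + x * stein_d1 x + dh x).
Proof.
apply: has_deriv_eq.
  apply: has_derivB (has_derivC c); apply: has_derivD (ramp_deriv D z).
  exact: has_derivM (@has_derivX R) fd.
by move=> x /=; ring.
Qed.

Let kap1_deriv : has_deriv (fun x => 1 - kap x) (fun x => - dkap x).
Proof.
by apply: has_deriv_eq (has_derivB (has_derivC 1) kapd) _ => x; rewrite sub0r.
Qed.

Let kap1 x : `|1 - kap x| <= 3 / 2.
Proof. by have := kap_le x; rewrite !ler_norml; lra. Qed.

Lemma stein_res_le x : `|r x| <= 2.
Proof.
have := xf_le x; have := ramp01 z D0 x; move: (c01) => c01'.
by rewrite /r !ler_norml; lra.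
Qed.

Let le_mul (a b u v : R) : `|a| <= u -> `|b| <= v -> `|a * b| <= u * v.
Proof. by move=> au bv; rewrite normrM ler_pM. Qed.

Lemma stein_d1_le x : `|stein_d1 x| <= 3.
Proof. by apply: le_trans (le_mul (stein_res_le x) (kap1 x)) _; lra. Qed.

Lemma stein_d1_deriv : has_deriv stein_d1 stein_d2.
Proof.
apply: has_deriv_eq (has_derivM r_deriv kap1_deriv) _ => x /=.
by rewrite /stein_d2 /r; ring.
Qed.

Let dr_le x : `|f x + x * stein_d1 x| <= 5 / 2 + 3 * `|x|.
Proof.
apply: le_trans (ler_normD _ _) _; apply: lerD => //.
by rewrite mulrC; exact: le_mul (stein_d1_le x) (lexx _).
Qed.

Lemma stein_d2_le x : `|stein_d2 x| <= 6 + 5 * `|x| + 2 * `|dh x|.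
Proof.
apply: le_trans (ler_normB _ _) _; move: (D1) => D1'.
have H1 : `|f x + x * stein_d1 x + dh x| <= 5 / 2 + 3 * `|x| + `|dh x|.
  by apply: le_trans (ler_normD _ _) _; rewrite lerD2r.
have := le_mul H1 (kap1 x); have := le_mul (stein_res_le x) (dkap_le x).
by have := normr_ge0 x; have := normr_ge0 (dh x); lra.
Qed.

Let dh_le x : `|dh x| <= D^-1.
Proof.
have : 0 <= D^-1 by rewrite invr_ge0 ltW.
by have := dramp_bound z D0 x; rewrite ler_norml; lra.
Qed.

Lemma stein_d2_le_scale x : `|stein_d2 x| <= 8 / D + 5 * `|x|.
Proof.
apply: le_trans (stein_d2_le x) _; have := dh_le x.
have : 1 <= D^-1 by rewrite invf_ge1.
lra.
Qed.

Let g x := (f x + x * stein_d1 x) * (1 - kap x) - r x * dkap x.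
Let dg x := (2 * stein_d1 x + x * stein_d2 x) * (1 - kap x)
  - (f x + x * stein_d1 x) * dkap x
  - ((f x + x * stein_d1 x + dh x) * dkap x + r x * ddkap x).
Let m x := (kap z - kap x) * dh x.

Let g_deriv : has_deriv g dg.
Proof.
apply: has_deriv_eq.
  apply: has_derivB (has_derivM r_deriv dkapd).
  apply: has_derivM kap1_deriv; apply: has_derivD fd _.
  exact: has_derivM (@has_derivX R) stein_d1_deriv.
by move=> x /=; rewrite /dg; ring.
Qed.

Let stein_d2_split x : stein_d2 x = (1 - kap z) * dh x + m x + g x.
Proof. by rewrite /stein_d2 /m /g /r; ring. Qed.

Let dg_le x : `|dg x| <= 29 + 15 * x ^+ 2 + 3 * ((1 + `|x|) * `|dh x|).
Proof.
move: (D0) (D1) => D_gt0 D_le1.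
have n0 := normr_ge0 x; have d0 := normr_ge0 (dh x).
have H1 : `|2 * stein_d1 x + x * stein_d2 x| <= 6 + `|x| * (6 + 5 * `|x| + 2 * `|dh x|).
  apply: le_trans (ler_normD _ _) _; apply: lerD.
    by rewrite normrM ger0_norm//; have := stein_d1_le x; lra.
  exact: le_mul (lexx _) (stein_d2_le x).
have := le_mul H1 (kap1 x).
have := le_mul (dr_le x) (dkap_le x).
have : `|dh x * dkap x| <= 1.
  by apply: le_trans (le_mul (dh_le x) (dkap_le x)) _; rewrite mulVf ?lt0r_neq0.
have := le_mul (stein_res_le x) (ddkap_le x).
set A1 := `|r x * _|; set A2 := `|dh x * _|; set A3 := `|(f x + _) * dkap x|.
set A4 := `|(2 * _ + _) * _| => a1 a2 a3 a4.
have tri : `|dg x| <= A4 + A3 + A3 + A2 + A1.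
  have := lexx A1; rewrite {1}/A1 ler_norml; have := lexx A2; rewrite {1}/A2 ler_norml.
  have := lexx A3; rewrite {1}/A3 ler_norml; have := lexx A4; rewrite {1}/A4 ler_norml.
  by rewrite /dg (mulrDl _ (dh x)) ler_norml; lra.
apply: le_trans tri _.
have : (5 / 2 + 3 * `|x|) * D <= 5 / 2 + 3 * `|x| by rewrite ler_piMr//; lra.
have : x ^+ 2 = `|x| * `|x| by rewrite -expr2 real_normK ?num_real.
have : 0 <= `|x| * `|dh x| by rewrite mulr_ge0.
have : 0 <= (`|x| - 1) ^+ 2 by rewrite sqr_ge0.
rewrite expr2; move: a3 a4; move: `|x| `|dh x| n0 d0 => u v u0 v0; lra.
Qed.

(** Unless one of the points lies in the window both values vanish. For a point in the window, 4
    comes from the variation of the kernel, 4 / D^2 against D^2, and 1 from that of [kap], D against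
    1 / D. *)
Let m_lipschitz x y : `|m x - m y| <= 5 * `|x - y|.
Proof.
move: (D0) (D1) => D_gt0 D_le1.
have D2 : 0 < D ^+ 2 by exact: exprn_gt0.
have kl a b : `|kap a - kap b| <= D * `|a - b|.
  by apply: lipschitz_has_deriv kapd _ => *; exact: dkap_le.
have in_window a b : z - D < b <= z + D -> `|m a - m b| <= 5 * `|a - b|.
  move=> wb.
  rewrite (_ : m a - m b = (kap z - kap b) * (dh a - dh b) + (kap b - kap a) * dh a); last first.
    by rewrite /m; ring.
  apply: le_trans (ler_normD _ _) _.
  have H1 : `|kap z - kap b| <= D * D.
    apply: le_trans (kl _ _) _; rewrite ler_wpM2l ?(ltW D_gt0)// ler_norml; lra.
  have := le_mul H1 (dramp_lipschitz z D0 a b).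
  have := le_mul (kl b a) (dh_le a); rewrite distrC.
  rewrite [X in _ <= X -> _]mulrAC mulfV ?lt0r_neq0// mul1r.
  rewrite (_ : D * D * _ = 4 * `|a - b|); last by field; exact: lt0r_neq0.
  lra.
have [wy|wy] := boolP (z - D < y <= z + D); first exact: in_window.
have [wx|wx] := boolP (z - D < x <= z + D).
  by rewrite distrC (distrC x); exact: in_window.
by rewrite /m !dramp_out// !mulr0 subrr normr0 mulr_ge0.
Qed.

Variables (T : finType) (X : T -> R) (C1 K : R).
Hypothesis T0 : (0 < #|T|)%N.
Hypotheses (C10 : 0 < C1) (K1 : 1 <= K) (second_moment : Ex (fun w => X w ^+ 2) <= K).
Hypothesis smooth : forall z y, 0 <= y <= D ->
  `|Delta2 y (unif_cdf X) z| <= C1 * (D ^+ 2 + y ^+ 2).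

Let sq_shift t : Ex (fun w => (X w + t) ^+ 2) <= 2 * K + 2 * t ^+ 2.
Proof.
have H w : (X w + t) ^+ 2 <= 2 * X w ^+ 2 + 2 * t ^+ 2.
  by have := sqr_ge0 (X w - t); lra.
apply: le_trans (Ex_le H) _; rewrite ExD ExZ (ExC T0).
by move: (second_moment) => SM; lra.
Qed.

Let abs_shift t : Ex (fun w => `|X w + t|) <= K + `|t|.
Proof.
have H w : `|X w + t| <= 2^-1 * X w ^+ 2 + (2^-1 + `|t|).
  apply: le_trans (ler_normD _ _) _; rewrite addrA lerD2r.
  have := sqr_ge0 (`|X w| - 1); rewrite -(real_normK (num_real (X w))).
  lra.
apply: le_trans (Ex_le H) _; rewrite ExD ExZ (ExC T0).
by move: (second_moment) (K1) => SM K_ge1; lra.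
Qed.

Let weight t : Ex (fun w => (1 + `|X w + t|) * `|dh (X w + t)|)
    <= 2 * (8 * K + 4 * C1) * (3 + `|t|).
Proof. exact: Ex_dramp_weight. Qed.

Lemma Ex_stein_d2 t :
  Ex (fun w => `|stein_d2 (X w + t)|) <= 110 * (K + C1) * (1 + `|t|).
Proof.
move: (C10) (K1) => C1_gt0 K_ge1.
have H w : `|stein_d2 (X w + t)| <=
    6 + 5 * `|X w + t| + 2 * ((1 + `|X w + t|) * `|dh (X w + t)|).
  apply: le_trans (stein_d2_le _) _; rewrite lerD2l ler_wpM2l//.
  by rewrite ler_peMl// lerDl.
apply: le_trans (Ex_le H) _; rewrite !ExD !ExZ (ExC T0).
have := abs_shift t; have := weight t; have := normr_ge0 t.
move: `|t| => u u0 H1 H2.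
have Ku : 0 <= (K - 1) * u by rewrite mulr_ge0//; lra.
have Cu : 0 <= C1 * u by rewrite mulr_ge0// ltW.
lra.
Qed.

(** The three parts of the split contribute 3 C1, 5 and 450 (K + C1). Keeping the shifts in [-2, 2]
    turns their powers in the mean of [dg] into constants. *)
Lemma Ex_stein_d2_lipschitz s t : `|s| <= 2 -> `|t| <= 2 ->
  `|Ex (fun w => stein_d2 (X w + t)) - Ex (fun w => stein_d2 (X w + s))|
    <= 460 * (K + C1) * `|t - s|.
Proof.
move: (C10) (K1) => C1_gt0 K_ge1 s2 t2.
have E u : Ex (fun w => stein_d2 (X w + u)) = (1 - kap z) * Ex (fun w => dh (X w + u))
    + Ex (fun w => m (X w + u)) + Ex (fun w => g (X w + u)).
  by rewrite -ExZ -!ExD; apply: eq_Ex => w; exact: stein_d2_split.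
have dist0 := normr_ge0 (t - s).
have B1 := le_mul (kap1 z) (Ex_dramp_lipschitz T0 C10 D0 smooth z s t).
have B2 : `|Ex (fun w => m (X w + t)) - Ex (fun w => m (X w + s))| <= 5 * `|t - s|.
  rewrite -[leRHS](ExC T0); apply: le_trans (Ex_norm_sub _ _) (Ex_le _) => w.
  by apply: le_trans (m_lipschitz _ _) _; rewrite opprD addrACA subrr add0r.
have B3 : `|Ex (fun w => g (X w + t)) - Ex (fun w => g (X w + s))|
    <= 450 * (K + C1) * `|t - s|.
  have Gd : has_deriv (fun u => Ex (fun w => g (X w + u))) (fun u => Ex (fun w => dg (X w + u))).
    apply: Ex_deriv => w u; under eq_fun do rewrite addrC; rewrite addrC.
    exact: has_deriv_shift g_deriv u.
  apply: lipschitz_has_deriv Gd _ => u u2.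
  have {}u2 : `|u| <= 2.
    move: u2 s2 t2; rewrite ge_min le_max !ler_norml => /andP[/orP[?|?] /orP[?|?]]; lra.
  apply: le_trans (Ex_norm_le (fun w => dg_le (X w + u))) _.
  rewrite !ExD !ExZ (ExC T0).
  have := sq_shift u; have := weight u; rewrite -(real_normK (num_real u)).
  have := normr_ge0 u; move: `|u| u2 => v v2 v0 H1 H2.
  have v4 : v ^+ 2 <= 4 by nra.
  have Kv : 0 <= K * (2 - v) by rewrite mulr_ge0//; lra.
  have Cv : 0 <= C1 * (2 - v) by rewrite mulr_ge0//; lra.
  lra.
rewrite !E (_ : _ - _ = (1 - kap z) *
  (Ex (fun w => dh (X w + t)) - Ex (fun w => dh (X w + s)))
  + (Ex (fun w => m (X w + t)) - Ex (fun w => m (X w + s)))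
  + (Ex (fun w => g (X w + t)) - Ex (fun w => g (X w + s)))); last by ring.
apply: le_trans (ler_normD _ _) _; apply: (@le_trans _ _ (3 / 2 * (2 * C1 * `|t - s|)
   + 5 * `|t - s| + 450 * (K + C1) * `|t - s|)).
  by apply: lerD => //; apply: le_trans (ler_normD _ _) _; apply: lerD.
have Ku : 0 <= (K - 1) * `|t - s| by rewrite mulr_ge0//; lra.
have Cu : 0 <= C1 * `|t - s| by rewrite mulr_ge0// ltW.
lra.
Qed.

End SteinRegularity.

(** * The constant of the Stein equation *)

Section StandardNormal.
Variable R : realType.
Implicit Types (x y e : R).

Local Notation phi := (normal_pdf (0 : R) 1).

Let P : probability (measurableTypeR R) R := normal_prob 0 1.
(** The identity as a random variable under the normal law: its distribution function is [Phi], to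
    which the limit theorems at both infinities then apply. *)
Let idTR : measurableTypeR R -> R := idfun.
#[local] HB.instance Definition _ :=
  @isMeasurableFun.Build _ _ _ _ idTR (@measurable_id _ _ setT).

Lemma Phi_ltNy e : 0 < e -> exists M : R, forall x, x < M -> `|Phi x| < e.
Proof.
move=> e0.
have /fine_cvg /cvgrPdist_lt /(_ _ e0) := @cvg_cdfNy0 _ _ _ P (idTR : {RV P >-> R}).
by case=> M [_ H]; exists M => x /H /=; rewrite sub0r normrN.
Qed.

Lemma Phi_lty e : 0 < e -> exists M : R, forall x, M < x -> `|1 - Phi x| < e.
Proof.
move=> e0.
have /fine_cvg /cvgrPdist_lt /(_ _ e0) := @cvg_cdfy1 _ _ _ P (idTR : {RV P >-> R}).
by case=> M [_ H]; exists M => x /H.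
Qed.

Lemma Phi_deriv : has_deriv (@Phi R) phi.
Proof.
move=> x.
have [||||Id Ie] := @continuous_FTC1 R phi (BInfty _ true) x (x + 1) _ _ _ _.
- by rewrite ltrDl.
- apply: (integrableS measurableT _ (@subsetT _ _) (integrable_normal_pdf 0 1)).
  exact: measurable_itv.
- by rewrite ltNyr.
- exact: continuous_normal_pdf.
apply: is_derive_eq; first exact: derivableP.
by rewrite -derive1E Ie.
Qed.

Lemma psiE : @psi R = phi.
Proof. by apply/funext => x; rewrite /psi derive1E; case: (Phi_deriv x). Qed.

Lemma Phi01 x : 0 <= Phi x <= 1.
Proof.
have A : (0 <= normal_prob (0 : R) 1 `]-oo, x])%E by exact: measure_ge0.
have B : (normal_prob (0 : R) 1 `]-oo, x] <= 1)%E.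
  by apply: (@probability_le1 _ _ _ P); exact: measurable_itv.
have F : normal_prob (0 : R) 1 `]-oo, x] \is a fin_num.
  by rewrite ge0_fin_numE//; exact: le_lt_trans B (ltry _).
by rewrite /Phi fine_ge0//= -lee_fin fineK.
Qed.

Lemma normal_pdf01E x : phi x = normal_peak 1 * expR (- (x ^+ 2 / 2)).
Proof.
rewrite normal_pdfE ?oner_neq0// /normal_fun subr0 expr1n; congr (_ * expR _).
by rewrite mulNr.
Qed.

Lemma normal_pdf01_deriv : has_deriv phi (fun x => - x * phi x).
Proof.
have -> : phi = fun x => normal_peak 1 * expR (- (x ^+ 2 / 2)).
  by apply/funext => x; rewrite normal_pdf01E.
apply: has_deriv_eq.
  apply: has_derivZ; apply: has_deriv_expR; apply: has_derivN.
  exact: has_derivM (@has_derivXn R 2) (has_derivC 2^-1).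
by move=> x /=; field.
Qed.

(** From e^y >= 1 + y^3 / 6 at y = x^2 / 2, whence 48 = 8 * 6. Degree 6 is what the later estimates
    require: a factor of degree 4 times 1 + x^2. *)
Lemma normal_pdf01_decay x : 0 <= phi x /\ phi x * (1 + x ^+ 6) <= 48.
Proof.
have pk : 0 <= normal_peak (1 : R) <= 1.
  rewrite normal_peak_ge0 /= /normal_peak invf_le1; last first.
    by rewrite sqrtr_gt0 expr1n mul1r mulrn_wgt0// pi_gt0.
  rewrite -[leLHS]sqrtr1 ler_wsqrtr// expr1n mul1r.
  by have := pi_ge2 R; lra.
split; first exact: normal_pdf_ge0.
have y0 : 0 <= x ^+ 2 / 2 by rewrite divr_ge0 ?sqr_ge0.
have := @expR_ge1Dxn R _ 2 y0; rewrite (_ : (3`!)%:R = 6)//.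
have -> : (x ^+ 2 / 2) ^+ 3 = x ^+ 6 / 8 by rewrite expr_div_n -exprM (_ : 2 ^+ 3 = 8)//; ring.
rewrite normal_pdf01E => H.
have E0 := expR_gt0 (- (x ^+ 2 / 2)).
have EE : expR (- (x ^+ 2 / 2)) * expR (x ^+ 2 / 2) = 1 by rewrite -expRD addNr expR0.
have x6 : 0 <= x ^+ 6 by rewrite (exprM x 2 3) exprn_ge0 ?sqr_ge0.
have : expR (- (x ^+ 2 / 2)) * (1 + x ^+ 6 / 8 / 6) <= 1.
  by rewrite -[leRHS]EE ler_wpM2l// ltW.
case/andP: pk => p0 p1.
move: (normal_peak 1) (expR (- _)) E0 p0 p1 => p E E0 p0 p1 HE.
have HE2 : E * (1 + x ^+ 6) <= 48 by nra.
have B0 : 0 <= E * (1 + x ^+ 6) by rewrite mulr_ge0 ?addr_ge0// ltW.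
by rewrite -mulrA; apply: le_trans HE2; rewrite ler_piMl.
Qed.

Lemma pow_le6 (u : R) k : (k <= 6)%N -> 0 <= u -> u ^+ k <= 1 + u ^+ 6.
Proof.
move=> k6 u0; have [u1|/ltW u1] := leP u 1.
  by apply: (@le_trans _ _ 1); [exact: exprn_ile1 | rewrite lerDl exprn_ge0].
by apply: (@le_trans _ _ (u ^+ 6)); [exact: ler_weXn2l | rewrite lerDr].
Qed.

Lemma normal_pdf01_poly x (q C : R) : 0 <= C ->
  `|q| <= C * (1 + x ^+ 6) -> phi x * `|q| <= 48 * C.
Proof.
have [p0 pd] := normal_pdf01_decay x => C0 H.
apply: (@le_trans _ _ (C * (phi x * (1 + x ^+ 6)))).
  by rewrite mulrCA ler_wpM2l.
by rewrite mulrC ler_wpM2r.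
Qed.

(** [atan] is the explicit antiderivative of the majorant 1 / (1 + x^2); its oscillation pi, rounded
    up to 4, bounds integrals over half-lines uniformly. *)
Lemma atan_var x y : atan x - atan y <= 4.
Proof.
have := atan_ltpi2 x; have := atan_gtNpi2 y; have := @pihalf_lt2 R.
lra.
Qed.

Lemma atan_deriv : has_deriv (@atan R) (fun x => (1 + x ^+ 2)^-1).
Proof. by move=> x; exact: is_derive1_atan. Qed.

Lemma normal_pdf01_atan x (q C : R) : 0 <= C ->
  `|q| * (1 + x ^+ 2) <= C * (1 + x ^+ 6) -> phi x * `|q| <= 48 * C / (1 + x ^+ 2).
Proof.
move=> C0 H; have x2 : 0 < 1 + x ^+ 2 by rewrite ltr_wpDr ?sqr_ge0.
rewrite ler_pdivlMr// -mulrA -[1 + x ^+ 2]gtr0_norm// -normrM.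
by apply: normal_pdf01_poly => //; rewrite normrM (gtr0_norm x2).
Qed.

Lemma inv_sq_small (C e : R) : 0 <= C -> 0 < e ->
  exists M, forall x, M < `|x| -> C / (1 + x ^+ 2) < e.
Proof.
move=> C0 e0; exists (C / e + 1) => x xM.
have Ce : 0 <= C / e by rewrite divr_ge0// ltW.
have x2 : 0 < 1 + x ^+ 2 by rewrite ltr_wpDr ?sqr_ge0.
rewrite ltr_pdivrMr// mulrC -ltr_pdivrMr//.
rewrite -(real_normK (num_real x)); move: `|x| xM => u uM; nra.
Qed.

End StandardNormal.

(** * Comparison of the Stein constant with the Edgeworth expansion *)

Section SteinConstant.
Variables (R : realType) (D lam l z c : R) (f : R -> R).
Implicit Types (x y : R).

Local Notation phi := (normal_pdf (0 : R) 1).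
Local Notation h := (ramp D z).

(* The factor l x / 2 damped at the scale 1 / D, which keeps it below 1 / 2. *)
Definition skew x : R := l / 2 * x / (1 + D ^+ 2 * x ^+ 2).

Definition edgeworth x : R := Phi x - 6^-1 * lam * (x ^+ 2 - 1) * phi x.

Hypotheses (D0 : 0 < D) (D1 : D <= 1) (lam_le : `|lam| <= D) (l_le : `|l| <= 2 * D).
Hypothesis lam_l : `|l - lam| <= 8 * D ^+ 2.

Let den x : R := 1 + D ^+ 2 * x ^+ 2.

Let den_ge1 x : 1 <= den x.
Proof. by rewrite lerDl mulr_ge0 ?sqr_ge0. Qed.

Let den0 x : den x != 0.
Proof. by rewrite gt_eqF// (lt_le_trans ltr01). Qed.

(** With |l| <= 2 D this inequality of means is what keeps [skew] below 1/2; it also fixes the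
    damping scale 1 / D. *)
Let Dx_den x : 2 * (D * `|x|) <= den x.
Proof.
have := sqr_ge0 (D * `|x| - 1).
by rewrite /den -(real_normK (num_real x)); lra.
Qed.

Lemma skew_half x : `|skew x| <= 2^-1.
Proof.
have dx0 : 0 < den x := lt_le_trans ltr01 (den_ge1 x).
rewrite /skew -/(den x) normrM (normrM _ x) normfV (gtr0_norm dx0) ler_pdivrMr//.
rewrite normrM normfV (@ger0_norm _ 2)//; move: (l_le) => l_le'.
have : `|l| * `|x| <= 2 * D * `|x| by rewrite ler_wpM2r.
by have := Dx_den x; lra.
Qed.

Lemma skew_lin x : `|skew x - l / 2 * x| <= 2^-1 * D ^+ 2 * x ^+ 2.
Proof.
move: (D0) (l_le) => D_gt0 l_le'.
have dx0 : 0 < den x := lt_le_trans ltr01 (den_ge1 x).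
have -> : skew x - l / 2 * x = - (l / 2 * x * (D ^+ 2 * x ^+ 2)) / den x.
  by rewrite /skew; have := den0 x; rewrite /den => ?; field; rewrite ?exprMn.
rewrite normrM normrN normfV (gtr0_norm dx0) ler_pdivrMr//.
rewrite !normrM normfV !(@ger0_norm _ 2)// (gtr0_norm D_gt0).
have xx : x ^+ 2 = `|x| ^+ 2 by rewrite real_normK ?num_real.
have := Dx_den x; rewrite /den !xx.
move: `|l| `|x| (normr_ge0 l) (normr_ge0 x) l_le' => L u L0 u0 HL Hd.
have : 0 <= (D - L / 2) * (D ^+ 2 * u ^+ 2 * u).
  by apply: mulr_ge0 (mulr_ge0 (mulr_ge0 (sqr_ge0 D) (sqr_ge0 u)) u0); lra.
have : D ^+ 2 * u ^+ 2 * (2 * (D * u)) <= D ^+ 2 * u ^+ 2 * (1 + D ^+ 2 * u ^+ 2).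
  exact: ler_wpM2l (mulr_ge0 (sqr_ge0 D) (sqr_ge0 u)) _ _ Hd.
lra.
Qed.

Lemma skew_le x : `|skew x| <= D * `|x|.
Proof.
move: (l_le) => l_le'.
have dx0 : 0 < den x := lt_le_trans ltr01 (den_ge1 x).
rewrite /skew -/(den x) normrM (normrM _ x) normfV (gtr0_norm dx0) ler_pdivrMr//.
rewrite normrM normfV (@ger0_norm _ 2)//.
apply: (@le_trans _ _ (D * `|x|)); first by rewrite ler_wpM2r//; lra.
by rewrite ler_peMr// mulr_ge0// ltW.
Qed.

Let den_deriv : has_deriv den (fun x => 2 * D ^+ 2 * x).
Proof.
apply: has_deriv_eq.
  exact: has_derivD (has_derivC 1) (has_derivZ (D ^+ 2) (@has_derivXn R 2)).
by move=> x /=; ring.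
Qed.

Definition dskew x : R := l / 2 * (1 - D ^+ 2 * x ^+ 2) / den x ^+ 2.
Definition ddskew x : R :=
  l / 2 * (D ^+ 2 * x) * (2 * D ^+ 2 * x ^+ 2 - 6) / den x ^+ 3.

Lemma skew_deriv : has_deriv skew dskew.
Proof.
apply: has_deriv_eq.
  exact: has_derivM (has_derivZ (l / 2) (@has_derivX R)) (has_derivV den0 den_deriv).
by move=> x /=; rewrite /dskew; have := den0 x; rewrite /den => ?; field; rewrite ?exprMn.
Qed.

Lemma dskew_deriv : has_deriv dskew ddskew.
Proof.
have den20 x : den x ^+ 2 != 0 by rewrite expf_neq0.
have num := has_derivZ (l / 2) (has_derivB (has_derivC 1)
  (has_derivZ (D ^+ 2) (@has_derivXn R 2))).
have inv := has_derivV den20 (has_deriv_comp (@has_derivXn R 2) den_deriv).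
apply: (has_deriv_eq (has_derivM num inv)).
by move=> x /=; rewrite /ddskew; have := den0 x; rewrite /den => ?; field; rewrite ?exprMn.
Qed.

Lemma dskew_le x : `|dskew x| <= D.
Proof.
move: (l_le) => l_le'.
have dx0 : 0 < den x ^+ 2 by rewrite exprn_gt0// (lt_le_trans ltr01).
rewrite /dskew normrM normfV (gtr0_norm dx0) ler_pdivrMr//.
rewrite normrM normrM normfV (@ger0_norm _ 2)//.
apply: ler_pM => //; first by lra.
have s0 : 0 <= D ^+ 2 * x ^+ 2 by rewrite mulr_ge0 ?sqr_ge0.
by rewrite /den; move: (D ^+ 2 * _) s0 => s s0; rewrite ler_norml; nra.
Qed.

Lemma ddskew_le x : `|ddskew x| <= 3.
Proof.
move: (D0) (D1) (l_le) => D_gt0 D_le1 l_le'.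
have d1 := den_ge1 x.
have dx0 : 0 < den x ^+ 3 by rewrite exprn_gt0// (lt_le_trans ltr01).
rewrite /ddskew normrM normfV (gtr0_norm dx0) ler_pdivrMr//.
rewrite !normrM normfV !(@ger0_norm _ 2)// (gtr0_norm D_gt0) -(expr2 D).
have H1 : `|l| / 2 * (D ^+ 2 * `|x|) <= 2^-1 * den x.
  have : `|l| / 2 <= 1 by lra.
  have : D ^+ 2 * `|x| <= D * `|x| by rewrite ler_wpM2r// expr2 ler_piMl// ltW.
  have := Dx_den x; have : 0 <= D ^+ 2 * `|x| by rewrite mulr_ge0 ?sqr_ge0.
  have : 0 <= `|l| / 2 by rewrite divr_ge0.
  move: (`|l| / 2) (D ^+ 2 * _) => a b; nra.
have H2 : `|2 * D ^+ 2 * x ^+ 2 - 6| <= 6 * den x ^+ 2.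
  have s0 : 0 <= D ^+ 2 * x ^+ 2 by rewrite mulr_ge0 ?sqr_ge0.
  by rewrite /den -mulrA; move: (D ^+ 2 * _) s0 => s s0; rewrite ler_norml; nra.
have H3 : 0 <= `|l| / 2 * (D ^+ 2 * `|x|).
  exact: mulr_ge0 (divr_ge0 (normr_ge0 l) (ler0n R 2)) (mulr_ge0 (sqr_ge0 D) (normr_ge0 x)).
by apply: le_trans (ler_pM H3 (normr_ge0 _) H1 H2) _; lra.
Qed.

Hypotheses (c01 : 0 <= c <= 1) (fd : has_deriv f (stein_d1 D z c skew f)).
Hypotheses (f_le : forall x, `|f x| <= 5 / 2) (xf_le : forall x, `|x * f x| <= 1).

(** [q] is the derivative of [edgeworth], and p - q = phi lam x / 2. This difference cancels the
    skewed part of the equation to order D^2, so that W' = h q + O(D^2). Since [W] tends to 0 at -oo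
    and to [c] at +oo, [c] is the integral of h q up to O(D^2). *)
Let q x : R := phi x * (1 + lam / 6 * (x ^+ 3 - 3 * x)).
Let p x : R := phi x * (1 + lam / 6 * x ^+ 3).
Let W x : R := f x * p x + c * edgeworth x.

Lemma edgeworth_deriv : has_deriv edgeworth q.
Proof.
apply: has_deriv_eq.
  apply: has_derivB (@Phi_deriv R) _; apply: has_derivM (@normal_pdf01_deriv R).
  apply: has_derivZ; exact: has_derivB (@has_derivXn R 2) (has_derivC 1).
by move=> x /=; rewrite /q; field.
Qed.

(* br collects the terms of order D^2 left in the integrated Stein identity. *)
Let br x : R := lam / 2 * x - skew x - skew x * (lam / 6 * x ^+ 3).

Let W_deriv : has_deriv W (fun x => h x * q x + phi x * (br x * (x * f x + h x - c))).
Proof.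
have pd := has_derivM (@normal_pdf01_deriv R)
  (has_derivD (has_derivC 1) (has_derivZ (lam / 6) (@has_derivXn R 3))).
apply: (has_deriv_eq (has_derivD (has_derivM fd pd) (has_derivZ c edgeworth_deriv))).
by move=> x /=; rewrite /stein_d1 /q /br; field.
Qed.

Let br_le x : `|br x| <= D ^+ 2 * (4 * `|x| + x ^+ 2 + `|x| ^+ 4).
Proof.
move: (lam_le) (lam_l) (D0) => lam_le' lam_l' D_gt0.
have -> : br x = - ((skew x - l / 2 * x) + (l - lam) / 2 * x + skew x * (lam / 6 * x ^+ 3)).
  by rewrite /br; field.
rewrite normrN; apply: le_trans (ler_normD _ _) _.
have H1 : `|skew x - l / 2 * x + (l - lam) / 2 * x| <= D ^+ 2 * (x ^+ 2 + 4 * `|x|).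
  apply: le_trans (ler_normD _ _) _; rewrite mulrDr; apply: lerD.
    apply: le_trans (skew_lin x) _.
    by have : 0 <= D ^+ 2 * x ^+ 2 by [rewrite mulr_ge0 ?sqr_ge0]; lra.
  rewrite !normrM normfV (@ger0_norm _ 2)//.
  have : `|l - lam| * `|x| <= 8 * D ^+ 2 * `|x| by rewrite ler_wpM2r.
  lra.
have H2 : `|skew x * (lam / 6 * x ^+ 3)| <= D ^+ 2 * `|x| ^+ 4.
  rewrite normrM; apply: le_trans (ler_pM _ _ (skew_le x) (lexx _)) _ => //.
  rewrite !normrM normfV (@ger0_norm _ 6)//.
  have : D * `|x| ^+ 4 * `|lam| <= D * `|x| ^+ 4 * D.
    by rewrite ler_wpM2l// mulr_ge0 ?exprn_ge0// ltW.
  have : 0 <= D * `|x| ^+ 4 * `|lam| by rewrite !mulr_ge0 ?exprn_ge0// ltW.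
  lra.
by move: H1 H2; lra.
Qed.

Let sixth x : x ^+ 6 = `|x| ^+ 6.
Proof. by rewrite (exprM x 2 3) (exprM `|x| 2 3) real_normK ?num_real. Qed.

Let err_le x : `|phi x * (br x * (x * f x + h x - c))| <= 1200 * D ^+ 2 / (1 + x ^+ 2).
Proof.
have x2 : 0 < 1 + x ^+ 2 by rewrite ltr_wpDr ?sqr_ge0.
have [p0 _] := normal_pdf01_decay x.
rewrite normrM (ger0_norm p0).
have := @normal_pdf01_atan R x (br x * (x * f x + h x - c)) (25 * D ^+ 2).
rewrite (_ : 48 * (25 * D ^+ 2) = 1200 * D ^+ 2); last by ring.
apply; first by rewrite mulr_ge0 ?sqr_ge0.
have r2 : `|x * f x + h x - c| <= 2.
  have := xf_le x; have := ramp01 z D0 x; move: (c01) => c01'.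
  by rewrite !ler_norml; lra.
have d0 : 0 <= D ^+ 2 := sqr_ge0 _.
have : `|br x * (x * f x + h x - c)| <= D ^+ 2 * (4 * `|x| + x ^+ 2 + `|x| ^+ 4) * 2.
  by rewrite normrM; exact: ler_pM (normr_ge0 _) (normr_ge0 _) (br_le x) r2.
rewrite sixth -!(real_normK (num_real x)).
move: (br x * _) `|x| (normr_ge0 x) => B u u0 HB.
apply: (@le_trans _ _ (D ^+ 2 * (4 * u + u ^+ 2 + u ^+ 4) * 2 * (1 + u ^+ 2))).
  by rewrite ler_wpM2r// addr_ge0 ?sqr_ge0.
suff P0 : (4 * u + u ^+ 2 + u ^+ 4) * 2 * (1 + u ^+ 2) <= 25 * (1 + u ^+ 6).
  by have := ler_wpM2l d0 P0; lra.
have := @pow_le6 R u 1 isT u0; have := @pow_le6 R u 2 isT u0.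
have := @pow_le6 R u 3 isT u0; have := @pow_le6 R u 4 isT u0; rewrite expr1.
have : 0 <= u ^+ 6 by exact: exprn_ge0.
lra.
Qed.

Let tail x : `|p x| + `|6^-1 * lam * (x ^+ 2 - 1) * phi x| <= 400 / (1 + x ^+ 2).
Proof.
move: (lam_le) (D1) => lam_le' D_le1.
have [p0 _] := normal_pdf01_decay x.
have x2 : 0 <= x ^+ 2 := sqr_ge0 _.
have pow k (k6 : (k <= 6)%N) := @pow_le6 R _ k k6 (normr_ge0 x).
have H1 : `|p x| <= 48 * 3 / (1 + x ^+ 2).
  rewrite /p normrM (ger0_norm p0); apply: normal_pdf01_atan => //.
  have : `|1 + lam / 6 * x ^+ 3| <= 1 + `|x| ^+ 3 / 6.
    apply: le_trans (ler_normD _ _) _; rewrite normr1 lerD2l !normrM normfV.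
    rewrite (@ger0_norm _ 6)//; have x3 : 0 <= `|x| ^+ 3 by exact: exprn_ge0.
    by have := ler_wpM2r x3 (le_trans lam_le' D_le1); lra.
  rewrite sixth -(real_normK (num_real x)).
  have := pow 2%N isT; have := pow 3%N isT; have := pow 5%N isT.
  have : 0 <= `|x| ^+ 6 by exact: exprn_ge0.
  move: `|_ + _ * _| (normr_ge0 (1 + lam / 6 * x ^+ 3)) => v v0 h6 h5 h3 h2 hv.
  apply: (@le_trans _ _ ((1 + `|x| ^+ 3 / 6) * (1 + `|x| ^+ 2))).
    by rewrite ler_wpM2r// addr_ge0 ?exprn_ge0.
  lra.
have H2 : `|6^-1 * lam * (x ^+ 2 - 1) * phi x| <= 48 * 4 / (1 + x ^+ 2).
  rewrite normrM mulrC (ger0_norm p0); apply: normal_pdf01_atan => //.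
  have : `|6^-1 * lam * (x ^+ 2 - 1)| <= 1 + x ^+ 2.
    rewrite normrM; have : `|6^-1 * lam| <= 1.
      by rewrite normrM ger0_norm//; lra.
    have : `|x ^+ 2 - 1| <= 1 + x ^+ 2 by rewrite ler_norml; lra.
    by move=> h1 h2; rewrite -[leRHS]mul1r ler_pM.
  rewrite sixth -(real_normK (num_real x)).
  have := pow 2%N isT; have := pow 4%N isT.
  move: `|_ * _ * _| => v h4 h2 hv.
  apply: (@le_trans _ _ ((1 + `|x| ^+ 2) * (1 + `|x| ^+ 2))).
    by rewrite ler_wpM2r// addr_ge0 ?exprn_ge0.
  have : 0 <= `|x| ^+ 6 by exact: exprn_ge0.
  lra.
have : 0 <= (1 + x ^+ 2)^-1 by rewrite invr_ge0 addr_ge0.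
lra.
Qed.

Let q_lipschitz x y : `|q x - q y| <= 250 * `|x - y|.
Proof.
move: (lam_le) (D1) => lam_le' D_le1.
have qd : has_deriv q (fun x => phi x *
    (- x * (1 + lam / 6 * (x ^+ 3 - 3 * x)) + lam / 6 * (3 * x ^+ 2 - 3))).
  apply: has_deriv_eq.
    apply: has_derivM (@normal_pdf01_deriv R) _.
    apply: has_derivD (has_derivC 1) _; apply: has_derivZ.
    exact: has_derivB (@has_derivXn R 3) (has_derivZ 3 (@has_derivX R)).
  by move=> u /=; field.
apply: lipschitz_has_deriv qd _ => u _.
have [p0 _] := normal_pdf01_decay u.
rewrite normrM (ger0_norm p0).
apply: (@le_trans _ _ (48 * 5)); last by lra.
apply: normal_pdf01_poly => //.
have lam1 : `|lam| <= 1 by exact: le_trans D_le1.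
have T1 : `|- u * (1 + lam / 6 * (u ^+ 3 - 3 * u))| <= `|u| + `|u| ^+ 4 + `|u| ^+ 2.
  rewrite normrM normrN.
  have : `|1 + lam / 6 * (u ^+ 3 - 3 * u)| <= 1 + (`|u| ^+ 3 + `|u|).
    apply: le_trans (ler_normD _ _) _; rewrite normr1 lerD2l !normrM normfV.
    rewrite (@ger0_norm _ 6)//.
    have : `|u ^+ 3 - 3 * u| <= `|u| ^+ 3 + 3 * `|u|.
      by apply: le_trans (ler_normB _ _) _; rewrite !normrM (@ger0_norm _ 3)//; lra.
    have : 0 <= `|u| ^+ 3 by exact: exprn_ge0.
    have := normr_ge0 u; have := normr_ge0 lam; have := normr_ge0 (u ^+ 3 - 3 * u).
    move: `|u ^+ 3 - _| (`|u| ^+ 3) `|u| `|lam| lam1 => a b e g g1 a0 g0 e0 b0 hab.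
    have : g / 6 * a <= 1 / 6 * a by rewrite ler_wpM2r//; lra.
    lra.
  move=> H; apply: le_trans (ler_wpM2l (normr_ge0 _) H) _.
  by lra.
have T2 : `|lam / 6 * (3 * u ^+ 2 - 3)| <= `|u| ^+ 2 + 1.
  rewrite !normrM normfV (@ger0_norm _ 6)// real_normK ?num_real//.
  have : `|3 * u ^+ 2 - 3| <= 3 * u ^+ 2 + 3 by have := sqr_ge0 u; rewrite ler_norml; lra.
  have := normr_ge0 (3 * u ^+ 2 - 3); have := normr_ge0 lam.
  move: `|3 * _ - _| `|lam| lam1 => a g g1 a0 g0 ha.
  have : g / 6 * a <= 1 / 6 * a by rewrite ler_wpM2r//; lra.
  by have := sqr_ge0 u; lra.
apply: le_trans (ler_normD _ _) _.
have := @pow_le6 R _ 1 isT (normr_ge0 u); have := @pow_le6 R _ 2 isT (normr_ge0 u).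
have := @pow_le6 R _ 4 isT (normr_ge0 u); rewrite expr1 (sixth u).
have : 0 <= `|u| ^+ 6 by exact: exprn_ge0.
by move: T1 T2; lra.
Qed.

Let B := fun x : R => 1200 * D ^+ 2 * atan x.

Let B_deriv : has_deriv B (fun x => 1200 * D ^+ 2 / (1 + x ^+ 2)).
Proof. exact: has_derivZ (@atan_deriv R). Qed.

Let B_var x y : B x - B y <= 4800 * D ^+ 2.
Proof.
rewrite /B -mulrBr; have := ler_wpM2l (sqr_ge0 D) (atan_var x y); lra.
Qed.

Let small e : 0 < e -> exists M, [/\ forall x, x < - M -> `|Phi x| < e,
  forall x, M < x -> `|1 - Phi x| < e & forall x, M < `|x| -> 3 * (400 / (1 + x ^+ 2)) < e].
Proof.
move=> e0; have [M1 H1] := Phi_ltNy e0; have [M2 H2] := Phi_lty e0.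
have [M3 H3] := inv_sq_small (mulr_ge0 (ler0n R 3) (ler0n R 400)) e0.
exists (Num.max (- M1) (Num.max M2 M3)); split=> x; last first.
- by rewrite !gt_max => /and3P[_ _ /H3]; rewrite mulrA.
- by rewrite !gt_max => /and3P[_ /H2].
by rewrite ltrNr !gt_max => /and3P[xM _ _]; apply: H1; move: xM; rewrite ltrN2.
Qed.

(** Here h = 1, so the derivative of [W - edgeworth] is only the error term, whose integral is at
    most 4 * 1200 D^2. The vanishing at -oo is used through a far point y and an arbitrary e. *)
Let left_part : `|W (z - D) - edgeworth (z - D)| <= 4800 * D ^+ 2.
Proof.
apply/ler_addgt0Pr => e e0.
have [|M [H1 _ H3]] := @small (e / 2); first by rewrite divr_gt0.
pose y := Num.min (z - D) (- (`|M| + 1)) .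
have yz : y <= z - D by rewrite ge_min lexx.
have yM : y < - M.
  apply: (@le_lt_trans _ _ (- (`|M| + 1))); first by rewrite ge_min lexx orbT.
  by have := ler_norm M; lra.
have yM' : M < `|y|.
  have yn : y < 0.
    apply: (@le_lt_trans _ _ (- (`|M| + 1))); first by rewrite ge_min lexx orbT.
    by have := normr_ge0 M; lra.
  by rewrite ltr0_norm//; lra.
have V : `|(W (z - D) - edgeworth (z - D)) - (W y - edgeworth y)| <= B (z - D) - B y.
  apply: (incr_le_has_deriv (f := fun x => W x - edgeworth x) yz _ B_deriv).
    by move=> x _; exact: (has_derivB W_deriv edgeworth_deriv x).
  move=> x /andP[_ xz]; rewrite (ramp_left D0 xz).
  have := err_le x; rewrite (ramp_left D0 xz); set E := phi x * _.
  by rewrite (_ : 1 * q x + E - q x = E)//; ring.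
have S : `|W y - edgeworth y| <= e.
  have -> : W y - edgeworth y = f y * p y - (1 - c) * Phi y
      + (1 - c) * (6^-1 * lam * (y ^+ 2 - 1) * phi y).
    by rewrite /W /edgeworth; ring.
  have P1 := H1 _ yM; have P3 := H3 _ yM'; have P2 := tail y.
  have c1 : `|1 - c| <= 1 by move: (c01) => ?; rewrite ler_norml; lra.
  apply: le_trans (ler_normD _ _) _; apply: le_trans (lerD (ler_normB _ _) (lexx _)) _.
  rewrite !(normrM (1 - c)) (normrM (f y)).
  have : `|1 - c| * `|Phi y| <= 1 * `|Phi y| by rewrite ler_wpM2r.
  have : `|1 - c| * `|6^-1 * lam * (y ^+ 2 - 1) * phi y| <= 1 * `|6^-1 * lam * (y ^+ 2 - 1) * phi y| by rewrite ler_wpM2r.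
  have : `|f y| * `|p y| <= 5 / 2 * `|p y| by rewrite ler_wpM2r.
  have := normr_ge0 (p y); have := normr_ge0 (6^-1 * lam * (y ^+ 2 - 1) * phi y).
  lra.
have := B_var (z - D) y; move: V S; rewrite !ler_norml; lra.
Qed.

(** Here h = 0 and [W] tends to [c] at +oo; otherwise the argument mirrors the left half-line. *)
Let right_part : `|c - W (z + D)| <= 4800 * D ^+ 2.
Proof.
apply/ler_addgt0Pr => e e0.
have [|M [_ H2 H3]] := @small (e / 2); first by rewrite divr_gt0.
pose y := Num.max (z + D) (`|M| + 1) .
have yz : z + D <= y by rewrite le_max lexx.
have yM1 : `|M| + 1 <= y by rewrite le_max lexx orbT.
have yM : M < y by have := ler_norm M; lra.
have yM' : M < `|y| by apply: lt_le_trans (ler_norm y).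
have V : `|W y - W (z + D)| <= B y - B (z + D).
  apply: (incr_le_has_deriv yz (fun x _ => W_deriv x) B_deriv).
  move=> x /andP[xz _]; have := err_le x.
  by rewrite (ramp_right D0 xz) mul0r add0r.
have S : `|W y - c| <= e.
  have -> : W y - c = f y * p y - c * (1 - Phi y)
      - c * (6^-1 * lam * (y ^+ 2 - 1) * phi y).
    by rewrite /W /edgeworth; ring.
  have P1 := H2 _ yM; have P3 := H3 _ yM'; have P2 := tail y.
  have c1 : `|c| <= 1 by move: (c01) => ?; rewrite ler_norml; lra.
  apply: le_trans (ler_normB _ _) _; apply: le_trans (lerD (ler_normB _ _) (lexx _)) _.
  rewrite !(normrM c) (normrM (f y)).
  have : `|c| * `|1 - Phi y| <= 1 * `|1 - Phi y| by rewrite ler_wpM2r.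
  have : `|c| * `|6^-1 * lam * (y ^+ 2 - 1) * phi y| <= 1 * `|6^-1 * lam * (y ^+ 2 - 1) * phi y| by rewrite ler_wpM2r.
  have : `|f y| * `|p y| <= 5 / 2 * `|p y| by rewrite ler_wpM2r.
  have := normr_ge0 (p y); have := normr_ge0 (6^-1 * lam * (y ^+ 2 - 1) * phi y).
  lra.
have := B_var y (z + D); move: V S; rewrite !ler_norml; lra.
Qed.

(** Growing the window symmetrically from u = 0 to D makes the density enter through h(z + u) (q(z +
    u) - q(z - u)), which is O(D); integrating over u gives the second power. The constant is 500 +
    2 * 1200. *)
Let middle_part :
  `|(W (z + D) - W (z - D)) - (edgeworth z - edgeworth (z - D))| <= 2900 * D ^+ 2.
Proof.
move: (D0) (D1) => D_gt0 D_le1.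
pose m u := W (z + u) - W (z - u) - (edgeworth z - edgeworth (z - u)).
have Nd : has_deriv (fun x : R => z - x) (fun=> -1).
  apply: has_deriv_eq (has_derivB (has_derivC z) (@has_derivX R)) _ => x.
  by rewrite sub0r.
have Pd : has_deriv (fun x : R => z + x) (fun=> 1).
  apply: has_deriv_eq (has_derivD (has_derivC z) (@has_derivX R)) _ => x.
  by rewrite add0r.
pose er x := phi x * (br x * (x * f x + h x - c)).
have md : has_deriv m (fun u => h (z + u) * (q (z + u) - q (z - u))
    + er (z + u) + er (z - u)).
  apply: has_deriv_eq.
    apply: has_derivB; first exact: has_derivB (has_deriv_comp W_deriv Pd) (has_deriv_comp W_deriv Nd).
    exact: has_derivB (has_derivC (edgeworth z)) (has_deriv_comp edgeworth_deriv Nd).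
  move=> u /=; rewrite /er -/(er _).
  have E : h (z - u) = 1 - h (z + u) by rewrite -(ramp_sym z D0 u); ring.
  by rewrite E; ring.
have er_le x : `|er x| <= 1200 * D ^+ 2.
  have x1 : 1 <= 1 + x ^+ 2 by rewrite lerDl sqr_ge0.
  apply: le_trans (err_le x) _; rewrite ler_pdivrMr; last exact: lt_le_trans ltr01 x1.
  exact: ler_peMr (mulr_ge0 (ler0n R 1200) (sqr_ge0 D)) x1.
have mb : `|m D - m 0| <= 2900 * D * `|D - 0|.
  apply: lipschitz_has_deriv md _ => u.
  rewrite (min_idPl (ltW D_gt0)) (max_idPr (ltW D_gt0)) => /andP[u0 uD].
  have hb := ramp01 z D0 (z + u).
  have qb := q_lipschitz (z + u) (z - u).
  have : `|h (z + u) * (q (z + u) - q (z - u))| <= 500 * D.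
    rewrite normrM; apply: (@le_trans _ _ (1 * (250 * `|z + u - (z - u)|))).
      by apply: ler_pM => //; rewrite ger0_norm; lra.
    by rewrite (_ : z + u - (z - u) = 2 * u) ?ger0_norm; lra.
  have := er_le (z + u); have := er_le (z - u) => h1 h2 h3.
  have D2D : D ^+ 2 <= D by rewrite expr2 ler_piMl// ltW.
  apply: le_trans (ler_normD _ _) _; apply: le_trans (lerD (ler_normD _ _) (lexx _)) _.
  lra.
have m0 : m 0 = 0 by rewrite /m addr0 subr0 !subrr.
by move: mb; rewrite m0 !subr0 (gtr0_norm D_gt0) /m -mulrA -expr2.
Qed.

(** The three parts telescope: 4800 + 2900 + 4800. *)
Lemma stein_const_edgeworth : `|c - edgeworth z| <= 12500 * D ^+ 2.
Proof.
move: left_part middle_part right_part; rewrite !ler_norml; lra.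
Qed.

End SteinConstant.

(** * Random transpositions *)

Section RandomTransposition.
Variables (R : realType) (n : nat).
Implicit Types (a b : 'M[R]_n) (s : 'S_n) (i j k l x y : 'I_n) (G : 'S_n -> R).

Local Notation E := (@Ex R 'S_n).

(* The change of the permutation sum when the images k of i and l of j are
   exchanged. *)
Definition swap_diff a i j k l : R := a i k + a j l - a i l - a j k.

Lemma sum_two (F : 'I_n -> R) i j : i != j ->
  \sum_x F x = F i + F j + \sum_(x | (x != i) && (x != j)) F x.
Proof.
move=> ij; rewrite (bigD1 i)//= (bigD1 j)/=; last by rewrite eq_sym.
by rewrite addrA.
Qed.

Lemma perm_sum_swap a s i j :
  perm_sum a (tperm i j * s)%g = perm_sum a s - swap_diff a i j (s i) (s j).
Proof.
rewrite /perm_sum /swap_diff; have [<-|ij] := eqVneq i j.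
  by rewrite tperm1 mul1g addrK subrr subr0.
rewrite !(sum_two _ ij) !permM tpermL tpermR.
under eq_bigr => x /andP[xi xj] do rewrite permM tpermD 1?eq_sym//.
ring.
Qed.

Lemma Ex_swap G i j : E (fun s => G (tperm i j * s)%g) = E G.
Proof. by rewrite /Ex [in RHS](reindex_inj (mulgI (tperm i j))). Qed.

Lemma sum_cst_ord (c : R) : \sum_(j < n) c = n%:R * c.
Proof. by rewrite sumr_const card_ord mulr_natl. Qed.

Lemma sum_perm_row a s i : \sum_j a i (s j) = \sum_k a i k.
Proof. by rewrite [in RHS](reindex_inj (@perm_inj _ s)). Qed.

(** Linear regression property of the exchangeable pair: the mean increment over all transpositions
    is proportional to the centered permutation sum. *)
Lemma sum_swap_diff b s : \sum_i \sum_j swap_diff b i j (s i) (s j)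
  = 2 * (n%:R * perm_sum b s - \sum_i \sum_k b i k).
Proof.
rewrite /swap_diff.
under eq_bigr => i _ do rewrite !sumrB big_split /=.
rewrite !sumrB big_split /= [X in _ - X]exchange_big /=.
under eq_bigr => i _ do rewrite sum_cst_ord.
rewrite sum_cst_ord -mulr_sumr.
under [X in _ - X - _]eq_bigr => i _ do rewrite sum_perm_row.
under [X in _ - X]eq_bigr => i _ do rewrite sum_perm_row.
by rewrite /perm_sum; ring.
Qed.

Lemma swap_diff_swap b s i j : swap_diff b i j ((tperm i j * s)%g i) ((tperm i j * s)%g j)
  = - swap_diff b i j (s i) (s j).
Proof. by rewrite !permM tpermL tpermR /swap_diff; ring. Qed.

(* Stein's exchangeable pair (s, tperm i j * s). *)
Lemma exchangeable_pair b G : (0 < n)%N ->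
  E (fun s => (perm_sum b s - n%:R^-1 * \sum_i \sum_k b i k) * G s)
  = (4 * n%:R)^-1 * \sum_i \sum_j
      E (fun s => swap_diff b i j (s i) (s j) * (G s - G (tperm i j * s)%g)).
Proof.
move=> n0; have n1 : n%:R != 0 :> R by rewrite pnatr_eq0 -lt0n.
have H i j : E (fun s => swap_diff b i j (s i) (s j) * (G s - G (tperm i j * s)%g))
    = 2 * E (fun s => swap_diff b i j (s i) (s j) * G s).
  have K : E (fun s => swap_diff b i j (s i) (s j) * G (tperm i j * s)%g)
      = - E (fun s => swap_diff b i j (s i) (s j) * G s).
    rewrite -[LHS](Ex_swap _ i j) -ExN; apply: eq_Ex => s.
    by rewrite mulgA tperm2 mul1g swap_diff_swap mulNr.
  rewrite (eq_Ex (fun s => mulrBr _ _ _)) ExB K; ring.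
have -> : \sum_i \sum_j E (fun s => swap_diff b i j (s i) (s j) * (G s - G (tperm i j * s)%g))
    = 2 * E (fun s => \sum_i \sum_j swap_diff b i j (s i) (s j) * G s).
  rewrite Ex_sum mulr_sumr; apply: eq_bigr => i _.
  by rewrite Ex_sum mulr_sumr; apply: eq_bigr => j _; exact: H.
rewrite mulrA -ExZ; apply: eq_Ex => s.
have -> : \sum_i \sum_j swap_diff b i j (s i) (s j) * G s
    = (\sum_i \sum_j swap_diff b i j (s i) (s j)) * G s.
  by rewrite mulr_suml; apply: eq_bigr => i _; rewrite mulr_suml.
by rewrite sum_swap_diff; field.
Qed.

Definition row_centered a := forall i, \sum_k a i k = 0.
Definition col_centered a := forall k, \sum_i a i k = 0.

(* The off-diagonal part of the trace of the product of the matrices a and b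
   with columns permuted by s. *)
Definition offdiag a b s : R := \sum_i \sum_(j | j != i) a i (s j) * b j (s i).

Definition mx_dot a b : R := \sum_i \sum_k a i k * b i k.

Definition mx_mul_entries a b : 'M[R]_n := \matrix_(i, k) (a i k * b i k).

(** Conditional covariance of the two increments given s. Of the sixteen products, the eight pairing
    a diagonal entry with an off-diagonal one sum to 0 by double centering. The dominant random part
    is the permutation sum of the entrywise product, which is how the permutation sum of the squares
    enters the expansion. *)
Lemma sum_swap_diff_mul a b s :
  row_centered a -> col_centered a -> row_centered b -> col_centered b ->
  (0 < n)%N ->
  (4 * n%:R)^-1 * \sum_i \sum_j swap_diff a i j (s i) (s j) * swap_diff b i j (s i) (s j)
  = (2^-1 + (2 * n%:R)^-1) * perm_sum (mx_mul_entries a b) s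
    + (2 * n%:R)^-1 * (perm_sum a s * perm_sum b s + mx_dot a b + offdiag a b s).
Proof.
move=> ra ca rb cb n0; have n1 : n%:R != 0 :> R by rewrite pnatr_eq0 -lt0n.
pose Y := perm_sum (mx_mul_entries a b) s.
have YE : Y = \sum_i a i (s i) * b i (s i).
  by apply: eq_bigr => i _; rewrite mxE.
have Off : \sum_i \sum_j a i (s j) * b j (s i) = Y + offdiag a b s.
  rewrite YE /offdiag -big_split; apply: eq_bigr => i _.
  by rewrite (bigD1 i).
have Off' : \sum_i \sum_j a j (s i) * b i (s j) = Y + offdiag a b s.
  by rewrite exchange_big -Off.
have pr a' i : row_centered a' -> \sum_j a' i (s j) = 0.
  by move=> H; rewrite sum_perm_row H.
have pc a' i : col_centered a' -> \sum_j a' j (s i) = 0 by move=> ->.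
have S1 i j : swap_diff a i j (s i) (s j) * swap_diff b i j (s i) (s j)
  = (a i (s i) * b i (s i) + a j (s j) * b j (s j)
     + a i (s i) * b j (s j) + a j (s j) * b i (s i))
  - (a i (s i) * b i (s j) + a i (s i) * b j (s i)
     + a j (s j) * b i (s j) + a j (s j) * b j (s i))
  - (b i (s i) * a i (s j) + b i (s i) * a j (s i)
     + b j (s j) * a i (s j) + b j (s j) * a j (s i))
  + (a i (s j) * b i (s j) + a j (s i) * b j (s i)
     + a i (s j) * b j (s i) + a j (s i) * b i (s j)).
  by rewrite /swap_diff; ring.
under eq_bigr => i _ do under eq_bigr => j _ do rewrite S1.
have T1 : \sum_i \sum_j (a i (s i) * b i (s i) + a j (s j) * b j (s j)
     + a i (s i) * b j (s j) + a j (s j) * b i (s i)) = 2 * n%:R * Y + 2 * perm_sum a s * perm_sum b s.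
  under eq_bigr => i _ do rewrite !big_split /= sum_cst_ord -mulr_sumr -mulr_suml -YE.
  by rewrite !big_split /= -!mulr_sumr -mulr_suml sum_cst_ord -YE /perm_sum; ring.
have cross a' b' : row_centered b' -> col_centered b' ->
  \sum_i \sum_j (a' i (s i) * b' i (s j) + a' i (s i) * b' j (s i)
     + a' j (s j) * b' i (s j) + a' j (s j) * b' j (s i)) = 0.
  move=> rb' cb'; under eq_bigr => i _ do rewrite !big_split /= -!mulr_sumr pr// pc// !mulr0 !add0r.
  rewrite big_split /= exchange_big /=.
  rewrite [X in X + _]big1 ?add0r => [|j _]; last by rewrite -mulr_sumr pc// mulr0.
  rewrite exchange_big big1//= => j _.
  by rewrite -mulr_sumr pr// mulr0.
have T4 : \sum_i \sum_j (a i (s j) * b i (s j) + a j (s i) * b j (s i)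
     + a i (s j) * b j (s i) + a j (s i) * b i (s j))
   = 2 * mx_dot a b + 2 * (Y + offdiag a b s).
  under eq_bigr => i _ do rewrite !big_split /=.
  rewrite !big_split /= Off Off' [X in _ + X + _ + _]exchange_big /=.
  rewrite (_ : \sum_(i < n) \sum_(j < n) a i (s j) * b i (s j) = mx_dot a b); first by ring.
  by apply: eq_bigr => i _; rewrite [in RHS](reindex_inj (@perm_inj _ s)).
have spl (p1 p2 p3 p4 : 'I_n -> 'I_n -> R) :
    \sum_i \sum_j (p1 i j - p2 i j - p3 i j + p4 i j)
    = \sum_i \sum_j p1 i j - \sum_i \sum_j p2 i j - \sum_i \sum_j p3 i j
      + \sum_i \sum_j p4 i j.
  under eq_bigr => i _ do rewrite big_split !sumrB.
  by rewrite big_split !sumrB.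
rewrite spl T1 (cross a b rb cb) (cross b a ra ca) T4 -/Y.
by field.
Qed.

End RandomTransposition.

(** * Conditioning and moments *)

Section Conditioning.
Variable R : realType.

Local Open Scope nat_scope.

Lemma card_perm_gt0 n : (0 < #|{: 'S_n}|)%N.
Proof. by rewrite card_Sn fact_gt0. Qed.

Local Open Scope ring_scope.

(** Conditioning on the image of [i]: [lift_perm i] is injective on pairs of an image and a smaller
    permutation, and the cardinalities agree. *)
Lemma Ex_cond n (i : 'I_n.+1) (G : 'S_n.+1 -> R) :
  Ex G = n.+1%:R^-1 * \sum_k Ex (fun t : 'S_n => G (lift_perm i k t)).
Proof.
pose L (p : 'I_n.+1 * 'S_n) := lift_perm i p.1 p.2.
have Linj : injective L.
  move=> [k s] [l t]; rewrite /L /= => /permP E; have := E i; rewrite !lift_perm_id => kl.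
  subst l; congr (_, _); apply/permP => x.
  by have := E (lift i x); rewrite !lift_perm_lift => /lift_inj.
have Lbij : bijective L.
  by apply: inj_card_bij => //; rewrite card_prod !card_Sn card_ord.
rewrite /Ex (reindex L) /=; last exact: onW_bij.
rewrite -(pair_bigA _ (fun k t => G (lift_perm i k t))) /= mulr_sumr mulr_sumr.
apply: eq_bigr => k _; rewrite mulrA; congr (_ * _).
by rewrite !card_Sn factS natrM invfM.
Qed.

Lemma perm_sum_lift n (i k : 'I_n.+1) (a : 'M[R]_n.+1) (t : 'S_n) :
  perm_sum a (lift_perm i k t) = a i k + perm_sum (mxsub (lift i) (lift k) a) t.
Proof.
rewrite /perm_sum (bigD1_ord i)//= lift_perm_id; congr (_ + _).
by apply: eq_bigr => x _; rewrite lift_perm_lift mxE.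
Qed.

Lemma Ex_entry n (i : 'I_n) (F : 'I_n -> R) :
  Ex (fun s : 'S_n => F (s i)) = n%:R^-1 * \sum_k F k.
Proof.
case: n i F => [|n] i F; first by case: i.
rewrite (Ex_cond i); congr (_ * _); apply: eq_bigr => k _.
under eq_Ex => t do rewrite lift_perm_id.
by rewrite ExC// card_perm_gt0.
Qed.

(** The second row and column are given by their positions after deletion of the first ones, so
    their being distinct from these is built into the types. *)
Definition minor2 m (a : 'M[R]_m.+2) (i : 'I_m.+2) (j' : 'I_m.+1) (k : 'I_m.+2) (l' : 'I_m.+1) : 'M[R]_m :=
  mxsub (lift i \o lift j') (lift k \o lift l') a.

Lemma Ex_cond2 m (a : 'M[R]_m.+2) (i : 'I_m.+2) (j' : 'I_m.+1)
    (Gam : 'I_m.+2 -> 'I_m.+2 -> R -> R) :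
  Ex (fun s : 'S_m.+2 => Gam (s i) (s (lift i j')) (perm_sum a s))
  = (m.+2%:R * m.+1%:R)^-1 * \sum_k \sum_l'
      Ex (fun t : 'S_m => Gam k (lift k l')
        (a i k + a (lift i j') (lift k l') + perm_sum (minor2 a i j' k l') t)).
Proof.
rewrite (Ex_cond i) invfM -mulrA [in RHS]mulr_sumr; congr (_ * _).
apply: eq_bigr => k _; rewrite (Ex_cond j'); congr (_ * _).
apply: eq_bigr => l' _; apply: eq_Ex => t.
rewrite lift_perm_id !lift_perm_lift lift_perm_id !perm_sum_lift mxE addrA.
by congr (Gam _ _ (_ + perm_sum _ _)); apply/matrixP => x y; rewrite !mxE.
Qed.

(** The bound is summed over all pairs of columns; the diagonal pairs only enlarge it, and the full
    double sum can be computed in closed form. *)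
Lemma Ex_cond2_le m (a : 'M[R]_m.+2) (i j : 'I_m.+2)
    (Gam : 'I_m.+2 -> 'I_m.+2 -> R -> R) (Q : 'I_m.+2 -> 'I_m.+2 -> R) :
  i != j -> (forall k l, 0 <= Q k l) ->
  (forall j' k l', j = lift i j' ->
    `|Ex (fun t : 'S_m => Gam k (lift k l')
        (a i k + a j (lift k l') + perm_sum (minor2 a i j' k l') t))| <= Q k (lift k l')) ->
  `|Ex (fun s : 'S_m.+2 => Gam (s i) (s j) (perm_sum a s))|
    <= (m.+2%:R * m.+1%:R)^-1 * \sum_k \sum_l Q k l.
Proof.
move=> ij Q0 H; have [j' jE _] := unlift_some ij.
rewrite {1}jE Ex_cond2 normrM gtr0_norm ?invr_gt0 ?mulr_gt0// ler_wpM2l ?invr_ge0 ?mulr_ge0//.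
apply: le_trans (ler_norm_sum _ _ _) _; apply: ler_sum => k _.
apply: le_trans (ler_norm_sum _ _ _) _; rewrite (bigD1_ord k)//=.
apply: (@le_trans _ _ (\sum_l' Q k (lift k l'))); last by rewrite lerDr.
by apply: ler_sum => l' _; rewrite -jE; exact: H.
Qed.

Lemma N_minor2 m (a : 'M[R]_m.+2) i j' k l' : (1 <= m)%N -> N 8 a (minor2 a i j' k l').
Proof.
move=> m1; exists 2%N, (lift i \o lift j'), (lift k \o lift l'); split => //.
(* A matrix of order m + 2 may lose at most m + 1 rows, so deleting two requires 1 <= m. *)
- by rewrite leq_min /= subn1 /= ltnS.
- by rewrite addn2.
- by move=> x y; rewrite !ltnNge /= !leq_bump2.
- by move=> x y; rewrite !ltnNge /= !leq_bump2.
Qed.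

Lemma N_refl n (a : 'M[R]_n) : N 8 a a.
Proof.
exists 0%N, id, id; split => //; first exact: addn0.
by apply/matrixP => x y; rewrite mxE.
Qed.

Section Moments.
Variable n : nat.
Implicit Types (a b : 'M[R]_n).

Local Notation total a := (\sum_i \sum_k a i k).
Local Notation sqnorm a := (\sum_i \sum_k a i k ^+ 2).

Lemma perm_sum_mean a : (0 < n)%N -> Ex (perm_sum a) = n%:R^-1 * total a.
Proof.
move=> n0; rewrite /perm_sum Ex_sum mulr_sumr; apply: eq_bigr => i _.
exact: (Ex_entry i (a i)).
Qed.

Lemma sqr_sum4 (x y u v : R) : (x + y - u - v) ^+ 2 <= 4 * (x ^+ 2 + y ^+ 2 + u ^+ 2 + v ^+ 2).
Proof.
have := sqr_ge0 (x - y); have := sqr_ge0 (x + u); have := sqr_ge0 (x + v).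
have := sqr_ge0 (y + u); have := sqr_ge0 (y + v); have := sqr_ge0 (u - v).
lra.
Qed.

Lemma Ex_swap_diff_sqr b : (0 < n)%N ->
  \sum_i \sum_j Ex (fun s : 'S_n => swap_diff b i j (s i) (s j) ^+ 2) <= 16 * sqnorm b.
Proof.
move=> n0; have n1 : n%:R != 0 :> R by rewrite pnatr_eq0 -lt0n.
have H i j : Ex (fun s : 'S_n => swap_diff b i j (s i) (s j) ^+ 2)
   <= 4 * (n%:R^-1 * \sum_k b i k ^+ 2 + n%:R^-1 * \sum_k b j k ^+ 2
       + n%:R^-1 * \sum_k b i k ^+ 2 + n%:R^-1 * \sum_k b j k ^+ 2).
  apply: le_trans (Ex_le (fun s => sqr_sum4 _ _ _ _)) _.
  rewrite ExZ !ExD (Ex_entry i (fun k => b i k ^+ 2)) (Ex_entry j (fun k => b j k ^+ 2)).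
  by rewrite (Ex_entry j (fun k => b i k ^+ 2)) (Ex_entry i (fun k => b j k ^+ 2)).
apply: le_trans (ler_sum _ (fun i _ => ler_sum _ (fun j _ => H i j))) _.
rewrite le_eqVlt; apply/orP; left; apply/eqP.
under eq_bigr => i _ do rewrite -mulr_sumr !big_split /= !sum_cst_ord -!mulr_sumr !mulVKf//.
rewrite -mulr_sumr !big_split /= !sum_cst_ord !mulVKf//; ring.
Qed.

(** The exchangeable pair with [G] the centered sum itself turns the variance into a mean squared
    increment. *)
Lemma perm_sum_variance b : (0 < n)%N ->
  Ex (fun s : 'S_n => (perm_sum b s - n%:R^-1 * total b) ^+ 2) <= 4 / n%:R * sqnorm b.
Proof.
move=> n0; have n1 : n%:R != 0 :> R by rewrite pnatr_eq0 -lt0n.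
have := @exchangeable_pair R n b (fun s => perm_sum b s - n%:R^-1 * total b) n0.
under eq_Ex => s do rewrite -expr2.
move=> ->.
have -> : \sum_i \sum_j Ex (fun s : 'S_n => swap_diff b i j (s i) (s j) *
      (perm_sum b s - n%:R^-1 * total b - (perm_sum b (tperm i j * s)%g - n%:R^-1 * total b)))
   = \sum_i \sum_j Ex (fun s : 'S_n => swap_diff b i j (s i) (s j) ^+ 2).
  apply: eq_bigr => i _; apply: eq_bigr => j _; apply: eq_Ex => s.
  by rewrite perm_sum_swap expr2; ring.
have -> : 4 / n%:R * sqnorm b = (4 * n%:R)^-1 * (16 * sqnorm b) by field.
by rewrite ler_wpM2l ?invr_ge0 ?mulr_ge0//; exact: Ex_swap_diff_sqr.
Qed.

Lemma perm_sum_second_moment b : (0 < n)%N ->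
  Ex (fun s : 'S_n => perm_sum b s ^+ 2)
    <= 4 / n%:R * sqnorm b + (n%:R^-1 * total b) ^+ 2.
Proof.
move=> n0; apply: le_trans (lerD (perm_sum_variance b n0) (lexx _)).
rewrite le_eqVlt; apply/orP; left; apply/eqP.
set mu0 := n%:R^-1 * total b.
rewrite -[X in _ + X](ExC (card_perm_gt0 n)) -ExD.
have -> : Ex (fun s : 'S_n => (perm_sum b s - mu0) ^+ 2 + mu0 ^+ 2)
  = Ex (fun s : 'S_n => perm_sum b s ^+ 2 - 2 * mu0 * (perm_sum b s - mu0)).
  by apply: eq_Ex => s; ring.
rewrite ExB ExZ ExB (ExC (card_perm_gt0 n)).
by rewrite (_ : Ex _ - mu0 = 0) ?mulr0 ?subr0// (@perm_sum_mean b n0) subrr.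
Qed.

End Moments.
End Conditioning.

(** * Second moment of the off-diagonal bilinear sum *)

Section OffDiagonal.
Variables (R : realType) (m : nat).
Local Notation n := (m.+2).
Implicit Types (a b : 'M[R]_n) (s : 'S_n) (i j K x y : 'I_n) (G : 'S_n -> R).

Local Notation E := (@Ex R 'S_n).
Local Notation swp j K s := (tperm j K * s)%g.

Definition sqnorm p (a : 'M[R]_p) : R := \sum_i \sum_k a i k ^+ 2.

Lemma sqnorm_ge0 p (a : 'M[R]_p) : 0 <= sqnorm a.
Proof. by apply: sumr_ge0 => i _; apply: sumr_ge0 => k _; exact: sqr_ge0. Qed.

Lemma sqr_sum_le p (F : 'I_p -> R) : (\sum_i F i) ^+ 2 <= p%:R * \sum_i F i ^+ 2.
Proof.
rewrite expr2 mulr_suml; under eq_bigr => i _ do rewrite mulr_sumr.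
have H (i j : 'I_p) : F i * F j <= 2^-1 * F i ^+ 2 + 2^-1 * F j ^+ 2.
  by have := sqr_ge0 (F i - F j); lra.
apply: le_trans (ler_sum _ (fun u _ => ler_sum _ (fun v _ => H u v))) _.
under eq_bigr => i _ do rewrite big_split /= sum_cst_ord -mulr_sumr.
by rewrite big_split /= sum_cst_ord -!mulr_sumr; lra.
Qed.

Lemma mul_diff_le (u p q : R) : u * (p - q) <= 2^-1 * u ^+ 2 + (p ^+ 2 + q ^+ 2).
Proof.
by have := sqr_ge0 (u - (p - q)); have := sqr_ge0 (p + q); lra.
Qed.

Lemma sqr_sum6 (x1 x2 x3 x4 x5 x6 : R) : (x1 + x2 + x3 + x4 - x5 - x6) ^+ 2
  <= 6 * (x1 ^+ 2 + x2 ^+ 2 + x3 ^+ 2 + x4 ^+ 2 + x5 ^+ 2 + x6 ^+ 2).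
Proof.
have := sqr_sum_le (fun u : 'I_6 => nth 0 [:: x1; x2; x3; x4; - x5; - x6] u).
by rewrite !big_ord_recl !big_ord0 /= !sqrrN; lra.
Qed.

(** Absorbing N/2 Q on the left leaves half of N Q, bounded by (2 + 5 + 480) N P + 48 P <= 535 N P;
    doubling gives 1070. *)
Lemma self_bound_arith (u v w P Q N : R) : 0 <= (N - 1) * P ->
  N * u <= N * (10 * P) -> N * v <= N * (10 * P) -> w <= 2 * P ->
  N * Q <= N / 2 * Q + 2 * N * P + (N * (2^-1 * u + 24 * (u + v)) + 24 * w) ->
  N * Q <= N * (1070 * P).
Proof. lra. Qed.

Lemma perm_sum_sqr_le a s : perm_sum a s ^+ 2 <= n%:R * sqnorm a.
Proof.
apply: le_trans (sqr_sum_le (fun i => a i (s i))) _.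
rewrite ler_wpM2l//; apply: ler_sum => i _.
by rewrite (bigD1 (s i))//= lerDl sumr_ge0// => k _; exact: sqr_ge0.
Qed.

Let swap_l j K s : (swp j K s) j = s K. Proof. by rewrite permM tpermL. Qed.
Let swap_r j K s : (swp j K s) K = s j. Proof. by rewrite permM tpermR. Qed.
Let swap_d j K s x : x != j -> x != K -> (swp j K s) x = s x.
Proof. by move=> xj xK; rewrite permM tpermD// eq_sym. Qed.
Let swapK j K s : swp j K (swp j K s) = s.
Proof. by rewrite mulgA tperm2 mul1g. Qed.

Definition offdiag_col a b j s : R := \sum_(i | i != j) a i (s j) * b j (s i).

Section Bilinear.
Variables a b : 'M[R]_n.
Hypotheses (ra : row_centered a) (ca : col_centered a).
Hypotheses (rb : row_centered b) (cb : col_centered b).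

Local Notation rr i j s := (a i (s j) * b j (s i)).

(** Row centering evaluates the sum over K different from [i]. The term K = i stands apart because
    that transposition also moves the image of [i]. *)
Let pair_average i j s : i != j ->
  \sum_K (a i ((swp j K s) j) * b j ((swp j K s) i)) = a i (s i) * (b j (s j) - b j (s i)).
Proof.
move=> ij; rewrite (bigD1 i)//= swap_l swap_r.
under eq_bigr => K Ki do rewrite swap_l (swap_d s ij) 1?eq_sym//.
rewrite -mulr_suml.
have -> : \sum_(K | K != i) a i (s K) = - a i (s i).
  have := ra i; rewrite (reindex_inj (@perm_inj _ s)) (bigD1 i)//= => /eqP.
  by rewrite addrC addr_eq0 => /eqP.
ring.
Qed.

(* Averaging a i (s j) over the choice of s j replaces it by 0; the price is
   the increment of G along the corresponding transposition. *)
Let pair_center i j G : i != j ->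
  n%:R * E (fun s => rr i j s * G s)
  = E (fun s => a i (s i) * (b j (s j) - b j (s i)) * G s)
    + \sum_K E (fun s => rr i j s * (G s - G (swp j K s))).
Proof.
move=> ij.
have -> : E (fun s => a i (s i) * (b j (s j) - b j (s i)) * G s)
   = \sum_K E (fun s => rr i j s * G (swp j K s)).
  have -> : \sum_K E (fun s => rr i j s * G (swp j K s))
      = \sum_K E (fun s => a i ((swp j K s) j) * b j ((swp j K s) i) * G s).
    apply: eq_bigr => K _; rewrite -[LHS](Ex_swap _ j K).
    by apply: eq_Ex => s; rewrite swapK.
  rewrite -Ex_sum; apply: eq_Ex => s.
  by rewrite -mulr_suml pair_average.
rewrite -big_split /= -sum_cst_ord; apply: eq_bigr => K _.
by rewrite -ExD; apply: eq_Ex => s; ring.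
Qed.

(** Column centering of [b] supplies the diagonal entry missing from the sum over j different from
    i, so the averaged part is exactly the product of the two permutation sums. *)
Lemma offdiag_center G :
  n%:R * E (fun s => offdiag a b s * G s)
  = E (fun s => perm_sum a s * perm_sum b s * G s)
    + \sum_j \sum_K E (fun s => offdiag_col a b j s * (G s - G (swp j K s))).
Proof.
have -> : E (fun s => offdiag a b s * G s)
    = \sum_i \sum_(j | j != i) E (fun s => rr i j s * G s).
  rewrite -(eq_bigr _ (fun i _ => Ex_sum _ _)) -Ex_sum; apply: eq_Ex => s.
  by rewrite /offdiag mulr_suml; apply: eq_bigr => i _; rewrite mulr_suml.
rewrite mulr_sumr; under eq_bigr => i _ do
  rewrite mulr_sumr; under eq_bigr => i _ do under eq_bigr => j ji do
  rewrite pair_center 1?eq_sym//.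
under eq_bigr => i _ do rewrite big_split /=.
rewrite big_split /=; congr (_ + _).
  rewrite -(eq_bigr _ (fun i _ => Ex_sum _ _)) -Ex_sum; apply: eq_Ex => s.
  under eq_bigr => i _ do rewrite -mulr_suml -mulr_sumr.
  rewrite -mulr_suml; congr (_ * _); rewrite /perm_sum mulr_suml.
  apply: eq_bigr => i _; congr (_ * _); rewrite sumrB.
  rewrite [in RHS](bigD1 i)//= addrC; congr (_ + _).
  apply/eqP; rewrite eqr_oppLR -addr_eq0 addrC -{1}[b i (s i)]/(b i (s i)).
  by have := cb (s i); rewrite (bigD1 i)//= => ->.
rewrite (exchange_big_dep xpredT)//=; apply: eq_bigr => j _.
rewrite exchange_big /=; apply: eq_bigr => K _.
rewrite -Ex_sum; apply: eq_Ex => s; rewrite /offdiag_col -mulr_suml.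
by congr (_ * _); apply: eq_bigl => i; rewrite eq_sym.
Qed.

(** The terms of [offdiag] with an index in {j, K}, collected by rows and columns; the last two
    summands correct the pairs counted twice. All other terms are unchanged by the transposition of
    j and K. *)
Definition offdiag_touching j K s : R :=
  offdiag_col a b j s + offdiag_col b a j s + offdiag_col a b K s
  + offdiag_col b a K s - rr j K s - rr K j s.

Lemma offdiag_increment j K s : j != K ->
  offdiag a b s - offdiag a b (swp j K s) = offdiag_touching j K s - offdiag_touching j K (swp j K s).
Proof.
move=> jK; pose r s' x y : R := if y != x then rr x y s' else 0.
pose inner s' := \sum_(x | (x != j) && (x != K)) \sum_(y | (y != j) && (y != K)) r s' x y.
have split s' : offdiag a b s' = offdiag_touching j K s' + inner s'.
  have row x : \sum_y r s' x y = offdiag_col b a x s'.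
    rewrite /r -big_mkcond; apply: eq_bigr => y _; exact: mulrC.
  have col y : \sum_x r s' x y = offdiag_col a b y s'.
    by rewrite /r -big_mkcond; apply: eq_bigl => x; rewrite eq_sym.
  have -> : offdiag a b s' = \sum_x \sum_y r s' x y.
    by apply: eq_bigr => x _; rewrite /r -big_mkcond.
  rewrite (sum_two _ jK) !row.
  under eq_bigr => x _ do rewrite (sum_two _ jK).
  rewrite !big_split /= -/(inner s').
  have := col j; rewrite (sum_two _ jK) {1}/r eqxx /= => cj.
  have := col K; rewrite (sum_two _ jK) {2}/r eqxx /= => cK.
  rewrite /offdiag_touching -cj -cK /r jK (eq_sym K j) jK; ring.
have inner_swap : inner (swp j K s) = inner s.
  apply: eq_bigr => x /andP[xj xK]; apply: eq_bigr => y /andP[yj yK].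
  by rewrite /r !swap_d.
by rewrite !split inner_swap; ring.
Qed.

End Bilinear.

(** Given s j = p, this is the permutation sum of a rank one matrix, column p of [a] times row [j]
    of [b] with the entries at j and p removed. By centering its total is the single product a j p *
    b j p, so the second moment bound for permutation sums applies. *)
Let offdiag_col_sqr a b j :
  row_centered a -> col_centered a -> row_centered b -> col_centered b ->
  E (fun s => offdiag_col a b j s ^+ 2) <= 10 / n%:R ^+ 2 * (sqnorm a * \sum_k b j k ^+ 2).
Proof.
move=> ra ca rb cb.
pose A p := \sum_i a i p ^+ 2; pose B := \sum_k b j k ^+ 2.
have A0 p : 0 <= A p by apply: sumr_ge0 => i _; exact: sqr_ge0.
have B0 : 0 <= B by apply: sumr_ge0 => i _; exact: sqr_ge0.
have m1 : 0 < m.+1%:R^-1 :> R by rewrite invr_gt0.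
rewrite (Ex_cond j).
have H p : Ex (fun t : 'S_m.+1 => offdiag_col a b j (lift_perm j p t) ^+ 2)
    <= 5 / m.+1%:R * (A p * B).
  pose c : 'M[R]_m.+1 := \matrix_(x, y) (a (lift j x) p * b j (lift p y)).
  have -> : Ex (fun t : 'S_m.+1 => offdiag_col a b j (lift_perm j p t) ^+ 2)
      = Ex (fun t : 'S_m.+1 => perm_sum c t ^+ 2).
    apply: eq_Ex => t; congr (_ ^+ 2).
    rewrite /offdiag_col lift_perm_id big_mkcond (bigD1_ord j)//= eqxx add0r.
    by apply: eq_bigr => x _; rewrite eq_sym neq_lift lift_perm_lift mxE.
  apply: le_trans (perm_sum_second_moment _ _) _ => //.
  have C1 : \sum_i \sum_k c i k ^+ 2 <= A p * B.
    rewrite /A /B (bigD1_ord j)//= [\sum_k b j k ^+ 2](bigD1_ord p)//=.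
    set A' := \sum_i a _ _ ^+ 2; set B' := \sum_i b j _ ^+ 2.
    have -> : \sum_i \sum_k c i k ^+ 2 = A' * B'.
      rewrite mulr_suml; apply: eq_bigr => x _; rewrite mulr_sumr.
      by apply: eq_bigr => y _; rewrite mxE exprMn.
    have A'0 : 0 <= A' by apply: sumr_ge0 => i _; exact: sqr_ge0.
    have B'0 : 0 <= B' by apply: sumr_ge0 => i _; exact: sqr_ge0.
    by apply: ler_pM => //; rewrite lerDr sqr_ge0.
  have C2 : (\sum_i \sum_k c i k) ^+ 2 <= A p * B.
    have -> : \sum_i \sum_k c i k = a j p * b j p.
      have -> : \sum_i \sum_k c i k
          = (\sum_x a (lift j x) p) * (\sum_y b j (lift p y)).
        rewrite mulr_suml; apply: eq_bigr => x _; rewrite mulr_sumr.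
        by apply: eq_bigr => y _; rewrite mxE.
      have := ca p; rewrite (bigD1_ord j)//= => /eqP; rewrite addrC addr_eq0 => /eqP ->.
      have := rb j; rewrite (bigD1_ord p)//= => /eqP; rewrite addrC addr_eq0 => /eqP ->.
      by rewrite mulrNN.
    rewrite exprMn; apply: ler_pM; rewrite ?sqr_ge0//.
      by rewrite /A (bigD1 j)//= lerDl sumr_ge0// => i _; exact: sqr_ge0.
    by rewrite /B (bigD1 p)//= lerDl sumr_ge0// => i _; exact: sqr_ge0.
  have m2 : m.+1%:R^-1 ^+ 2 <= m.+1%:R^-1 :> R.
    by rewrite expr2 ler_piMl ?(ltW m1)// invf_le1// ler1n.
  have AB0 : 0 <= A p * B by exact: mulr_ge0.
  rewrite exprMn; move: m.+1%:R^-1 m1 m2 => v v0 v2.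
  have : v ^+ 2 * (\sum_i \sum_k c i k) ^+ 2 <= v * (A p * B).
    by apply: ler_pM; rewrite ?sqr_ge0.
  have : v * (\sum_i \sum_k c i k ^+ 2) <= v * (A p * B).
    by rewrite ler_wpM2l// ltW.
  lra.
apply: le_trans (ler_wpM2l _ (ler_sum _ (fun p _ => H p))) _; first by rewrite invr_ge0.
rewrite -mulr_sumr -mulr_suml (_ : \sum_p A p = sqnorm a); last exact: exchange_big.
have n2 : m.+1%:R^-1 <= 2 * n%:R^-1 :> R.
  rewrite -[leRHS]invrK lef_pV2 ?posrE ?invr_gt0 ?mulr_gt0 ?invr_gt0//.
  rewrite invfM invrK ler_pdivrMl// -natrM ler_nat; lia.
have P0 : 0 <= sqnorm a * B by rewrite mulr_ge0// sqnorm_ge0.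
have n0 : 0 <= n%:R^-1 :> R by rewrite invr_ge0.
have := ler_wpM2l n0 (ler_wpM2r P0 n2); rewrite -exprVn expr2.
move: (sqnorm a * B) P0 => P P0; rewrite -mulrA.
by move: n%:R^-1 m.+1%:R^-1 => v u; lra.
Qed.

Let offdiag_pair_sqr a b j K : j != K ->
  E (fun s => (a j (s K) * b K (s j)) ^+ 2)
  <= 2 / n%:R ^+ 2 * ((\sum_k a j k ^+ 2) * \sum_k b K k ^+ 2).
Proof.
move=> jK; apply: le_trans (ler_norm _) _.
apply: le_trans (@Ex_cond2_le R m 0 j K
  (fun k l _ => (a j l * b K k) ^+ 2) (fun k l => (a j l * b K k) ^+ 2) jK _ _) _.
- by move=> k l; exact: sqr_ge0.
- by move=> j' k l' _; rewrite ExC ?card_perm_gt0// ger0_norm ?sqr_ge0.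
have -> : \sum_k \sum_l (a j l * b K k) ^+ 2 = (\sum_k a j k ^+ 2) * \sum_k b K k ^+ 2.
  rewrite mulr_sumr; apply: eq_bigr => k _; rewrite mulr_suml.
  by apply: eq_bigr => l _; rewrite exprMn.
rewrite ler_wpM2r//; first by rewrite mulr_ge0// sumr_ge0// => k _; exact: sqr_ge0.
rewrite -[leRHS]invrK lef_pV2 ?posrE ?invr_gt0 ?mulr_gt0 ?invr_gt0 ?exprn_gt0//.
rewrite invfM invrK ler_pdivrMl// expr2 -!natrM ler_nat; nia.
Qed.

(** A self-bounding argument: [offdiag_center] with [G] equal to the sum itself bounds n E[G^2] by
    half of itself plus terms in rows, columns and single pairs, which have already been
    estimated. *)
Lemma offdiag_second_moment a b :
  row_centered a -> col_centered a -> row_centered b -> col_centered b ->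
  E (fun s => offdiag a b s ^+ 2) <= 1070 * (sqnorm a * sqnorm b / n%:R ^+ 2).
Proof.
move=> ra ca rb cb; set P := sqnorm a * sqnorm b / n%:R ^+ 2.
have n0 : 0 < n%:R :> R by [].
have n1 : 1 <= n%:R :> R by rewrite ler1n.
have P0 : 0 <= P by rewrite divr_ge0 ?sqr_ge0// mulr_ge0 ?sqnorm_ge0.
pose U j := E (fun s => offdiag_col a b j s ^+ 2).
pose V j := E (fun s => offdiag_col b a j s ^+ 2).
pose r j K := if j != K then E (fun s => (a j (s K) * b K (s j)) ^+ 2) else 0.
have SU : \sum_j U j <= 10 * P.
  apply: le_trans (ler_sum _ (fun j _ => offdiag_col_sqr j ra ca rb cb)) _.
  by rewrite -!mulr_sumr /P /sqnorm; move: (n%:R ^- 2) => v; lra.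
have SV : \sum_j V j <= 10 * P.
  apply: le_trans (ler_sum _ (fun j _ => offdiag_col_sqr j rb cb ra ca)) _.
  by rewrite -!mulr_sumr /P /sqnorm; move: (n%:R ^- 2) => v; lra.
have Sr : \sum_j \sum_K r j K <= 2 * P.
  have H j K : r j K <= 2 / n%:R ^+ 2 * ((\sum_k a j k ^+ 2) * \sum_k b K k ^+ 2).
    rewrite /r; case: ifP => [jK|_]; first exact: offdiag_pair_sqr.
    rewrite mulr_ge0// ?divr_ge0 ?sqr_ge0// mulr_ge0// sumr_ge0// => k _; exact: sqr_ge0.
  apply: le_trans (ler_sum _ (fun j _ => ler_sum _ (fun K _ => H j K))) _.
  under eq_bigr => j _ do rewrite -!mulr_sumr.
  by rewrite -mulr_sumr -mulr_suml /P /sqnorm; move: (n%:R ^- 2) => v; lra.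
have := @offdiag_center a b ra cb (offdiag a b).
under eq_Ex => s do rewrite -expr2.
set ER := E (fun s => offdiag a b s ^+ 2) => main.
have B1 : E (fun s => perm_sum a s * perm_sum b s * offdiag a b s) <= n%:R / 2 * ER + 2 * n%:R * P.
  apply: le_trans (Ex_le (fun s => ler_norm _)) _.
  under eq_Ex => s do rewrite mulrC.
  apply: le_trans (Ex_young _ _ n0) _; rewrite -/ER lerD2l.
  have H s : (perm_sum a s * perm_sum b s) ^+ 2 <= n%:R * sqnorm a * perm_sum b s ^+ 2.
    by rewrite exprMn ler_wpM2r ?sqr_ge0// perm_sum_sqr_le.
  have := Ex_le H; rewrite ExZ => H1.
  have := @perm_sum_second_moment R n b isT.
  rewrite (_ : \sum_i \sum_k b i k = 0); last by rewrite big1.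
  rewrite mulr0 expr0n /= addr0 -/(sqnorm b) => H2.
  have := ler_wpM2l (mulr_ge0 (ltW n0) (sqnorm_ge0 a)) H2 => H3.
  have H4 := le_trans H1 H3.
  have := ler_wpM2l (_ : 0 <= (2 * n%:R)^-1) H4.
  rewrite invr_ge0 mulr_ge0//= => /(_ isT) H5; apply: le_trans H5 _.
  by rewrite le_eqVlt /P; apply/orP; left; apply/eqP; field.
have B2 j K : E (fun s => offdiag_col a b j s * (offdiag a b s - offdiag a b (swp j K s)))
   <= 2^-1 * U j + 12 * (U j + V j + U K + V K + r j K + r K j).
  have [<-|jK] := eqVneq j K.
    under eq_Ex => s do rewrite tperm1 mul1g subrr mulr0.
    rewrite ExC ?card_perm_gt0//.
    have U0 : 0 <= U j by apply: Ex_ge0 => s; exact: sqr_ge0.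
    have V0 : 0 <= V j by apply: Ex_ge0 => s; exact: sqr_ge0.
    rewrite /r eqxx /= !addr0; apply: addr_ge0; first by rewrite mulr_ge0 ?invr_ge0.
    by rewrite mulr_ge0// !addr_ge0.
  pose L s : R := offdiag_col a b j s + offdiag_col b a j s + offdiag_col a b K s
    + offdiag_col b a K s - a j (s K) * b K (s j) - a K (s j) * b j (s K).
  have H s : offdiag_col a b j s * (offdiag a b s - offdiag a b (swp j K s))
      <= 2^-1 * offdiag_col a b j s ^+ 2 + (L s ^+ 2 + L (swp j K s) ^+ 2).
    rewrite (offdiag_increment a b s jK) -/(L s) -/(L (swp j K s)).
    exact: mul_diff_le.
  apply: le_trans (Ex_le H) _; rewrite ExD ExZ -/(U j) lerD2l ExD.
  rewrite (@Ex_swap R n (fun s => L s ^+ 2) j K).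
  have HL s : L s ^+ 2 <= 6 * (offdiag_col a b j s ^+ 2 + offdiag_col b a j s ^+ 2
     + offdiag_col a b K s ^+ 2 + offdiag_col b a K s ^+ 2
     + (a j (s K) * b K (s j)) ^+ 2 + (a K (s j) * b j (s K)) ^+ 2).
    exact: sqr_sum6.
  have EL := Ex_le HL; rewrite ExZ !ExD -/(U j) -/(V j) -/(U K) -/(V K) in EL.
  apply: le_trans (lerD EL EL) _.
  by rewrite -mulrDl -natrD /r jK (eq_sym K j) jK.
have B3 : n%:R * ER <= n%:R / 2 * ER + 2 * n%:R * P + \sum_j \sum_K
    (2^-1 * U j + 12 * (U j + V j + U K + V K + r j K + r K j)).
  rewrite main; apply: lerD B1 _; apply: ler_sum => j _; apply: ler_sum => K _.
  exact: B2.
have E3 : \sum_j \sum_K (2^-1 * U j + 12 * (U j + V j + U K + V K + r j K + r K j))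
  = n%:R * (2^-1 * \sum_j U j + 24 * (\sum_j U j + \sum_j V j)) + 24 * \sum_j \sum_K r j K.
  under eq_bigr => j _ do rewrite big_split /= -!mulr_sumr !big_split /= !sum_cst_ord.
  rewrite !(big_split, =^~ mulr_sumr) /= !sum_cst_ord.
  by rewrite [\sum_i \sum_j r j i]exchange_big /=; ring.
rewrite E3 in B3.
have nP : 0 <= (n%:R - 1) * P by rewrite mulr_ge0// subr_ge0.
have h1 := ler_wpM2l (ltW n0) SU; have h2 := ler_wpM2l (ltW n0) SV.
rewrite -(ler_pM2l n0); exact: self_bound_arith nP h1 h2 Sr B3.
Qed.

End OffDiagonal.

(** * The standardized matrix *)

Section DoubleCentering.
Variables (R : realType) (n : nat).
Implicit Types (a b : 'M[R]_n).
Hypothesis n0 : (0 < n)%N.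

Let nR0 : n%:R != 0 :> R. Proof. by rewrite pnatr_eq0 -lt0n. Qed.

Lemma breve_row_centered b : row_centered (breve_mx b).
Proof.
move=> i; under eq_bigr => k _ do rewrite mxE.
rewrite big_split /= sum_cst_ord !sumrB sum_cst_ord -mulr_sumr.
by rewrite exchange_big /=; have := nR0 => ?; field.
Qed.

Lemma breve_col_centered b : col_centered (breve_mx b).
Proof.
move=> k; under eq_bigr => i _ do rewrite mxE.
rewrite big_split /= sum_cst_ord !sumrB sum_cst_ord -mulr_sumr.
by have := nR0 => ?; field.
Qed.

Lemma perm_sum_breve b s : perm_sum (breve_mx b) s = perm_sum b s - mu b.
Proof.
rewrite /perm_sum; under eq_bigr => i _ do rewrite mxE.
rewrite big_split /= sum_cst_ord !sumrB -!mulr_sumr /mu.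
rewrite (_ : \sum_i \sum_k b k (s i) = \sum_i \sum_k b i k); first by have := nR0 => ?; field.
rewrite exchange_big /=; apply: eq_bigr => i _; exact: sum_perm_row.
Qed.

(** Double centering is the orthogonal projection onto doubly centered matrices, hence invisible to
    a product with such a matrix. *)
Lemma mx_dot_breve a b : row_centered a -> col_centered a ->
  mx_dot a (breve_mx b) = mx_dot a b.
Proof.
move=> ra ca.
pose r i := n%:R^-1 * \sum_l b i l; pose c k := n%:R^-1 * \sum_i b i k.
pose g := (n%:R ^+ 2)^-1 * \sum_k \sum_l b k l.
have E i k : a i k * breve_mx b i k = a i k * b i k - a i k * r i - a i k * c k + a i k * g.
  by rewrite mxE -/(r i) -/(c k) -/g; ring.
rewrite /mx_dot; under eq_bigr => i _ do under eq_bigr => k _ do rewrite E.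
under eq_bigr => i _ do rewrite big_split !sumrB /= -!mulr_suml ra !mul0r subr0 addr0.
rewrite sumrB (_ : \sum_i \sum_k a i k * c k = 0) ?subr0//.
rewrite exchange_big big1//= => k _; by rewrite -mulr_suml ca mul0r.
Qed.

(** Each of the three families of means has squared norm at most [sqnorm b] by Cauchy-Schwarz; 16 is
    four such terms times the 4 of [sqr_sum4]. *)
Lemma sqnorm_breve b : sqnorm (breve_mx b) <= 16 * sqnorm b.
Proof.
have n1 : 0 < n%:R :> R by rewrite ltr0n.
have nV : 0 <= n%:R^-1 :> R by rewrite invr_ge0 ltW.
pose r i := n%:R^-1 * \sum_l b i l; pose c k := n%:R^-1 * \sum_i b i k.
pose g := (n%:R ^+ 2)^-1 * \sum_k \sum_l b k l.
have E i k : breve_mx b i k ^+ 2 <= 4 * (b i k ^+ 2 + r i ^+ 2 + c k ^+ 2 + g ^+ 2).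
  rewrite mxE -/(r i) -/(c k) -/g.
  have -> : b i k - r i - c k + g = b i k + g - r i - c k by ring.
  by apply: le_trans (sqr_sum4 _ _ _ _) _; rewrite le_eqVlt; apply/orP; left; apply/eqP; ring.
apply: le_trans (ler_sum _ (fun i _ => ler_sum _ (fun k _ => E i k))) _.
under eq_bigr => i _ do rewrite -mulr_sumr !big_split /= !sum_cst_ord.
rewrite -mulr_sumr !big_split /= !sum_cst_ord -!mulr_sumr.
have mean (F : 'I_n -> R) : n%:R * (n%:R^-1 * \sum_i F i) ^+ 2 <= \sum_i F i ^+ 2.
  have nn := nR0; have := ler_wpM2l nV (sqr_sum_le F) => H.
  rewrite (_ : n%:R * _ = n%:R^-1 * (\sum_i F i) ^+ 2); last by field.
  by apply: le_trans H _; rewrite mulrA mulVf ?mul1r.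
have Hr : n%:R * \sum_i r i ^+ 2 <= sqnorm b.
  by rewrite mulr_sumr; apply: ler_sum => i _; exact: mean.
have Hc : n%:R * \sum_k c k ^+ 2 <= sqnorm b.
  rewrite mulr_sumr /sqnorm exchange_big; apply: ler_sum => k _.
  exact: (mean (fun i => b i k)).
have Hg : n%:R * (n%:R * g ^+ 2) <= sqnorm b.
  apply: le_trans Hr; rewrite ler_wpM2l ?(ltW n1)//.
  have := mean r; rewrite (_ : n%:R^-1 * _ = g)//.
  by rewrite /r -mulr_sumr mulrA /g expr2 invfM.
rewrite (_ : \sum_i \sum_k b i k ^+ 2 = sqnorm b)//.
set u := n%:R * \sum_i r i ^+ 2; set v := n%:R * \sum_i c i ^+ 2; set w := n%:R * (n%:R * _).
have : sqnorm b + u + v + w <= sqnorm b + sqnorm b + sqnorm b + sqnorm b.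
  by rewrite !lerD.
move=> H; have := ler_wpM2l (ler0n R 4) H; move/le_trans; apply.
by rewrite le_eqVlt; apply/orP; left; apply/eqP; ring.
Qed.

End DoubleCentering.

Section FourthMomentArith.
Variable R : realFieldType.

Lemma fourth_moment_arith (t x o v N : R) : 0 <= t -> 0 <= v -> v * N = 1 ->
  v * o <= 1 -> v * x <= 6^-1 * x -> v * t <= 6^-1 * t ->
  t * ((2^-1 + 2^-1 * v) * x + 2^-1 * v * (t + (N - 1) + o))
    <= 7 / 12 * (t * x) + 12^-1 * (t * t) + t.
Proof.
move=> t0 v0 vN vo vx vt.
suff H : (2^-1 + 2^-1 * v) * x + 2^-1 * v * (t + (N - 1) + o) <= 7 / 12 * x + 12^-1 * t + 1.
  by have := ler_wpM2l t0 H; lra.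
lra.
Qed.

(** On the right, [t4] has total coefficient 3 (7/12 * 1/7 + 1/12) = 1/2 and is absorbed. *)
Lemma fourth_moment_arith2 (t4 tx x2 t2 e : R) : t4 <= 3 * e ->
  tx <= 7^-1 * t4 + 7 / 4 * x2 -> t2 <= 4 -> x2 <= 5 ->
  e <= 7 / 12 * tx + 12^-1 * t4 + t2 -> t4 <= 60.
Proof. lra. Qed.

Lemma splitr3 (x : R) : 3 / 2 * x + 3 / 2 * x = 3 * x.
Proof. by field. Qed.

End FourthMomentArith.

(** * Moments of the standardized matrix *)

Section StandardizedMatrix.
Variables (R : realType) (m : nat).
Local Notation n := (m.+2).
Variables (a : 'M[R]_n) (D : R).
Hypotheses (ra : row_centered a) (ca : col_centered a).
Hypotheses (sq_a : sqnorm a = n%:R - 1).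
Hypotheses (D0 : 0 < D) (D1 : D <= 1).
Hypothesis fourth_a : \sum_i \sum_k a i k ^+ 4 = n%:R * D ^+ 2.

Local Notation E := (@Ex R 'S_n).
Local Notation T := (perm_sum a).

Definition skewness : R := n%:R^-1 * \sum_i \sum_k a i k ^+ 3.
(** Coefficient of the orthogonal projection of [sq_mx] onto [a]: the dot product n lam divided by
    the squared norm n - 1. This is why [beta_mx] is orthogonal to [a]. *)
Definition skewness' : R := n%:R / (n%:R - 1) * skewness.
Local Notation lam := skewness.
Local Notation l := skewness'.

Definition sq_mx : 'M[R]_n := mx_mul_entries a a.
Definition beta_mx : 'M[R]_n := breve_mx sq_mx - l *: a.
Local Notation X := (perm_sum sq_mx).

Let n2 : 2 <= n%:R :> R. Proof. by rewrite ler_nat. Qed.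
Let n0 : 0 < n%:R :> R. Proof. by []. Qed.
Let nR0 : n%:R != 0 :> R. Proof. by []. Qed.

(** Cauchy-Schwarz between second and fourth powers: (n - 1)^2 <= n^3 D^2. Every factor 1/n in the
    expansion becomes O(D^2) in this way. *)
Lemma inv_n_le : n%:R^-1 <= 4 * D ^+ 2.
Proof.
have Q : sqnorm a ^+ 2 <= n%:R * (n%:R * (n%:R * D ^+ 2)).
  apply: le_trans (sqr_sum_le (fun i => \sum_k a i k ^+ 2)) _.
  rewrite ler_wpM2l//; apply: (@le_trans _ _ (\sum_i n%:R * \sum_k a i k ^+ 4)).
    apply: ler_sum => i _; apply: le_trans (sqr_sum_le (fun k => a i k ^+ 2)) _.
    by rewrite ler_wpM2l// ler_sum// => k _; rewrite -exprM.
  by rewrite -mulr_sumr fourth_a.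
rewrite sq_a in Q.
have N : n%:R ^+ 2 <= 4 * (n%:R - 1) ^+ 2 :> R by have := n2; nra.
have : n%:R * n%:R <= n%:R * n%:R * (4 * n%:R * D ^+ 2).
  rewrite -expr2; apply: le_trans N _; move: Q; lra.
rewrite ler_pMr ?mulr_gt0// => H.
by rewrite -[leLHS]mulr1 ler_pdivrMl// mulrCA mulrA.
Qed.

(** The cube lies between square and fourth power: |u|^3 <= D/2 u^2 + u^4 / (2 D), both of which sum
    to at most n D / 2. *)
Lemma skewness_le : `|lam| <= D.
Proof.
move: (D0) => Dp.
rewrite /skewness normrM gtr0_norm ?invr_gt0// ler_pdivrMl//.
have H i k : `|a i k ^+ 3| <= D / 2 * a i k ^+ 2 + (2 * D)^-1 * a i k ^+ 4.
  rewrite normrX -(real_normK (num_real (a i k))).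
  have -> : a i k ^+ 4 = `|a i k| ^+ 4 by rewrite (exprM _ 2 2) (exprM `|_| 2 2) real_normK ?num_real.
  move: `|a i k| (normr_ge0 (a i k)) => u u0.
  rewrite -subr_ge0 (_ : _ - _ = (2 * D)^-1 * (u * (D - u)) ^+ 2); last first.
    by field; rewrite lt0r_neq0.
  by rewrite mulr_ge0 ?sqr_ge0// invr_ge0 mulr_ge0// ltW.
apply: le_trans (ler_norm_sum _ _ _) _.
apply: le_trans (ler_sum _ (fun i _ => ler_norm_sum _ _ _)) _.
apply: le_trans (ler_sum _ (fun i _ => ler_sum _ (fun k _ => H i k))) _.
under eq_bigr => i _ do rewrite big_split /= -!mulr_sumr.
rewrite big_split /= -!mulr_sumr -/(sqnorm a) sq_a fourth_a.
rewrite (_ : (2 * D)^-1 * (n%:R * D ^+ 2) = n%:R * D / 2); last by field; rewrite lt0r_neq0.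
by have := n0; lra.
Qed.

Lemma skewness'_le : `|l| <= 2 * D.
Proof.
have n2' := n2.
rewrite /skewness' normrM; apply: ler_pM => //; last exact: skewness_le.
have n1 : 0 < n%:R - 1 :> R by lra.
by rewrite ger0_norm ?divr_ge0 ?(ltW n1)// ler_pdivrMr//; lra.
Qed.

Lemma skewness'_sub : `|l - lam| <= 8 * D ^+ 2.
Proof.
have n2' := n2; have D1' := D1; have D0' := D0.
have -> : l - lam = (n%:R - 1)^-1 * lam by rewrite /skewness'; field.
have n1 : 0 < n%:R - 1 :> R by lra.
rewrite normrM gtr0_norm ?invr_gt0//.
have H1 : (n%:R - 1)^-1 <= 8 * D ^+ 2.
  have := inv_n_le; have : (n%:R - 1)^-1 <= 2 * n%:R^-1 :> R.
    rewrite -[leRHS]invrK lef_pV2 ?posrE ?invr_gt0 ?mulr_gt0 ?invr_gt0//.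
    rewrite invfM invrK; lra.
  by move: (n%:R - 1)^-1 n%:R^-1 => u v; lra.
have H2 := le_trans skewness_le D1'.
rewrite -[leRHS]mulr1; apply: ler_pM => //; by rewrite invr_ge0 ltW.
Qed.

Lemma beta_mxE i k : beta_mx i k = breve_mx sq_mx i k - l * a i k.
Proof. by rewrite [LHS]mxE [X in _ + X]mxE [X in _ - X]mxE. Qed.

Lemma beta_row : row_centered beta_mx.
Proof.
move=> i; under eq_bigr => k _ do rewrite beta_mxE.
rewrite sumrB -mulr_sumr ra mulr0 subr0.
exact: breve_row_centered.
Qed.

Lemma beta_col : col_centered beta_mx.
Proof.
move=> k; under eq_bigr => i _ do rewrite beta_mxE.
rewrite sumrB -mulr_sumr ca mulr0 subr0.
exact: breve_col_centered.
Qed.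

Lemma perm_sum_beta s : perm_sum beta_mx s = X s - (n%:R - 1) / n%:R - l * T s.
Proof.
have -> : perm_sum beta_mx s = perm_sum (breve_mx sq_mx) s - l * T s.
  rewrite /perm_sum mulr_sumr -sumrB; apply: eq_bigr => i _.
  exact: beta_mxE.
rewrite perm_sum_breve//; congr (_ - _ - _).
rewrite /mu mulrC; congr (_ / _); rewrite -sq_a.
by apply: eq_bigr => i _; apply: eq_bigr => k _; rewrite mxE expr2.
Qed.

Lemma mx_dot_beta : mx_dot a beta_mx = 0.
Proof.
have -> : mx_dot a beta_mx = mx_dot a (breve_mx sq_mx) - l * sqnorm a.
  rewrite /mx_dot /sqnorm mulr_sumr -sumrB; apply: eq_bigr => i _.
  rewrite mulr_sumr -sumrB; apply: eq_bigr => k _.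
  by rewrite beta_mxE; ring.
rewrite mx_dot_breve// sq_a.
have -> : mx_dot a sq_mx = n%:R * lam.
  rewrite /skewness mulVKf//; apply: eq_bigr => i _; apply: eq_bigr => k _.
  by rewrite mxE; ring.
by rewrite /skewness'; field.
Qed.

Lemma sqnorm_sq : sqnorm sq_mx = n%:R * D ^+ 2.
Proof.
rewrite -fourth_a; apply: eq_bigr => i _; apply: eq_bigr => k _.
by rewrite mxE; ring.
Qed.

(** 40 = 2 * 16 + 2 * 4, from the centered square and from l^2 <= 4 D^2. *)
Lemma sqnorm_beta : sqnorm beta_mx <= 40 * n%:R * D ^+ 2.
Proof.
have n2' := n2; have D0' := D0.
have H i k : beta_mx i k ^+ 2 <= 2 * breve_mx sq_mx i k ^+ 2 + 2 * l ^+ 2 * a i k ^+ 2.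
  rewrite beta_mxE.
  move: (breve_mx _ i k) (a i k) l => u v w.
  by have := sqr_ge0 (u + w * v); lra.
apply: le_trans (ler_sum _ (fun i _ => ler_sum _ (fun k _ => H i k))) _.
under eq_bigr => i _ do rewrite big_split /= -!mulr_sumr.
rewrite big_split /= -!mulr_sumr -/(sqnorm a) -/(sqnorm (breve_mx _)) sq_a.
have := @sqnorm_breve R n isT sq_mx; rewrite sqnorm_sq => H1.
have l2 : l ^+ 2 <= 4 * D ^+ 2.
  rewrite -(real_normK (num_real l)) (_ : 4 * D ^+ 2 = (2 * D) ^+ 2); last by ring.
  by rewrite lerXn2r ?nnegrE ?mulr_ge0 ?(ltW D0')// skewness'_le.
have : l ^+ 2 * (n%:R - 1) <= 4 * D ^+ 2 * n%:R.
  apply: ler_pM => //; rewrite ?sqr_ge0//; lra.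
lra.
Qed.

Let centered_second_moment b : row_centered b ->
  E (fun s => perm_sum b s ^+ 2) <= 4 / n%:R * sqnorm b.
Proof.
move=> rb; apply: le_trans (@perm_sum_second_moment R n b isT) _.
by rewrite (_ : \sum_i \sum_k b i k = 0) ?mulr0 ?expr0n ?addr0//= big1.
Qed.

Lemma second_moment_le : E (fun s => T s ^+ 2) <= 4.
Proof.
apply: le_trans (centered_second_moment ra) _.
by rewrite sq_a mulrAC ler_pdivrMr//; lra.
Qed.

Lemma beta_second_moment : E (fun s => perm_sum beta_mx s ^+ 2) <= 160 * D ^+ 2.
Proof.
apply: le_trans (centered_second_moment beta_row) _.
rewrite mulrAC ler_pdivrMr//; have := sqnorm_beta; lra.
Qed.

Lemma sq_mean : E X = (n%:R - 1) / n%:R.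
Proof.
rewrite (@perm_sum_mean R n sq_mx isT) mulrC; congr (_ / _); rewrite -sq_a.
by apply: eq_bigr => i _; apply: eq_bigr => k _; rewrite mxE expr2.
Qed.

Lemma sq_ge0 s : 0 <= X s.
Proof. by apply: sumr_ge0 => i _; rewrite mxE -expr2 sqr_ge0. Qed.

Lemma sq_second_moment : E (fun s => X s ^+ 2) <= 5.
Proof.
have n2' := n2; have D0' := D0; have D1' := D1.
apply: le_trans (@perm_sum_second_moment R n sq_mx isT) _.
rewrite -/(sqnorm sq_mx) sqnorm_sq.
have -> : \sum_i \sum_k sq_mx i k = n%:R - 1.
  by rewrite -sq_a; apply: eq_bigr => i _; apply: eq_bigr => k _; rewrite mxE expr2.
rewrite (_ : 4 / n%:R * (n%:R * D ^+ 2) = 4 * D ^+ 2); last by field.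
have D2 : D ^+ 2 <= 1 by rewrite expr_le1// ltW.
have H : 0 <= (n%:R^-1 * (n%:R - 1) : R) <= 1.
  by rewrite mulr_ge0 ?invr_ge0//= ?ler_pdivrMl//; lra.
have : (n%:R^-1 * (n%:R - 1)) ^+ 2 <= 1 :> R by case/andP: H => h0 h1; rewrite expr_le1.
by move: (_ * (_ - _)) => u; lra.
Qed.

Lemma offdiag_self : E (fun s => offdiag a a s ^+ 2) <= 1070.
Proof.
have n2' := n2.
apply: le_trans (offdiag_second_moment ra ca ra ca) _.
rewrite sq_a -[leRHS]mulr1 ler_wpM2l ?ler0n// ler_pdivrMr ?exprn_gt0// mul1r expr2.
by apply: ler_pM; lra.
Qed.

Lemma offdiag_beta : E (fun s => offdiag a beta_mx s ^+ 2) <= 1070 * (40 * D ^+ 2).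
Proof.
have n2' := n2.
apply: le_trans (offdiag_second_moment ra ca beta_row beta_col) _.
rewrite ler_wpM2l ?ler0n// ler_pdivrMr ?exprn_gt0// sq_a.
apply: le_trans (_ : n%:R * (40 * n%:R * D ^+ 2) <= _); last by rewrite expr2; lra.
apply: ler_pM; [lra | exact: sqnorm_ge0 | lra | exact: sqnorm_beta].
Qed.

Lemma offdiag_self_le s : offdiag a a s <= n%:R.
Proof.
have H i j : a i (s j) * a j (s i) <= 2^-1 * a i (s j) ^+ 2 + 2^-1 * a j (s i) ^+ 2.
  by have := sqr_ge0 (a i (s j) - a j (s i)); lra.
have := n0 => n0'.
apply: (@le_trans _ _ (\sum_i \sum_j (2^-1 * a i (s j) ^+ 2 + 2^-1 * a j (s i) ^+ 2))).
  apply: ler_sum => i _; rewrite [leRHS](bigID (fun j => j != i)) /=.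
  rewrite -[leLHS]addr0; apply: lerD; first by apply: ler_sum => j _; exact: H.
  by apply: sumr_ge0 => j _; apply: addr_ge0; rewrite mulr_ge0 ?invr_ge0 ?sqr_ge0.
under eq_bigr => i _ do rewrite big_split /= -!mulr_sumr.
rewrite big_split /= -!mulr_sumr [X in _ + _ * X]exchange_big /=.
have -> : \sum_i \sum_j a i (s j) ^+ 2 = sqnorm a.
  apply: eq_bigr => i _.
  by rewrite [in RHS](reindex_inj (@perm_inj _ s)).
by rewrite sq_a; lra.
Qed.

Lemma swap_diff_sqr_sum (s : 'S_n) : (4 * n%:R)^-1 * \sum_i \sum_j swap_diff a i j (s i) (s j) ^+ 2
  = (2^-1 + (2 * n%:R)^-1) * X s + (2 * n%:R)^-1 * (T s ^+ 2 + (n%:R - 1) + offdiag a a s).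
Proof.
under eq_bigr => i _ do under eq_bigr => j _ do rewrite expr2.
rewrite (sum_swap_diff_mul s ra ca ra ca isT) -expr2; congr (_ + _ * (_ + _ + _)).
rewrite -sq_a; apply: eq_bigr => i _; apply: eq_bigr => k _; by rewrite expr2.
Qed.

(** The pair with G = T^3. The trapezoid error of the cube has a favorable sign, w (t^3 - (t - w)^3)
    = 3/2 w^2 (t^2 + (t - w)^2) - w^4 / 2, so no sixth moments arise; 6 <= n makes the coefficient
    of the fourth moment on the right absorbable. *)
Lemma fourth_moment_le : 6 <= n%:R :> R -> E (fun s => T s ^+ 4) <= 60.
Proof.
move=> n6.
have := @exchangeable_pair R n a (fun s => T s ^+ 3) isT.
rewrite (_ : \sum_i \sum_k a i k = 0); last by rewrite big1.
under eq_Ex => s do rewrite mulr0 subr0 -exprS.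
move=> main.
have H i j (s : 'S_n) : swap_diff a i j (s i) (s j) * (T s ^+ 3 - T (tperm i j * s)%g ^+ 3)
   <= 3 / 2 * (swap_diff a i j (s i) (s j) ^+ 2 * T s ^+ 2)
      + 3 / 2 * (swap_diff a i j (s i) (s j) ^+ 2 * T (tperm i j * s)%g ^+ 2).
  rewrite perm_sum_swap; move: (swap_diff _ _ _ _ _) (T s) => w t.
  rewrite -subr_ge0 (_ : _ - _ = 2^-1 * (w * (t - (t - w))) ^+ 2 ); last by field.
  by rewrite mulr_ge0 ?invr_ge0 ?sqr_ge0.
pose Q i j (s : 'S_n) := swap_diff a i j (s i) (s j) ^+ 2 * T s ^+ 2.
have S i j : E (fun s => swap_diff a i j (s i) (s j) * (T s ^+ 3 - T (tperm i j * s)%g ^+ 3))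
   <= 3 * E (Q i j).
  apply: le_trans (Ex_le (H i j)) _; rewrite ExD !ExZ.
  rewrite (_ : Ex (fun s : 'S_n => _ * T (tperm i j * s)%g ^+ 2) = E (Q i j)).
    by rewrite splitr3.
  rewrite -[RHS](Ex_swap _ i j); apply: eq_Ex => s.
  by rewrite /Q swap_diff_swap sqrrN.
have {}S : E (fun s => T s ^+ 4) <= 3 * E (fun s => T s ^+ 2 *
    ((2^-1 + (2 * n%:R)^-1) * X s + (2 * n%:R)^-1 * (T s ^+ 2 + (n%:R - 1) + offdiag a a s))).
  rewrite main -ExZ.
  have -> : E (fun s => 3 * (T s ^+ 2 * ((2^-1 + (2 * n%:R)^-1) * X s
      + (2 * n%:R)^-1 * (T s ^+ 2 + (n%:R - 1) + offdiag a a s))))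
    = (4 * n%:R)^-1 * \sum_i \sum_j (3 * E (Q i j)).
    have -> : \sum_i \sum_j (3 * E (Q i j)) = E (fun s => 3 * (T s ^+ 2 * \sum_i \sum_j swap_diff a i j (s i) (s j) ^+ 2)).
      rewrite ExZ (_ : Ex _ = \sum_i \sum_j E (Q i j)).
        by rewrite mulr_sumr; apply: eq_bigr => i _; rewrite mulr_sumr.
      under eq_bigr => i _ do rewrite -Ex_sum.
      rewrite -Ex_sum; apply: eq_Ex => s.
      rewrite mulr_sumr; apply: eq_bigr => i _; rewrite mulr_sumr.
      by apply: eq_bigr => j _; rewrite /Q mulrC.
    by rewrite -ExZ; apply: eq_Ex => s; rewrite -swap_diff_sqr_sum; ring.
  rewrite ler_wpM2l ?invr_ge0 ?mulr_ge0//.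
  by apply: ler_sum => i _; apply: ler_sum => j _; exact: S.
have i6 : n%:R^-1 <= 6^-1 :> R by rewrite lef_pV2 ?posrE.
have i0 : 0 <= n%:R^-1 :> R by rewrite invr_ge0.
have K (s : 'S_n) : T s ^+ 2 * ((2^-1 + (2 * n%:R)^-1) * X s
      + (2 * n%:R)^-1 * (T s ^+ 2 + (n%:R - 1) + offdiag a a s))
   <= 7 / 12 * (T s ^+ 2 * X s) + 12^-1 * T s ^+ 4 + T s ^+ 2.
  have X0 := sq_ge0 s; have O := offdiag_self_le s.
  rewrite invfM (_ : T s ^+ 4 = T s ^+ 2 * T s ^+ 2); last by ring.
  have nn : n%:R^-1 * n%:R = 1 :> R by rewrite mulVf.
  have HO : n%:R^-1 * offdiag a a s <= 1 by rewrite -[leRHS]nn ler_wpM2l.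
  have HX : n%:R^-1 * X s <= 6^-1 * X s by rewrite ler_wpM2r.
  have T2 := sqr_ge0 (T s).
  have HT : n%:R^-1 * T s ^+ 2 <= 6^-1 * T s ^+ 2 by rewrite ler_wpM2r.
  exact: fourth_moment_arith T2 i0 nn HO HX HT.
(* The weight 2/7 gives T^4 the coefficient 1/7, which cancels the 7 of 7/12. *)
have Y := @Ex_young R 'S_n (fun s => T s ^+ 2) X (2 / 7) _.
have {}Y : E (fun s => T s ^+ 2 * X s) <= 7^-1 * E (fun s => T s ^+ 4) + 7 / 4 * E (fun s => X s ^+ 2).
  apply: le_trans (Ex_le (fun s => ler_norm _)) _; apply: le_trans (Y _) _; first by rewrite divr_gt0.
  rewrite (_ : 2 / 7 / 2 = 7^-1 :> R); last by field.
  rewrite (_ : (2 * (2 / 7))^-1 = 7 / 4 :> R); last by field.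
  by under [in leLHS]eq_Ex => s do rewrite -exprM.
have := Ex_le K; rewrite !ExD !ExZ.
have := sq_second_moment; have := second_moment_le; move: S Y.
move: (E (fun s => T s ^+ 4)) (E (fun s => T s ^+ 2 * X s)) (E (fun s => X s ^+ 2))
  (E (fun s => T s ^+ 2)) => t4 tx x2 t2.
move: (E _) => e; exact: fourth_moment_arith2.
Qed.

End StandardizedMatrix.

(** * Taylor remainders *)

Section TaylorRemainders.
Variables (R : realType) (T : finType) (X : T -> R) (f f1 f2 : R -> R) (M : R).
Implicit Types (s t p w u v A B : R).

Hypotheses (T0 : (0 < #|T|)%N) (M1 : 1 <= M).
Hypotheses (fd : has_deriv f f1) (f1d : has_deriv f1 f2) (f1_le : forall t, `|f1 t| <= 3).
Hypothesis f2_le : forall t, Ex (fun x => `|f2 (X x + t)|) <= 110 * M * (1 + `|t|).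
Hypothesis f2_lip : forall s t, `|s| <= 2 -> `|t| <= 2 ->
  `|Ex (fun x => f2 (X x + t)) - Ex (fun x => f2 (X x + s))| <= 460 * M * `|t - s|.

Let G t := Ex (fun x => f (X x + t)).
Let G1 t := Ex (fun x => f1 (X x + t)).
Let G2 t := Ex (fun x => f2 (X x + t)).

Let shift_deriv g dg : has_deriv g dg ->
  has_deriv (fun t => Ex (fun x => g (X x + t))) (fun t => Ex (fun x => dg (X x + t))).
Proof.
move=> gd; apply: Ex_deriv => x t; under eq_fun do rewrite addrC; rewrite addrC.
exact: has_deriv_shift gd t.
Qed.

Let G_deriv : has_deriv G G1. Proof. exact: shift_deriv. Qed.
Let G1_deriv : has_deriv G1 G2. Proof. exact: shift_deriv. Qed.

Let mean_value g dg s t : has_deriv g dg ->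
  exists2 c, `|t - c| <= `|t - s| /\ `|s - c| <= `|t - s| & g t - g s = dg c * (t - s).
Proof.
move=> gd; have [st|/ltW ts] := leP s t.
  have [c /andP[sc ct] E] := MVT_has_deriv st (fun x _ => gd x).
  exists c => //; rewrite (@ger0_norm _ (t - s)) ?subr_ge0//.
  by rewrite ger0_norm ?subr_ge0// ler0_norm ?subr_le0//; lra.
have [c /andP[sc ct] E] := MVT_has_deriv ts (fun x _ => gd x).
exists c; last by rewrite -opprB E; ring.
rewrite (@ler0_norm _ (t - s)) ?subr_le0//.
by rewrite ler0_norm ?subr_le0// ger0_norm ?subr_ge0//; lra.
Qed.

Let between s t c : `|s| <= 1 -> `|t| <= 1 -> `|t - c| <= `|t - s| ->
  `|s - c| <= `|t - s| -> `|c| <= 1.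
Proof.
rewrite !ler_norml => /andP[? ?] /andP[? ?].
have [ts|ts] := leP 0 (t - s); [rewrite (ger0_norm ts)|rewrite (ltr0_norm ts)].
  by move=> /andP[_ h1] /andP[h2 _]; apply/andP; split; lra.
by move=> /andP[h1 _] /andP[_ h2]; apply/andP; split; lra.
Qed.

Let le2 s : `|s| <= 1 -> `|s| <= 2. Proof. lra. Qed.

Let trapezoid1 s t : `|s| <= 1 -> `|t| <= 1 ->
  `|G1 t - G1 s - (t - s) * ((G2 t + G2 s) / 2)| <= 460 * M * (t - s) ^+ 2.
Proof.
move=> s1 t1; have [c [tc sc] ->] := mean_value s t G1_deriv.
have c1 := between s1 t1 tc sc.
have H1 := f2_lip (le2 c1) (le2 t1); have H2 := f2_lip (le2 c1) (le2 s1).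
have M0 : 0 <= 460 * M by have := M1; lra.
have H1' := le_trans H1 (ler_wpM2l M0 tc); have H2' := le_trans H2 (ler_wpM2l M0 sc).
rewrite (_ : _ - _ = - ((t - s) * ((G2 t - G2 c) / 2 + (G2 s - G2 c) / 2))); last by field.
rewrite normrN normrM -(real_normK (num_real (t - s))) expr2 mulrA [leRHS]mulrC.
rewrite ler_wpM2l//; apply: le_trans (ler_normD _ _) _.
rewrite !normrM normfV (@ger0_norm _ 2)//.
rewrite -/(G2 t) -/(G2 c) in H1'; rewrite -/(G2 s) -/(G2 c) in H2'.
by move: H1' H2'; lra.
Qed.

(** Third order accuracy from a merely Lipschitz [G2]: the derivative of the error [Psi] is (G1 u -
    G1 s - (u - s) G2 u) / 2, and the mean value theorem turns it into a difference of values of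
    [G2]. The division by 2 makes 460 into 230. *)
Let trapezoid s t : `|s| <= 1 -> `|t| <= 1 ->
  `|G t - G s - (t - s) * ((G1 t + G1 s) / 2)| <= 230 * M * `|t - s| ^+ 3.
Proof.
move=> s1 t1.
have M0 : 0 <= 460 * M by have := M1; lra.
pose Psi u := G u - G s - (u - s) * ((G1 u + G1 s) / 2).
have Psid : has_deriv Psi (fun u => 2^-1 * (G1 u - G1 s - (u - s) * G2 u)).
  have sd := has_derivB (@has_derivX R) (has_derivC s).
  have md := has_derivM (has_derivD G1_deriv (has_derivC (G1 s))) (has_derivC 2^-1).
  apply: has_deriv_eq (has_derivB (has_derivB G_deriv (has_derivC (G s))) (has_derivM sd md)) _.
  by move=> u /=; field.
have Psi0 : Psi s = 0 by rewrite /Psi !subrr mul0r subrr.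
have [c [tc sc]] := mean_value s t Psid.
rewrite Psi0 subr0 -/(Psi t) => ->; have c1 := between s1 t1 tc sc.
rewrite normrM (_ : 230 * M * _ = 230 * M * `|t - s| ^+ 2 * `|t - s|); last by ring.
rewrite ler_wpM2r// normrM ger0_norm ?invr_ge0//.
have [d [cd sd] ->] := mean_value s c G1_deriv.
have d1 := between s1 c1 cd sd.
have H := le_trans (f2_lip (le2 c1) (le2 d1)) (ler_wpM2l M0 (_ : _ <= `|t - s|)).
rewrite (_ : _ - _ = (c - s) * (G2 d - G2 c)); last by ring.
have cs : `|c - s| <= `|t - s| by rewrite distrC.
have {}H : `|G2 d - G2 c| <= 460 * M * `|t - s|.
  by apply: H; rewrite distrC (le_trans cd).
rewrite normrM; have := ler_pM (normr_ge0 _) (normr_ge0 _) cs H.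
lra.
Qed.

Variables (p w A B : R).
Hypotheses (pA : `|p| <= A) (pwA : `|p - w| <= A) (wA : `|w| <= A).

Let A0 : 0 <= A. Proof. exact: le_trans pA. Qed.

Let small_arg : A <= 1 -> `|p| <= 1 /\ `|p - w| <= 1.
Proof. by move=> ?; split; [exact: le_trans pA _ | exact: le_trans pwA _]. Qed.

Let Ex3 (g h k : T -> R) c : Ex (fun x => c * (g x - h x - w / 2 * k x))
  = c * (Ex g - Ex h - w / 2 * Ex k).
Proof. by rewrite ExZ !ExB ExZ. Qed.

(** If A <= 1 both shifts stay where the averaged f'' is Lipschitz and the trapezoid rule applies.
    If A > 1 the crude bound 6 A^2 from |f'| <= 3 is already below the claim. *)
Lemma taylor_remainder1 :
  `|Ex (fun x => w * (f (X x + p) - f (X x + (p - w))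
       - w / 2 * (f1 (X x + p) + f1 (X x + (p - w)))))| <= 230 * M * A ^+ 4.
Proof.
have w4 : `|w| ^+ 4 <= A ^+ 4 by rewrite lerXn2r ?nnegrE.
have M1' := M1; have A0' := A0.
have M0 : 0 <= 230 * M by lra.
have [a1|a1] := leP A 1.
  have [p1 pw1] := small_arg a1.
  rewrite Ex3 ExD normrM; have := trapezoid pw1 p1; rewrite -/(G p) -/(G (p - w)) -/(G1 p) -/(G1 (p - w)).
  rewrite (_ : p - (p - w) = w); last by ring.
  rewrite (_ : w * ((G1 p + G1 (p - w)) / 2) = w / 2 * (G1 p + G1 (p - w))); last by field.
  move=> H; have := ler_wpM2l (normr_ge0 w) H => {}H.
  apply: le_trans H _; rewrite mulrCA -exprS; exact: ler_wpM2l.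
have H x : `|w * (f (X x + p) - f (X x + (p - w))
       - w / 2 * (f1 (X x + p) + f1 (X x + (p - w))))| <= 6 * A ^+ 2.
  have F : `|f (X x + p) - f (X x + (p - w))| <= 3 * `|w|.
    apply: le_trans (lipschitz_has_deriv fd (fun t _ => f1_le t)) _.
    by rewrite (_ : X x + p - _ = w)//; ring.
  have F1 : `|w / 2 * (f1 (X x + p) + f1 (X x + (p - w)))| <= 3 * `|w|.
    rewrite !normrM normfV (@ger0_norm _ 2)//.
    have := le_trans (ler_normD _ _) (lerD (f1_le (X x + p)) (f1_le (X x + (p - w)))).
    move=> /(ler_wpM2l (normr_ge0 w)); lra.
  have w2 : `|w| * `|w| <= A * A by exact: ler_pM.
  rewrite normrM; have := le_trans (ler_normB _ _) (lerD F F1).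
  move=> /(ler_wpM2l (normr_ge0 w)); lra.
apply: le_trans (Ex_norm_le H) _; rewrite (ExC T0).
have A2 : 1 <= A ^+ 2 by rewrite exprn_ege1// ltW.
have : A ^+ 2 <= A ^+ 4 by rewrite (_ : A ^+ 4 = A ^+ 2 * A ^+ 2) ?ler_peMl ?sqr_ge0//; ring.
have : 1 * A ^+ 4 <= M * A ^+ 4 by rewrite ler_wpM2r// exprn_ge0.
have : 0 <= A ^+ 4 by rewrite exprn_ge0.
lra.
Qed.

Let f2_avg t : `|t| <= A -> 1 < A -> Ex (fun x => `|f2 (X x + t)|) <= 220 * M * A.
Proof.
move=> tA a1; apply: le_trans (f2_le t) _; have M1' := M1.
have : M * (1 + `|t|) <= M * (2 * A) by rewrite ler_wpM2l; lra.
lra.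
Qed.

Hypothesis B0 : 0 <= B.

Lemma taylor_remainder2 b : `|b| <= B ->
  `|Ex (fun x => b * (f1 (X x + p) - f1 (X x + (p - w))
       - w / 2 * (f2 (X x + p) + f2 (X x + (p - w)))))| <= 460 * M * (A ^+ 2 * B).
Proof.
move=> bB.
have w2 : `|w| * `|w| <= A * A by exact: ler_pM.
have M1' := M1; have A0' := A0; have B0' := B0.
have M0 : 0 <= 460 * M by lra.
rewrite Ex3 ExD normrM.
suff H : `|G1 p - G1 (p - w) - w / 2 * (G2 p + G2 (p - w))| <= 460 * M * A ^+ 2.
  have := ler_pM (normr_ge0 _) (normr_ge0 _) bB H; rewrite -/(G1 p) -/(G1 (p - w)) -/(G2 p) -/(G2 (p - w)).
  lra.
have [a1|a1] := leP A 1.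
  have [p1 pw1] := small_arg a1.
  have := trapezoid1 pw1 p1; rewrite (_ : p - (p - w) = w); last by ring.
  rewrite (_ : w * ((G2 p + G2 (p - w)) / 2) = w / 2 * (G2 p + G2 (p - w))); last by field.
  move/le_trans; apply; rewrite ler_wpM2l// -(real_normK (num_real w)).
  by rewrite !expr2.
have F1 t : `|G1 t| <= 3.
  by apply: le_trans (Ex_norm_le (fun x => f1_le _)) _; rewrite (ExC T0).
have F2 t : `|t| <= A -> `|G2 t| <= 220 * M * A.
  by move=> tA; apply: le_trans (Ex_norm _) (f2_avg tA a1).
have H1 : `|G1 p - G1 (p - w)| <= 6.
  by apply: le_trans (ler_normB _ _) _; have := F1 p; have := F1 (p - w); lra.
have H2 : `|w / 2 * (G2 p + G2 (p - w))| <= 220 * M * A ^+ 2.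
  rewrite !normrM normfV (@ger0_norm _ 2)//.
  have := le_trans (ler_normD _ _) (lerD (F2 _ pA) (F2 _ pwA)) => h.
  have := ler_pM (normr_ge0 _) (normr_ge0 _) wA h.
  lra.
apply: le_trans (ler_normB _ _) _.
have A2 : 1 <= A ^+ 2 by rewrite exprn_ege1// ltW.
have : M <= M * A ^+ 2 by rewrite ler_peMr//; lra.
lra.
Qed.

(** Here the factor in front is already a product of two increments, so the Lipschitz bound on the
    averaged f'' suffices, with no trapezoid correction. *)
Lemma taylor_remainder3 b : `|b| <= A * B ->
  `|Ex (fun x => b * (f2 (X x + p) - f2 (X x + (p - w))))| <= 460 * M * (A ^+ 2 * B).
Proof.
move=> bB; have M1' := M1; have A0' := A0; have B0' := B0.
have M0 : 0 <= 460 * M by lra.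
rewrite ExZ ExB normrM.
suff H : `|G2 p - G2 (p - w)| <= 460 * M * A.
  have := ler_pM (normr_ge0 _) (normr_ge0 _) bB H; rewrite -/(G2 p) -/(G2 (p - w)).
  lra.
have [a1|a1] := leP A 1.
  have [p1 pw1] := small_arg a1.
  apply: le_trans (f2_lip (le2 pw1) (le2 p1)) _.
  by rewrite (_ : p - (p - w) = w) ?ler_wpM2l//; ring.
have F2 t : `|t| <= A -> `|G2 t| <= 220 * M * A.
  by move=> tA; apply: le_trans (Ex_norm _) (f2_avg tA a1).
apply: le_trans (ler_normB _ _) _; have := F2 _ pA; have := F2 _ pwA.
have : 0 <= M * A by rewrite mulr_ge0//; lra.
lra.
Qed.

End TaylorRemainders.

(** * Summation of the remainders over all transpositions *)

Section RemainderSum.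
Variables (R : realType) (m : nat).
Local Notation n := (m.+2).
Variables (a b : 'M[R]_n) (D c : R).
Implicit Types (i j k l : 'I_n).
Hypotheses (c0 : 0 <= c).
Hypothesis fourth_a : \sum_i \sum_k a i k ^+ 4 = n%:R * D ^+ 2.
Hypothesis sqnorm_b : sqnorm b <= 40 * n%:R * D ^+ 2.

Definition corner_abs (a' : 'M[R]_n) i j k l : R :=
  `|a' i k| + `|a' j l| + `|a' i l| + `|a' j k|.

Let Q i j k l := corner_abs a i j k l ^+ 4 + corner_abs b i j k l ^+ 2.

Let pow4_le (x y u v : R) : (`|x| + `|y| + `|u| + `|v|) ^+ 4 <= 64 * (x ^+ 4 + y ^+ 4 + u ^+ 4 + v ^+ 4).
Proof.
have E4 (t : R) : t ^+ 4 = `|t| ^+ 2 ^+ 2 by rewrite real_normK ?num_real -?exprM.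
have S (t1 t2 t3 t4 : R) : (t1 + t2 + t3 + t4) ^+ 2 <= 4 * (t1 ^+ 2 + t2 ^+ 2 + t3 ^+ 2 + t4 ^+ 2).
  have := sqr_sum4 t1 t2 (- t3) (- t4); by rewrite !opprK !sqrrN.
rewrite !E4 ger0_norm ?addr_ge0//.
have H1 := S `|x| `|y| `|u| `|v|.
have H2 := S (`|x| ^+ 2) (`|y| ^+ 2) (`|u| ^+ 2) (`|v| ^+ 2).
have := lerXn2r 2 _ _ H1; rewrite !nnegrE sqr_ge0 => /(_ isT _) H3.
apply: le_trans (H3 _) _; first by rewrite mulr_ge0// !addr_ge0 ?sqr_ge0.
by rewrite exprMn; move: H2; lra.
Qed.

Let sq_le (x y u v : R) : (`|x| + `|y| + `|u| + `|v|) ^+ 2 <= 4 * (x ^+ 2 + y ^+ 2 + u ^+ 2 + v ^+ 2).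
Proof.
have := sqr_sum4 `|x| `|y| (- `|u|) (- `|v|); by rewrite !opprK !sqrrN !real_normK ?num_real.
Qed.

Let sum_corner (F : 'I_n -> 'I_n -> R) :
  \sum_i \sum_j \sum_k \sum_l (F i k + F j l + F i l + F j k)
  = 4 * n%:R ^+ 2 * \sum_i \sum_k F i k.
Proof.
under eq_bigr => i _ do under eq_bigr => j _ do under eq_bigr => k _ do
  rewrite !big_split /= !sum_cst_ord.
under eq_bigr => i _ do under eq_bigr => j _ do
  rewrite !big_split /= !sum_cst_ord -!mulr_sumr.
under eq_bigr => i _ do rewrite !big_split /= !sum_cst_ord -!mulr_sumr.
rewrite !big_split /= !sum_cst_ord -!mulr_sumr; ring.
Qed.

Let total_Q : \sum_i \sum_j \sum_k \sum_l Q i j k l <= 896 * n%:R ^+ 3 * D ^+ 2.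
Proof.
pose F i k := 64 * a i k ^+ 4 + 4 * b i k ^+ 2.
have H i j k l : Q i j k l <= F i k + F j l + F i l + F j k.
  apply: le_trans (lerD (pow4_le _ _ _ _) (sq_le _ _ _ _)) _.
  by rewrite /F le_eqVlt; apply/orP; left; apply/eqP; ring.
apply: (@le_trans _ _ (\sum_i \sum_j \sum_k \sum_l (F i k + F j l + F i l + F j k))).
  by do 4 (apply: ler_sum => ? _); exact: H.
rewrite sum_corner /F.
under eq_bigr => i _ do rewrite big_split /= -!mulr_sumr.
rewrite big_split /= -!mulr_sumr fourth_a -/(sqnorm b).
have := ler_wpM2l (sqr_ge0 (n%:R : R)) sqnorm_b; lra.
Qed.

(** The total of [Q] has constant 896 = 4 (64 + 4 * 40). Dividing by 4 n from the pair and by n (n -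
    1) from the conditioning leaves 224 n / (n - 1) <= 448. *)
Lemma remainder_sum_le (Gam : 'I_n -> 'I_n -> 'I_n -> 'I_n -> R -> R) :
  (forall i k t, Gam i i k k t = 0) ->
  (forall i j (j' : 'I_m.+1) k (l' : 'I_m.+1), j = lift i j' ->
    `|Ex (fun t : 'S_m => Gam i j k (lift k l')
        (a i k + a j (lift k l') + perm_sum (minor2 a i j' k l') t))|
      <= c * Q i j k (lift k l')) ->
  `|(4 * n%:R)^-1 * \sum_i \sum_j
      Ex (fun s : 'S_n => Gam i j (s i) (s j) (perm_sum a s))| <= 448 * c * D ^+ 2.
Proof.
move=> Gam0 H.
have n0 : 0 < n%:R :> R by [].
have n1 : 0 < m.+1%:R :> R by [].
have nE : n%:R = m.+1%:R + 1 :> R by rewrite -natr1.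
have m1 : 1 <= m.+1%:R :> R by rewrite ler1n.
have Q0 i j k l : 0 <= c * Q i j k l.
  by rewrite mulr_ge0// addr_ge0// exprn_ge0// !addr_ge0.
have B i j : `|Ex (fun s : 'S_n => Gam i j (s i) (s j) (perm_sum a s))|
    <= (n%:R * m.+1%:R)^-1 * \sum_k \sum_l c * Q i j k l.
  have [<-|ij] := eqVneq i j.
    under eq_Ex => s do rewrite Gam0.
    rewrite ExC ?card_perm_gt0// normr0 mulr_ge0 ?invr_ge0 ?mulr_ge0//.
    by apply: sumr_ge0 => k _; apply: sumr_ge0 => l _; exact: Q0.
  apply: (Ex_cond2_le (Gam := Gam i j) (Q := fun k l => c * Q i j k l) ij) => //.
  by move=> j' k l' jE; exact: H.
rewrite normrM gtr0_norm ?invr_gt0 ?mulr_gt0// ler_pdivrMl ?mulr_gt0//.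
apply: le_trans (ler_norm_sum _ _ _) _.
apply: le_trans (ler_sum _ (fun i _ => ler_norm_sum _ _ _)) _.
apply: le_trans (ler_sum _ (fun i _ => ler_sum _ (fun j _ => B i j))) _.
under eq_bigr => i _ do rewrite -mulr_sumr.
rewrite -mulr_sumr ler_pdivrMl ?mulr_gt0//.
have -> : \sum_i \sum_j \sum_k \sum_l c * Q i j k l = c * \sum_i \sum_j \sum_k \sum_l Q i j k l.
  do 4 (rewrite mulr_sumr; apply: eq_bigr => ? _).
  by [].
apply: le_trans (ler_wpM2l c0 total_Q) _.
have P : 0 <= c * D ^+ 2 * n%:R ^+ 2 := mulr_ge0 (mulr_ge0 c0 (sqr_ge0 D)) (sqr_ge0 _).
have := ler_wpM2r P m1; rewrite nE in P *; lra.
Qed.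

End RemainderSum.

(** * Expansion and conclusion *)

Lemma sum4_mul_le (R : realDomainType) (x1 x2 x3 x4 : R) :
  0 <= x1 -> 0 <= x2 -> 0 <= x3 -> 0 <= x4 -> forall y1 y2 y3 y4,
  0 <= y1 -> 0 <= y2 -> 0 <= y3 -> 0 <= y4 ->
  x1 * y1 + x2 * y2 + x3 * y3 + x4 * y4 <= (x1 + x2 + x3 + x4) * (y1 + y2 + y3 + y4).
Proof.
move=> p1 p2 p3 p4 y1 y2 y3 y4 q1 q2 q3 q4; rewrite !mulrDl.
by do 3?apply: lerD; rewrite ler_wpM2l//; lra.
Qed.

Lemma norm_add_sub2_le (R : realDomainType) (x t o : R) : 0 <= x -> 0 <= t ->
  `|x + t + o - 2| <= x + t + o ^+ 2 + 3.
Proof.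
have := sqr_ge0 (o - 1); have := sqr_ge0 (o + 1).
by rewrite ler_norml => *; apply/andP; split; lra.
Qed.

(** Young's weight 6 D nearly balances the second moments 4 and 160 D^2, so that [y1] is O(D) and
    compensates 8 / D. *)
Lemma TTb_arith (R : realFieldType) (D y1 y2 t b t4 : R) : 0 < D -> D <= 1 ->
  y1 <= 6 * D / 2 * t + (2 * (6 * D))^-1 * b ->
  y2 <= 1 / 2 * t4 + (2 * 1)^-1 * b ->
  t <= 4 -> b <= 160 * D ^+ 2 -> t4 <= 60 -> 8 / D * y1 + 5 * y2 <= 800.
Proof.
move=> D0 D1 h1 h2 ht hb ht4.
have b1 : b <= 160.
  by apply: le_trans hb _; have := exprn_ile1 2 (ltW D0) D1; lra.
have : 8 / D * y1 <= 8 * (12 + 14).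
  rewrite mulrAC ler_pdivrMr// -mulrA ler_pM2l//.
  apply: le_trans h1 _.
  have -> : (2 * (6 * D))^-1 * b = 12^-1 * (b / D) by field; rewrite gt_eqF.
  have e1 : D * t <= D * 4 by rewrite ler_pM2l.
  have e2 : b / D <= 160 * D by rewrite ler_pdivrMr// -mulrA -expr2.
  lra.
by lra.
Qed.

Lemma offdiag_arith (R : realFieldType) (D y1 y2 t b : R) : 0 < D -> D <= 1 ->
  y1 <= 200 * D / 2 * 1 + (2 * (200 * D))^-1 * b ->
  y2 <= 200 / 2 * t + (2 * 200)^-1 * b ->
  t <= 4 -> b <= 1070 * (40 * D ^+ 2) -> 8 / D * y1 + 5 * y2 <= 4500.
Proof.
move=> D0 D1 h1 h2 ht hb.
have b1 : b <= 1070 * 40.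
  by apply: le_trans hb _; have := exprn_ile1 2 (ltW D0) D1; lra.
have : 8 / D * y1 <= 8 * 210.
  rewrite mulrAC ler_pdivrMr// -mulrA ler_pM2l//.
  apply: le_trans h1 _.
  have -> : (2 * (200 * D))^-1 * b = 400^-1 * (b / D) by field; rewrite gt_eqF.
  have e2 : b / D <= 1070 * (40 * D).
    by rewrite ler_pdivrMr//; move: hb; rewrite -!mulrA -expr2.
  lra.
by lra.
Qed.

Lemma pair_f1_arith (R : realFieldType) (v d Q e t o r2 r3 : R) :
  0 <= v -> v <= 4 * d -> v <= 1 -> e = (2^-1 + 2^-1 * v) * r3 + 2^-1 * v * (t + o) + r2 ->
  `|r2| <= Q -> `|r3| <= Q -> `|t| <= 800 -> `|o| <= 4500 -> `|e| <= 2 * Q + 10600 * d.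
Proof.
move=> v0 vd v1 -> h2 h3 ht ho.
have H3 : `|(2^-1 + 2^-1 * v) * r3| <= Q.
  rewrite normrM -[leRHS]mul1r; apply: ler_pM (normr_ge0 _) (normr_ge0 _) _ h3.
  by clear -v0 vd v1; rewrite ger0_norm; lra.
have Ho : `|2^-1 * v * (t + o)| <= 2 * d * 5300.
  rewrite normrM; apply: ler_pM (normr_ge0 _) (normr_ge0 _) _ _.
    by clear -v0 vd v1; rewrite ger0_norm; lra.
  by apply: le_trans (ler_normD _ _) _; lra.
apply: le_trans (ler_normD _ _) _; apply: le_trans (lerD (ler_normD _ _) h2) _.
by clear -H3 Ho; lra.
Qed.

Lemma pair_f_arith (R : realFieldType) (v d Q e x g r1 y : R) :
  0 <= v -> v <= 4 * d -> e = x + 2^-1 * y + 2^-1 * v * g + r1 ->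
  `|r1| <= Q -> `|y| <= 2 * Q + 10600 * d -> `|g| <= 3300 -> `|e - x| <= 2 * Q + 11900 * d.
Proof.
move=> v0 vd -> h1 hy hg.
have -> : x + 2^-1 * y + 2^-1 * v * g + r1 - x = 2^-1 * y + 2^-1 * v * g + r1 by ring.
have Hy : `|2^-1 * y| <= 2^-1 * (2 * Q + 10600 * d).
  by rewrite normrM ger0_norm ?invr_ge0 ?ler0n//; apply: ler_wpM2l hy; lra.
have Ho : `|2^-1 * v * g| <= 2 * d * 3300.
  rewrite normrM; apply: ler_pM (normr_ge0 _) (normr_ge0 _) _ hg.
  by clear -v0 vd; rewrite ger0_norm; lra.
apply: le_trans (ler_normD _ _) _; apply: le_trans (lerD (ler_normD _ _) h1) _.
by clear -Hy Ho; lra.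
Qed.

(** 2 * 448 * 230 = 206080; the constants free of x are absorbed by 10 d <= x d. *)
Lemma constant_arith (R : realFieldType) (x d : R) : 0 <= d -> 10 * d <= x * d ->
  2 * (x - 10) * d + (2 * (448 * (230 * x) * d) + 12000 * d) + 12500 * d
    <= 209 * (1000 * x) * d.
Proof. by move=> d0 H; lra. Qed.

(** * Expansion of the Stein identity *)

Section SteinExpansion.
Variables (R : realType) (m : nat).
Local Notation n := (m.+2).
Variables (a : 'M[R]_n) (D : R).
Implicit Types (s : 'S_n) (i j k l : 'I_n).

Local Notation E := (@Ex R 'S_n).
Local Notation T := (perm_sum a).
Local Notation wa i j s := (swap_diff a i j (s i) (s j)).

(** The squared norm of a minor is at most that of [a]. By double centering its total is the sum of
    the four entries where the deleted rows and columns meet, hence only of order the square root of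
    m. For 4 <= m the two contributions are at most 5 each. *)
Lemma minor2_second_moment i (j' : 'I_m.+1) k (l' : 'I_m.+1) :
  row_centered a -> col_centered a -> sqnorm a = n%:R - 1 -> (4 <= m)%N ->
  Ex (fun t : 'S_m => perm_sum (minor2 a i j' k l') t ^+ 2) <= 10.
Proof.
move=> ra ca sq_a m4; set B := minor2 a i j' k l'.
have m0 : (0 < m)%N by exact: leq_trans m4.
apply: le_trans (perm_sum_second_moment B m0) _.
have split2 (F : 'I_n -> R) i0 (j0 : 'I_m.+1) : \sum_x F x =
    F i0 + F (lift i0 j0) + \sum_(x < m) F (lift i0 (lift j0 x)).
  by rewrite (bigD1_ord i0)//= (bigD1_ord j0)//= addrA.
have mR : 4 <= m%:R :> R by rewrite ler_nat.
have nE : n%:R = m%:R + 2 :> R by rewrite -addn2 natrD.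
have sqB : sqnorm B <= m%:R + 1.
  have -> : m%:R + 1 = sqnorm a by rewrite sq_a nE; ring.
  rewrite /sqnorm [leRHS](split2 _ i j') -[leLHS]add0r; apply: lerD.
    by apply: addr_ge0; apply: sumr_ge0 => y _; exact: sqr_ge0.
  apply: ler_sum => x _; rewrite [leRHS](split2 _ k l') -[leLHS]add0r; apply: lerD.
    by rewrite addr_ge0 ?sqr_ge0.
  by apply: ler_sum => y _; rewrite mxE.
have entry x y : a x y ^+ 2 <= m%:R + 1.
  have -> : m%:R + 1 = sqnorm a by rewrite sq_a nE; ring.
  rewrite /sqnorm (bigD1 x)//= (bigD1 y)//= -addrA lerDl addr_ge0//.
    by apply: sumr_ge0 => ? _; exact: sqr_ge0.
  by apply: sumr_ge0 => ? _; apply: sumr_ge0 => ? _; exact: sqr_ge0.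
pose j := lift i j'; pose l := lift k l'.
have totB : \sum_x \sum_y B x y = a i k + a i l - (- a j k) - (- a j l).
  have row x : \sum_y B x y = - a (lift i (lift j' x)) k - a (lift i (lift j' x)) l.
    have := ra (lift i (lift j' x)); rewrite (split2 _ k l') => /eqP.
    rewrite addrC addr_eq0 opprD => /eqP <-.
    by apply: eq_bigr => y _; rewrite mxE.
  rewrite (eq_bigr _ (fun x _ => row x)) sumrB sumrN.
  have := ca k; have := ca l; rewrite !(split2 _ i j') -/j -/l.
  by set u := \sum_(x < m) _; set v := \sum_(x < m) _; lra.
have tot2 : (\sum_x \sum_y B x y) ^+ 2 <= 16 * (m%:R + 1).
  rewrite totB; apply: le_trans (sqr_sum4 _ _ _ _) _; rewrite !sqrrN.
  have := entry i k; have := entry i l; have := entry j k; have := entry j l; lra.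
have m00 : 0 < m%:R :> R by lra.
have i4 : m%:R^-1 <= 4^-1 :> R by rewrite lef_pV2 ?posrE.
have i0 : 0 <= m%:R^-1 :> R by rewrite invr_ge0 ltW.
have nn : m%:R^-1 * m%:R = 1 :> R by rewrite mulVf ?lt0r_neq0.
rewrite exprMn.
have H1 := ler_wpM2l i0 sqB; rewrite mulrDr nn mulr1 in H1.
have H2 := ler_wpM2l (sqr_ge0 m%:R^-1) tot2.
have H3 : m%:R^-1 ^+ 2 * (16 * (m%:R + 1)) = 16 * (m%:R^-1 + m%:R^-1 ^+ 2) :> R.
  by field; rewrite lt0r_neq0.
have H4 : m%:R^-1 ^+ 2 <= 4^-1 * 4^-1 :> R by rewrite expr2 ler_pM.
rewrite H3 in H2; rewrite -/(sqnorm B).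
move: (m%:R^-1) (sqnorm B) H1 H2 H4 i4 => v q H1 H2 H4 i4.
lra.
Qed.

(* Exchanging the images of i and j turns T s into T s - wa i j s and reverses
   the sign of both increments. *)
Lemma swap_symmetric b i j (g : R -> R) :
  E (fun s => swap_diff b i j (s i) (s j) * (wa i j s / 2 * (g (T s) + g (T s - wa i j s))))
  = E (fun s => swap_diff b i j (s i) (s j) * wa i j s * g (T s)).
Proof.
pose H s := swap_diff b i j (s i) (s j) * wa i j s * g (T s).
transitivity (2^-1 * E H + 2^-1 * E (fun s => H (tperm i j * s)%g)).
  rewrite -!ExZ -ExD; apply: eq_Ex => s.
  by rewrite /H !swap_diff_swap perm_sum_swap; field.
by rewrite Ex_swap -mulrDl (_ : 2^-1 + 2^-1 = 1) ?mul1r//; field.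
Qed.

(** The trapezoid form makes the main term an exact expectation at T, by [swap_symmetric], and
    leaves a remainder one order smaller than a one-sided Taylor expansion would. *)
Lemma pair_trapezoid b (g dg : R -> R) : row_centered b ->
  E (fun s => perm_sum b s * g (T s))
  = E (fun s => ((4 * n%:R)^-1 * \sum_i \sum_j swap_diff b i j (s i) (s j) * wa i j s) * dg (T s))
    + (4 * n%:R)^-1 * \sum_i \sum_j E (fun s => swap_diff b i j (s i) (s j) *
        (g (T s) - g (T s - wa i j s) - wa i j s / 2 * (dg (T s) + dg (T s - wa i j s)))).
Proof.
move=> rb; have := @exchangeable_pair R n b (fun s => g (T s)) isT.
rewrite (_ : \sum_i \sum_k b i k = 0); last by rewrite big1.
under eq_Ex => s do rewrite mulr0 subr0.
move=> ->.
have -> : E (fun s => ((4 * n%:R)^-1 * \sum_i \sum_j swap_diff b i j (s i) (s j) * wa i j s) * dg (T s))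
   = (4 * n%:R)^-1 * \sum_i \sum_j E (fun s => swap_diff b i j (s i) (s j) * wa i j s * dg (T s)).
  under eq_bigr => i _ do rewrite -Ex_sum.
  rewrite -Ex_sum -ExZ; apply: eq_Ex => s; rewrite -mulrA; congr (_ * _).
  by rewrite mulr_suml; apply: eq_bigr => i _; rewrite mulr_suml.
rewrite -mulrDr -big_split; congr (_ * _); apply: eq_bigr => i _.
rewrite -big_split; apply: eq_bigr => j _ /=.
rewrite -swap_symmetric -ExD; apply: eq_Ex => s.
by rewrite perm_sum_swap; ring.
Qed.

Hypotheses (ra : row_centered a) (ca : col_centered a).
Hypotheses (sq_a : sqnorm a = n%:R - 1).
Hypotheses (D0 : 0 < D) (D1 : D <= 1).
Hypothesis fourth_a : \sum_i \sum_k a i k ^+ 4 = n%:R * D ^+ 2.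
Hypothesis m4 : (4 <= m)%N.

Variable C1 : R.
Hypothesis C10 : 0 < C1.
Hypothesis smooth : forall (z y : R) (p : nat) (B : 'M[R]_p),
  0 <= y <= D -> N 8 a B -> `|Delta2 y (F B) z| <= C1 * (D ^+ 2 + y ^+ 2).

(** The 10 is the bound of [minor2_second_moment], in the role of the moment constant K of the
    regularity lemmas. *)
Let M := 10 + C1.
Let lam := skewness a.
Let l := skewness' a.
Let beta := beta_mx a.
Let gamma := mx_mul_entries a beta.

Variables (z c : R) (f : R -> R).
Local Notation f1 := (stein_d1 D z c (skew D l) f).
Local Notation f2 := (stein_d2 D z c (skew D l) (dskew D l) f).
Hypotheses (c01 : 0 <= c <= 1) (fd : has_deriv f f1).
Hypotheses (f_le : forall x, `|f x| <= 5 / 2) (xf_le : forall x, `|x * f x| <= 1).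

Let l_le : `|l| <= 2 * D. Proof. exact: skewness'_le. Qed.

Let f1_deriv : has_deriv f1 f2.
Proof. exact: stein_d1_deriv (skew_deriv D l) fd. Qed.

Let f1_le x : `|f1 x| <= 3.
Proof. exact: stein_d1_le D0 c01 (skew_half l_le) xf_le x. Qed.

Let f2_le x : `|f2 x| <= 8 / D + 5 * `|x|.
Proof.
by apply: stein_d2_le_scale => //; [exact: skew_half | exact: dskew_le].
Qed.

Section Minor.
Variables (i : 'I_n) (j' : 'I_m.+1) (k : 'I_n) (l' : 'I_m.+1).
Local Notation B := (minor2 a i j' k l').

Let smoothB z' y : 0 <= y <= D -> `|Delta2 y (unif_cdf (perm_sum B)) z'| <= C1 * (D ^+ 2 + y ^+ 2).
Proof. by move=> yD; apply: (smooth z' yD); apply: N_minor2; exact: leq_trans m4. Qed.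

Let one_le10 : 1 <= 10 :> R. Proof. by lra. Qed.

Lemma minor_stein_d2 t :
  Ex (fun s : 'S_m => `|f2 (perm_sum B s + t)|) <= 110 * M * (1 + `|t|).
Proof.
exact: (Ex_stein_d2 (K := 10) z D0 D1 c01 (skew_half l_le) (dskew_le l_le) f_le xf_le
  (card_perm_gt0 m) C10 one_le10 (minor2_second_moment i j' k l' ra ca sq_a m4) smoothB).
Qed.

Lemma minor_stein_d2_lipschitz t u : `|t| <= 2 -> `|u| <= 2 ->
  `|Ex (fun s : 'S_m => f2 (perm_sum B s + u)) - Ex (fun s : 'S_m => f2 (perm_sum B s + t))|
    <= 460 * M * `|u - t|.
Proof.
move=> t2 u2.
have := Ex_stein_d2_lipschitz (K := 10) (z := z) D0 D1 c01 (skew_deriv D l) (dskew_deriv D l)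
  (skew_half l_le) (dskew_le l_le) (ddskew_le D0 D1 l_le) fd f_le xf_le
  (card_perm_gt0 m) C10 one_le10 (minor2_second_moment i j' k l' ra ca sq_a m4) smoothB.
by apply.
Qed.

End Minor.

Let M1 : 1 <= M. Proof. by have := C10; rewrite /M; lra. Qed.

Let corner_bounds i j k q : let A := corner_abs a i j k q in
  [/\ `|a i k + a j q| <= A, `|a i k + a j q - swap_diff a i j k q| <= A
    & `|swap_diff a i j k q| <= A].
Proof.
rewrite /corner_abs /swap_diff /=.
have := ler_norm (a i k); have := ler_norm (a j q); have := ler_norm (a i q).
have := ler_norm (a j k); have := ler_norm (- a i k); have := ler_norm (- a j q).
have := ler_norm (- a i q); have := ler_norm (- a j k); rewrite !normrN.
by split; rewrite ler_norml; lra.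
Qed.

Let corner0 (b : 'M[R]_n) i j k q : 0 <= corner_abs b i j k q.
Proof. by rewrite !addr_ge0. Qed.

Let swap_diff_le (b : 'M[R]_n) i j k q : `|swap_diff b i j k q| <= corner_abs b i j k q.
Proof.
rewrite /corner_abs /swap_diff.
have := ler_norm (b i k); have := ler_norm (b j q); have := ler_norm (b i q).
have := ler_norm (b j k); have := ler_norm (- b i k); have := ler_norm (- b j q).
have := ler_norm (- b i q); have := ler_norm (- b j k); rewrite !normrN.
by rewrite ler_norml; lra.
Qed.

Let swap_diff_gamma i j k q :
  `|swap_diff gamma i j k q| <= corner_abs a i j k q * corner_abs beta i j k q.
Proof.
apply: le_trans (swap_diff_le _ _ _ _ _) _; rewrite /corner_abs.
have gE x y : gamma x y = a x y * beta x y by rewrite mxE.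
rewrite !gE !normrM.
move: (`|a i k|) (`|a j q|) (`|a i q|) (`|a j k|) (normr_ge0 (a i k)) (normr_ge0 (a j q))
  (normr_ge0 (a i q)) (normr_ge0 (a j k)) => x1 x2 x3 x4 p1 p2 p3 p4.
move: (`|beta i k|) (`|beta j q|) (`|beta i q|) (`|beta j k|) (normr_ge0 (beta i k))
  (normr_ge0 (beta j q)) (normr_ge0 (beta i q)) (normr_ge0 (beta j k)).
exact: sum4_mul_le.
Qed.

Let M230 : 0 <= 230 * M. Proof. by have := M1; lra. Qed.

Let amgm (x y : R) : 460 * M * (x ^+ 2 * y) <= 230 * M * (x ^+ 4 + y ^+ 2).
Proof.
have H : 2 * (x ^+ 2 * y) <= x ^+ 4 + y ^+ 2 by have := sqr_ge0 (x ^+ 2 - y); lra.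
by have := ler_wpM2l M230 H; lra.
Qed.

Let swap_diff0 (b : 'M[R]_n) i k : swap_diff b i i k k = 0.
Proof. by rewrite /swap_diff; ring. Qed.

Let sqb := sqnorm_beta sq_a D0 fourth_a.

Let remainder_total (Gam : 'I_n -> 'I_n -> 'I_n -> 'I_n -> R -> R) :
  (forall i k t, Gam i i k k t = 0) ->
  (forall i j (j' : 'I_m.+1) k (l' : 'I_m.+1), j = lift i j' ->
    `|Ex (fun t : 'S_m => Gam i j k (lift k l')
        (a i k + a j (lift k l') + perm_sum (minor2 a i j' k l') t))|
      <= 230 * M * (corner_abs a i j k (lift k l') ^+ 4 + corner_abs beta i j k (lift k l') ^+ 2)) ->
  `|(4 * n%:R)^-1 * \sum_i \sum_j
      E (fun s => Gam i j (s i) (s j) (T s))| <= 448 * (230 * M) * D ^+ 2.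
Proof. exact: (remainder_sum_le M230 fourth_a sqb). Qed.

Let rem1 := (4 * n%:R)^-1 * \sum_i \sum_j E (fun s => wa i j s *
  (f (T s) - f (T s - wa i j s) - wa i j s / 2 * (f1 (T s) + f1 (T s - wa i j s)))).
Let rem2 := (4 * n%:R)^-1 * \sum_i \sum_j E (fun s => swap_diff beta i j (s i) (s j) *
  (f1 (T s) - f1 (T s - wa i j s) - wa i j s / 2 * (f2 (T s) + f2 (T s - wa i j s)))).
Let rem3 := (4 * n%:R)^-1 * \sum_i \sum_j E (fun s => swap_diff gamma i j (s i) (s j) *
  (f2 (T s) - f2 (T s - wa i j s))).

Let shiftE (p w X : R) : p + X - w = X + (p - w). Proof. by ring. Qed.

Let rem1_le : `|rem1| <= 448 * (230 * M) * D ^+ 2.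
Proof.
apply: (remainder_total (Gam := fun i j k q t => swap_diff a i j k q *
  (f t - f (t - swap_diff a i j k q)
   - swap_diff a i j k q / 2 * (f1 t + f1 (t - swap_diff a i j k q))))).
  by move=> i k t; rewrite swap_diff0 mul0r.
move=> i j j' k l' jE; set q := lift k l'.
have [h1 h2 h3] := corner_bounds i j k q.
have := taylor_remainder1 (card_perm_gt0 m) M1 fd f1_deriv f1_le
  (@minor_stein_d2_lipschitz i j' k l') h1 h2 h3.
under eq_Ex => s do rewrite -shiftE [_ + (a i k + a j q)]addrC.
move/le_trans; apply; rewrite ler_wpM2l// lerDl sqr_ge0//.
Qed.

Let rem2_le : `|rem2| <= 448 * (230 * M) * D ^+ 2.
Proof.
apply: (remainder_total (Gam := fun i j k q t => swap_diff beta i j k q *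
  (f1 t - f1 (t - swap_diff a i j k q)
   - swap_diff a i j k q / 2 * (f2 t + f2 (t - swap_diff a i j k q))))).
  by move=> i k t; rewrite swap_diff0 mul0r.
move=> i j j' k l' jE; set q := lift k l'.
have [h1 h2 h3] := corner_bounds i j k q.
have := taylor_remainder2 (card_perm_gt0 m) M1 f1_deriv f1_le
  (@minor_stein_d2 i j' k l') (@minor_stein_d2_lipschitz i j' k l') h1 h2 h3
  (corner0 beta i j k q) (swap_diff_le beta i j k q).
under eq_Ex => s do rewrite -shiftE [_ + (a i k + a j q)]addrC.
by move/le_trans; apply; exact: amgm.
Qed.

Let rem3_le : `|rem3| <= 448 * (230 * M) * D ^+ 2.
Proof.
apply: (remainder_total (Gam := fun i j k q t => swap_diff gamma i j k q *
  (f2 t - f2 (t - swap_diff a i j k q)))).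
  by move=> i k t; rewrite swap_diff0 mul0r.
move=> i j j' k l' jE; set q := lift k l'.
have [h1 h2 h3] := corner_bounds i j k q.
have := taylor_remainder3 M1
  (@minor_stein_d2 i j' k l') (@minor_stein_d2_lipschitz i j' k l') h1 h2 h3
  (corner0 beta i j k q) (swap_diff_gamma i j k q).
under eq_Ex => s do rewrite -shiftE [_ + (a i k + a j q)]addrC.
by move/le_trans; apply; exact: amgm.
Qed.

Local Notation Tb := (perm_sum beta).
Local Notation X := (perm_sum (sq_mx a)).

Let n0 : 0 < n%:R :> R. Proof. by rewrite ltr0n. Qed.
Let n6 : 6 <= n%:R :> R. Proof. by rewrite ler_nat; exact: m4. Qed.
Let invn := inv_n_le sq_a fourth_a.
Let perm0 : (0 < #|{: 'S_n}|)%N := card_perm_gt0 n.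

Let half_inv : (2 * n%:R)^-1 = 2^-1 * n%:R^-1 :> R.
Proof. by rewrite invfM. Qed.

(** Half of [X] in the conditional variance is replaced by (n - 1) / n + l T + Tb. With the other
    deterministic part (n - 1) / (2 n) the constants add up to 1 - 1/n, which accounts for the main
    term and for the -2. *)
Let pair_f : E (fun s => T s * f (T s)) = E (fun s => f1 (T s)) + l / 2 * E (fun s => T s * f1 (T s))
  + 2^-1 * E (fun s => Tb s * f1 (T s))
  + (2 * n%:R)^-1 * E (fun s => (X s + T s ^+ 2 + offdiag a a s - 2) * f1 (T s)) + rem1.
Proof.
rewrite (pair_trapezoid f f1 ra) -/rem1; congr (_ + _).
rewrite -!ExZ -!ExD; apply: eq_Ex => s.
under eq_bigr => i _ do under eq_bigr => j _ do rewrite -expr2.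
rewrite (swap_diff_sqr_sum ra ca sq_a) (perm_sum_beta sq_a) -/l.
by field; rewrite lt0r_neq0.
Qed.

(** Orthogonality of [a] and [beta] is used twice: it removes the deterministic part of the
    conditional covariance, and it makes [perm_sum gamma] centered, so that another exchangeable
    pair produces [rem3]. *)
Let pair_f1 : E (fun s => Tb s * f1 (T s)) = (2^-1 + (2 * n%:R)^-1) * rem3
  + (2 * n%:R)^-1 * (E (fun s => T s * Tb s * f2 (T s)) + E (fun s => offdiag a beta s * f2 (T s)))
  + rem2.
Proof.
rewrite (pair_trapezoid f1 f2 (beta_row ra)) -/rem2; congr (_ + _).
have <- : E (fun s => perm_sum gamma s * f2 (T s)) = rem3.
  rewrite /rem3; have := @exchangeable_pair R n gamma (fun s => f2 (T s)) isT.
  have -> : \sum_i \sum_k gamma i k = 0.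
    transitivity (mx_dot a beta); last exact: mx_dot_beta.
    by apply: eq_bigr => i _; apply: eq_bigr => k _; rewrite mxE.
  under eq_Ex => s do rewrite mulr0 subr0.
  move=> ->; congr (_ * _); apply: eq_bigr => i _; apply: eq_bigr => j _.
  by apply: eq_Ex => s; rewrite perm_sum_swap.
rewrite -ExD -!ExZ -!ExD; apply: eq_Ex => s.
under eq_bigr => i _ do under eq_bigr => j _ do rewrite mulrC.
rewrite (sum_swap_diff_mul _ ra ca (beta_row ra) (beta_col ca))// (mx_dot_beta ra ca sq_a).
by rewrite -/gamma; ring.
Qed.

Let f1_term : `|E (fun s => (X s + T s ^+ 2 + offdiag a a s - 2) * f1 (T s))| <= 3300.
Proof.
have H s : `|(X s + T s ^+ 2 + offdiag a a s - 2) * f1 (T s)|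
    <= 3 * X s + 3 * T s ^+ 2 + 3 * offdiag a a s ^+ 2 + 9.
  rewrite normrM mulrC.
  have H1 : `|X s + T s ^+ 2 + offdiag a a s - 2| <=
      X s + T s ^+ 2 + offdiag a a s ^+ 2 + 3.
    exact: norm_add_sub2_le (sq_ge0 a s) (sqr_ge0 _).
  apply: le_trans (ler_pM (normr_ge0 _) (normr_ge0 _) (f1_le _) H1) _.
  by rewrite !mulrDr; lra.
apply: le_trans (Ex_norm_le H) _; rewrite !ExD !ExZ ExC//.
have eX : E (fun s => X s) <= 1.
  by rewrite (sq_mean sq_a) ler_pdivrMr ?n0 // mul1r gerBl ler01.
have eT := second_moment_le ra sq_a; have eR := offdiag_self ra ca sq_a.
by move: (E _) (E _) (E _) eX eT eR => x t r *; lra.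
Qed.

(** The pointwise bound 8 / D on f'' is affordable because [Tb] has second moment O(D^2); the part 5
    |x| brings in T^2 Tb and with it the fourth moment of [T]. *)
Let TTb_term : `|E (fun s => T s * Tb s * f2 (T s))| <= 800.
Proof.
have H s : `|T s * Tb s * f2 (T s)| <= (8 / D) * `|T s * Tb s| + 5 * `|T s ^+ 2 * Tb s|.
  rewrite normrM mulrC; apply: le_trans (ler_wpM2r (normr_ge0 _) (f2_le _)) _.
  by rewrite mulrDl lerD2l -mulrA -normrM mulrA -expr2.
apply: le_trans (Ex_norm_le H) _; rewrite ExD !ExZ.
have D6 : 0 < 6 * D by have := D0; lra.
have y1 := Ex_young T Tb D6.
have y2 := Ex_young (fun s => T s ^+ 2) Tb (ltr01 : 0 < 1 :> R).
have eT := second_moment_le ra sq_a; have eB := beta_second_moment ra sq_a D0 fourth_a.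
have eT4 := fourth_moment_le ra ca sq_a D0 D1 fourth_a n6.
have e4 : E (fun s => (T s ^+ 2) ^+ 2) = E (fun s => T s ^+ 4).
  by apply: eq_Ex => s; rewrite -exprM.
rewrite e4 in y2.
apply: (TTb_arith D0 D1) y1 y2 eT eB eT4.
Qed.

Let offdiag_term : `|E (fun s => offdiag a beta s * f2 (T s))| <= 4500.
Proof.
have H s : `|offdiag a beta s * f2 (T s)|
    <= (8 / D) * `|1 * offdiag a beta s| + 5 * `|T s * offdiag a beta s|.
  rewrite normrM mulrC; apply: le_trans (ler_wpM2r (normr_ge0 _) (f2_le _)) _.
  by rewrite mulrDl mul1r lerD2l -mulrA -normrM.
apply: le_trans (Ex_norm_le H) _; rewrite ExD !ExZ.
have D200 : 0 < 200 * D by have := D0; lra.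
have y1 := Ex_young (fun=> 1) (offdiag a beta) D200.
have y2 := Ex_young T (offdiag a beta) (ltr0n R 200 : 0 < 200 :> R).
have eT := second_moment_le ra sq_a; have eB := offdiag_beta ra ca sq_a D0 fourth_a.
rewrite expr1n (ExC perm0) in y1.
apply: (offdiag_arith D0 D1) y1 y2 eT eB.
Qed.

Let Q := 448 * (230 * M) * D ^+ 2.

Let inv0 : 0 <= n%:R^-1 :> R. Proof. by rewrite invr_ge0 ltW. Qed.
Let inv1 : n%:R^-1 <= 1 :> R. Proof. by rewrite invf_le1// ler1n. Qed.

Let Tb_f1 : `|E (fun s => Tb s * f1 (T s))| <= 2 * Q + 10600 * D ^+ 2.
Proof.
move: pair_f1; rewrite half_inv => e.
exact: pair_f1_arith inv0 invn inv1 e rem2_le rem3_le TTb_term offdiag_term.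
Qed.

Lemma Ex_stein_expansion :
  `|E (fun s => T s * f (T s)) - (E (fun s => f1 (T s)) + l / 2 * E (fun s => T s * f1 (T s)))|
    <= 2 * Q + 11900 * D ^+ 2.
Proof.
move: pair_f; rewrite half_inv => e.
exact: pair_f_arith inv0 invn e rem1_le Tb_f1 f1_term.
Qed.

Let stein_res x := x * f x + ramp D z x - c.

(** 1 + l x / 2 inverts 1 - kap up to O(D^2 x^2), so the two derivative terms of the expansion
    reassemble the residual of the Stein equation. *)
Let stein_res_sub x : `|stein_res x - f1 x - l / 2 * (x * f1 x)| <= 3 * D ^+ 2 * x ^+ 2.
Proof.
have -> : stein_res x - f1 x - l / 2 * (x * f1 x) =
    stein_res x * ((skew D l x - l / 2 * x) + l / 2 * x * skew D l x).
  by rewrite /stein_d1 -/(stein_res x); ring.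
have h1 : `|stein_res x| <= 2 by exact: stein_res_le.
have h2 := skew_lin D0 l_le x; have h3 := skew_le D0 l_le x.
have h4 : `|l / 2 * x * skew D l x| <= D ^+ 2 * x ^+ 2.
  have -> : D ^+ 2 * x ^+ 2 = (D * `|x|) * (D * `|x|).
    by rewrite -expr2 exprMn real_normK// num_real.
  rewrite normrM ler_pM// normrM ler_wpM2r// normrM (@ger0_norm _ 2^-1)//.
  by move: l_le => l_le'; lra.
rewrite normrM; have -> : 3 * D ^+ 2 * x ^+ 2 = 2 * (2^-1 * D ^+ 2 * x ^+ 2 + D ^+ 2 * x ^+ 2).
  by field.
by rewrite ler_pM//; apply: le_trans (ler_normD _ _) _; exact: lerD.
Qed.

Lemma Ex_ramp_const : `|E (fun s => ramp D z (T s)) - c| <= 2 * Q + 12000 * D ^+ 2.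
Proof.
have e : E (fun s => ramp D z (T s)) - c =
    E (fun s => stein_res (T s) - f1 (T s) - l / 2 * (T s * f1 (T s)))
    - (E (fun s => T s * f (T s)) - (E (fun s => f1 (T s)) + l / 2 * E (fun s => T s * f1 (T s)))).
  rewrite -[in LHS](ExC perm0 c) -ExB -ExZ -ExD -!ExB; apply: eq_Ex => s.
  by rewrite /stein_res; ring.
rewrite e; apply: le_trans (ler_normB _ _) _.
apply: le_trans (lerD (Ex_norm_le (fun s => stein_res_sub (T s))) Ex_stein_expansion) _.
rewrite ExZ.
have H := ler_wpM2l (sqr_ge0 D) (second_moment_le ra sq_a).
by move: (E _) (D ^+ 2) (sqr_ge0 D) (Q) H => x d d0 q H; lra.
Qed.

Lemma cdf_edgeworth_sub : `|F a z - edgeworth lam z| <= 209 * (1000 * M) * D ^+ 2.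
Proof.
have h1 : `|c - edgeworth lam z| <= 12500 * D ^+ 2.
  apply: (@stein_const_edgeworth R D lam l z c f) => //.
  - exact: skewness_le.
  - exact: skewness'_sub.
have h2 : `|E (fun s => ramp D z (T s)) - F a z| <= 2 * C1 * D ^+ 2.
  apply: Ex_ramp_cdf => // z' y yD; apply: smooth => //; exact: N_refl.
have h3 := Ex_ramp_const.
apply: le_trans (ler_distD c _ _) _.
apply: le_trans (lerD (ler_distD (E (fun s => ramp D z (T s))) _ _) (lexx _)) _.
rewrite (distrC (F a z)).
apply: le_trans (lerD (lerD h2 h3) h1) _; rewrite /Q.
have CM : C1 = M - 10 by rewrite /M [10 + _]addrC addrK.
have H : 10 * D ^+ 2 <= M * D ^+ 2.
  by apply: ler_wpM2r (sqr_ge0 D) _ _ _; rewrite lerDl ltW.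
rewrite CM; exact: constant_arith (sqr_ge0 D) H.
Qed.

End SteinExpansion.

(** Settles the case of [D] bounded below, where 1 + 16 D is itself O(D^2). *)
Lemma cdf_edgeworth_trivial (R : realType) (n : nat) (a : 'M[R]_n) (D lam z : R) :
  0 < D -> `|lam| <= D -> `|F a z - edgeworth lam z| <= 1 + 16 * D.
Proof.
move=> D0 lamD.
have H1 : `|F a z - Phi z| <= 1.
  have /andP[f0 f1] : 0 <= F a z <= 1 := unif_cdf01 (perm_sum a) (card_perm_gt0 n) z.
  by have /andP[p0 p1] := Phi01 z; rewrite ler_norml; lra.
have H2 : normal_pdf 0 1 z * `|z ^+ 2 - 1| <= 48 * 2.
  apply: normal_pdf01_poly => //.
  have z0 := sqr_ge0 z; have -> : z ^+ 6 = (z ^+ 2) ^+ 3 by rewrite -exprM.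
  move: (z ^+ 2) z0 => y y0.
  have y3 : 0 <= y ^+ 3 by exact: exprn_ge0.
  have : y <= 1 + y ^+ 3 by have := mulr_ge0 y0 (sqr_ge0 (y - 1)); have := sqr_ge0 (y - 1); nra.
  by rewrite ler_norml; lra.
have pz : 0 <= normal_pdf 0 1 z :> R by exact: normal_pdf_ge0.
rewrite /edgeworth.
have -> : F a z - (Phi z - 6^-1 * lam * (z ^+ 2 - 1) * normal_pdf 0 1 z) =
  (F a z - Phi z) + 6^-1 * lam * (normal_pdf 0 1 z * (z ^+ 2 - 1)) by ring.
apply: le_trans (ler_normD _ _) _; apply: lerD => //.
have -> : 16 * D = 6^-1 * D * (48 * 2) by field.
rewrite normrM; apply: ler_pM => //; last by rewrite normrM (ger0_norm pz).
by rewrite normrM ger0_norm ?invr_ge0 ?ler0n// ler_wpM2l ?invr_ge0 ?ler0n.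
Qed.

Lemma cdf_edgeworth_le (R : realType) (m : nat) (a : 'M[R]_m.+2) (D C1 z : R) :
  row_centered a -> col_centered a -> sqnorm a = m.+2%:R - 1 ->
  0 < D -> \sum_i \sum_k a i k ^+ 4 = m.+2%:R * D ^+ 2 -> 0 < C1 ->
  (forall (z y : R) (p : nat) (B : 'M[R]_p), 0 <= y <= D -> N 8 a B ->
     `|Delta2 y (F B) z| <= C1 * (D ^+ 2 + y ^+ 2)) ->
  `|F a z - edgeworth (skewness a) z| <= 209 * (1000 * (10 + C1)) * D ^+ 2.
Proof.
move=> ra ca sq_a D0 fourth_a C10 smooth.
have lamD := skewness_le sq_a D0 fourth_a.
(* Below the threshold 1/n <= 4 D^2 < 1/6, so n > 6 and both the fourth moment bound and the moment
   bound for minors apply; also D <= 1. *)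
have [big|small] := leP 1 (24 * D ^+ 2).
  apply: le_trans (cdf_edgeworth_trivial a z D0 lamD) _.
  have : 0 <= C1 * D ^+ 2 by rewrite mulr_ge0 ?sqr_ge0// ltW.
  have D5 : 1 <= 5 * D.
    rewrite leNgt; apply/negP => D5.
    have : D * D <= D * 5^-1 by apply: ler_wpM2l; lra.
    by rewrite -expr2; lra.
  have : D <= 5 * D ^+ 2 by have := ler_wpM2l (ltW D0) D5; rewrite mulr1 expr2; lra.
  by move: (D ^+ 2) big => d *; lra.
have D1 : D <= 1.
  rewrite leNgt; apply/negP => D1.
  by have : 1 * 1 <= D * D; [apply: ler_pM; lra|rewrite -expr2; lra].
have m4 : (4 <= m)%N.
  have n0 : 0 < m.+2%:R :> R by rewrite ltr0n.
  have : m.+2%:R^-1 < 6^-1 :> R.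
    by apply: le_lt_trans (inv_n_le sq_a fourth_a) _; lra.
  by rewrite ltf_pV2 ?posrE// ltr_nat; lia.
have lD := skewness'_le sq_a D0 fourth_a.
have [||||f [c [c01 fd f_le xf_le]]] :=
  @stein_solution R (skew D (skewness' a)) (ramp D z).
- exact: has_deriv_continuous (skew_deriv _ _).
- exact: skew_half.
- exact: has_deriv_continuous (ramp_deriv _ _).
- exact: ramp01.
exact: cdf_edgeworth_sub fd f_le xf_le.
Qed.

(** * Return to the original matrix *)

Section HatMatrix.
Variables (R : realType) (m : nat) (A : 'M[R]_m.+2).
Hypothesis sigma0 : 0 < sigma A.
Local Notation n := (m.+2).

Lemma hat_row_centered : row_centered (hat_mx A).
Proof.
move=> i; under eq_bigr => j _ do rewrite mxE.
by rewrite -mulr_suml breve_row_centered ?mul0r.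
Qed.

Lemma hat_col_centered : col_centered (hat_mx A).
Proof.
move=> j; under eq_bigr => i _ do rewrite mxE.
by rewrite -mulr_suml breve_col_centered ?mul0r.
Qed.

Let n1 : 0 < n%:R - 1 :> R. Proof. by rewrite subr_gt0 ltr1n. Qed.

Lemma sqnorm_hat : sqnorm (hat_mx A) = n%:R - 1.
Proof.
have e : (n%:R - 1) * sigma A ^+ 2 = sqnorm (breve_mx A).
  rewrite sqr_sqrtr; first by rewrite mulrA divff ?mul1r// gt_eqF.
  by rewrite mulr_ge0 ?invr_ge0 ?(ltW n1)// (sqnorm_ge0 (breve_mx A)).
have -> : sqnorm (hat_mx A) = sqnorm (breve_mx A) / sigma A ^+ 2.
  rewrite /sqnorm mulr_suml; apply: eq_bigr => i _; rewrite mulr_suml.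
  by apply: eq_bigr => j _; rewrite mxE expr_div_n.
by rewrite -e mulfK// expf_neq0// gt_eqF.
Qed.

Lemma fourth_hat : \sum_i \sum_k hat_mx A i k ^+ 4 = n%:R * D A ^+ 2.
Proof.
rewrite sqr_sqrtr; last first.
  rewrite mulr_ge0 ?invr_ge0//.
  by apply: sumr_ge0 => i _; apply: sumr_ge0 => k _; exact: exprn_ge0.
rewrite mulrA divff ?mul1r ?pnatr_eq0//.
apply: eq_bigr => i _; apply: eq_bigr => k _.
by rewrite -normrX ger0_norm// -[4%N]/(2 * 2)%N exprM sqr_ge0.
Qed.

(** The inequality 1/n <= 4 D^2 excludes D = 0. *)
Lemma D_gt0 : 0 < D A.
Proof.
rewrite lt_neqAle sqrtr_ge0 andbT eq_sym; apply/eqP => D0.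
have := inv_n_le sqnorm_hat fourth_hat.
by rewrite D0 expr0n mulr0 leNgt invr_gt0 ltr0n.
Qed.

Lemma std_perm_sumE : std_perm_sum A =1 perm_sum (hat_mx A).
Proof.
move=> s; rewrite /std_perm_sum -perm_sum_breve// /perm_sum mulr_suml.
by apply: eq_bigr => i _; rewrite [in RHS]mxE.
Qed.

Lemma FstdE z : Fstd A z = F (hat_mx A) z.
Proof.
rewrite /Fstd /F /unif_cdf /unif_prob; congr (_%:R / _).
by apply: eq_card => s; rewrite !inE std_perm_sumE.
Qed.

Lemma e1E z : e1 A z = edgeworth (skewness (hat_mx A)) z.
Proof. by rewrite /e1 psiE. Qed.

End HatMatrix.
Theorem theorem2p4 (R : realType) :
  exists K4 K5 : R,
    [/\ 0 < K4, 0 < K5 &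
      forall (n : nat) (A : 'M[R]_n) (C1 : R),
        (2 <= n)%N -> 0 < sigma A -> 0 < C1 ->
        (forall (z y : R) (m : nat) (B : 'M[R]_m),
            0 <= y <= D A -> N 8 (hat_mx A) B ->
            `|Delta2 y (F B) z| <= C1 * (D A ^+ 2 + y ^+ 2)) ->
        (ereal_sup (range (fun z : R => `|Fstd A z - e1 A z|%:E))
           <= ((K4 * C1 + K5) * D A ^+ 2)%:E)%E].
Proof.
have pos k : 0 < k.+1%:R :> R by rewrite ltr0n.
(* The bound 209000 (10 + C1) D^2 of [cdf_edgeworth_le], split into its part linear in [C1] and its
   constant part. *)
exists (209 * 1000), (209 * (1000 * 10)); split.
- exact: mulr_gt0 (pos 208) (pos 999).
- exact: mulr_gt0 (pos 208) (mulr_gt0 (pos 999) (pos 9)).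
move=> [|[|m]] // A C1 _ sigma0 C10 smooth.
apply: ge_ereal_sup => _ [z _ <-]; rewrite lee_fin FstdE e1E.
rewrite (addrC (_ * C1)) -[209 * 1000 * C1]mulrA -!mulrDr.
exact: cdf_edgeworth_le z (hat_row_centered A) (hat_col_centered A) (sqnorm_hat sigma0)
  (D_gt0 sigma0) (fourth_hat A) C10 smooth.
Qed.
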